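(* Each of the four $(S^2\times\mathbb{R})$-spaces, namely the product $S^2\times S^1$, the nonorientable (twisted) $S^2$-bundle over $S^1$, the product $\mathbb{R}\mathbf{P}^2\times S^1$, and the connected sum $\mathbb{R}\mathbf{P}^3\#\mathbb{R}\mathbf{P}^3$, has a triangulation with at most $15$ vertices.
   Context: A triangulation of a closed manifold $M$ is a finite (abstract) simplicial complex whose geometric realization is homeomorphic to $M$. An $(S^2\times\mathbb{R})$-space is a closed $3$-manifold modeled on Thurston's geometry $S^2\times\mathbb{R}$; it is known (Tollefson) that, up to homeomorphism, these are exactly the four manifolds listed in the claim. *)

(* Defs.v *)
From HB Require Import structures.
From Stdlib Require Import Relation_Operators.
From mathcomp Require Import all_boot all_order all_algebra.
From mathcomp Require Import all_classical all_reals all_analysis.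
Set Implicit Arguments.
Unset Strict Implicit.
Unset Printing Implicit Defensive.
Import Order.TTheory GRing.Theory Num.Theory.
Import numFieldNormedType.Exports.
Local Open Scope classical_set_scope.
Local Open Scope ring_scope.

Definition homeomorphic (X Y : topologicalType) : Prop :=
  exists (f : X -> Y) (g : Y -> X),
    [/\ continuous f, continuous g, cancel f g & cancel g f].

(* The empty face is not recorded, and every element of 'I_n is a vertex, so
   that the number of vertices of K is n. *)
Definition simplicial_complex (n : nat) (K : {set {set 'I_n}}) : Prop :=
  [/\ forall i : 'I_n, [set i]%SET \in K,
      finset.set0 \notin K
    & forall s t : {set 'I_n},
        s \in K -> t \subset s -> t != finset.set0 -> t \in K].

(* Points are given by their barycentric coordinates. *)
Definition realization (R : realType) (n : nat) (K : {set {set 'I_n}}) :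
    set 'rV[R]_n :=
  [set x | [/\ forall i, 0 <= x 0 i, \sum_i x 0 i = 1
             & [set i | x 0 i != 0]%SET \in K]].
Arguments realization R {n} K.

Definition triangulates (R : realType) (n : nat) (K : {set {set 'I_n}})
    (M : topologicalType) : Prop :=
  simplicial_complex K /\ homeomorphic (realization R K) M.

Definition has_triangulation_le (R : realType) (k : nat) (M : topologicalType) :
    Prop :=
  exists (n : nat) (K : {set {set 'I_n}}), (n <= k)%N /\ triangulates R K M.

(* Quotient of X by the equivalence relation generated by r. *)
Section QuotientBy.
Variables (X : topologicalType) (r : X -> X -> Prop).

Definition gen_rel (x y : X) : bool := `[< clos_refl_sym_trans X r x y >].

Lemma gen_rel_equiv : equiv_class_of gen_rel.
Proof.
split=> [x|x y|y x z]; first by apply/asboolP; exact: rst_refl.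
  by apply/asboolP/asboolP; exact: rst_sym.
by move=> /asboolP xy /asboolP yz; apply/asboolP; exact: rst_trans xy yz.
Qed.

Definition gen_equiv : equiv_rel X := EquivRelPack gen_rel_equiv.

Definition quotient_by : topologicalType := quotient_topology {eq_quot gen_equiv}%qT.

Definition quotient_by_pi (x : X) : quotient_by := (\pi_({eq_quot gen_equiv}) x)%qT.
End QuotientBy.

(* The norm of the library on row vectors is the maximum norm. *)
Definition sqnorm (R : realType) (n : nat) (x : 'rV[R]_n) : R :=
  \sum_i x 0 i ^+ 2.

Definition sphere (R : realType) (n : nat) : set 'rV[R]_n.+1 :=
  [set x | sqnorm x = 1].
Arguments sphere : clear implicits.

Definition projective_space (R : realType) (n : nat) : topologicalType :=
  quotient_by (fun x y : sphere R n => \val y = - \val x).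
Arguments projective_space : clear implicits.

Definition mapping_torus (R : realType) (X : topologicalType) (h : X -> X) :
    topologicalType :=
  quotient_by (fun p q : X * set_type (`[0, 1] : set R) =>
    [/\ \val p.2 = 0, \val q.2 = 1 & q.1 = h p.1]).
Arguments mapping_torus R {X} h.

Definition reflect_fun (R : realType) (n : nat) (x : 'rV[R]_n.+1) :
    'rV[R]_n.+1 :=
  \row_i (if i == 0 then - x 0 i else x 0 i).

Lemma reflect_subproof (R : realType) (n : nat) (x : sphere R n) :
  reflect_fun (\val x) \in sphere R n.
Proof.
case: x => x /= /set_mem sx; apply/mem_set; rewrite /sphere /= -[RHS]sx.
by apply: eq_bigr => i _; rewrite mxE; case: ifP; rewrite ?sqrrN.
Qed.

Definition sphere_reflection (R : realType) (n : nat) (x : sphere R n) :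
    sphere R n :=
  exist _ (reflect_fun (\val x)) (reflect_subproof x).

(* A hyperplane reflection reverses the orientation of the sphere, so that its
   mapping torus is the nonorientable bundle. *)
Definition twisted_sphere_bundle (R : realType) : topologicalType :=
  mapping_torus R (@sphere_reflection R 2).

Definition topsum_fam (X Y : topologicalType) (b : bool) : topologicalType :=
  if b then Y else X.
Definition topsum (X Y : topologicalType) : topologicalType :=
  {b : bool & topsum_fam X Y b}.
Definition topsum_inl (X Y : topologicalType) (x : X) : topsum X Y :=
  existT (topsum_fam X Y) false x.
Definition topsum_inr (X Y : topologicalType) (y : Y) : topsum X Y :=
  existT (topsum_fam X Y) true y.

Definition puncture (R : realType) (n : nat) (X : topologicalType)
    (f : 'rV[R]_n -> X) : set X :=
  ~` (f @` [set v | sqnorm v < 1]).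

(* Here f and g are meant to be open embeddings of R^n: the images of the open
   unit ball are removed, and the boundary spheres are identified along the
   map f v |-> g v. *)
Definition connected_sum (R : realType) (n : nat) (X Y : topologicalType)
    (f : 'rV[R]_n -> X) (g : 'rV[R]_n -> Y) : topologicalType :=
  quotient_by (fun p q : topsum (puncture f) (puncture g) =>
    exists (x : puncture f) (y : puncture g) (v : 'rV[R]_n),
      [/\ p = topsum_inl _ x, q = topsum_inr _ y, sqnorm v = 1,
          \val x = f v & \val y = g v]).

Definition homogenize (R : realType) (n : nat) (v : 'rV[R]_n) : 'rV[R]_n.+1 :=
  row_mx (const_mx 1 : 'rV[R]_1) v.

Definition normalize (R : realType) (n : nat) (x : 'rV[R]_n) : 'rV[R]_n :=
  (Num.sqrt (sqnorm x))^-1 *: x.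

Lemma normalize_subproof (R : realType) (n : nat) (v : 'rV[R]_n) :
  normalize (homogenize v) \in sphere R n.
Proof.
have s0 : 0 < sqnorm (homogenize v).
  have h : homogenize v 0 (lshift n 0 : 'I_(1 + n)) = 1.
    exact: etrans (row_mxEl _ _ _ _) (mxE _ _ _ _).
  rewrite /sqnorm (bigD1 (lshift n 0 : 'I_(1 + n))) //= h expr1n.
  by rewrite ltr_pwDl // sumr_ge0 // => i _; exact: sqr_ge0.
apply/mem_set; rewrite /sphere /= {1}/sqnorm /normalize.
under eq_bigr do rewrite mxE exprMn.
rewrite -mulr_sumr exprVn sqr_sqrtr ?ltW // mulVf //; exact: lt0r_neq0.
Qed.

(* v |-> [1 : v] *)
Definition affine_chart (R : realType) (n : nat) (v : 'rV[R]_n) :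
    projective_space R n :=
  quotient_by_pi _ (exist _ (normalize (homogenize v)) (normalize_subproof v)
             : sphere R n).

(* RP^3 has an orientation-reversing self-homeomorphism, so its connected sum
   with itself does not depend on the balls and the gluing map chosen. *)
Definition RP3_sum_RP3 (R : realType) : topologicalType :=
  connected_sum (@affine_chart R 3) (@affine_chart R 3).

(* Main.v *)
(* If a complex contains the join of a simplex A with the boundary of a simplex B
   as the whole star of A, a bistellar flip replaces it by the join of the
   boundary of A with B. With m the minimum of the coordinates over A, the map
   x |-> x - m (1_A - (|A| / |B|) 1_B) is a homeomorphism of the realizations.
     So
   it suffices to triangulate each manifold somehow and to apply a sequence of
   flips that leaves 15 vertices.

   The first triangulations are quotients of order complexes of products of
   posets: the realization of the order complex of P x Q is the product of those
   of P and Q, the barycentric coordinates of a pair of points being the lengths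
   of the intersections of two families of intervals. The posets are those of
     the
   cross-polytope, of the boundary of the cube, which is compatible with the
   antipodal map, and of a subdivided interval;
     RP^3 # RP^3 consists of two copies
   of S^2 x [-1, 1] modulo (u, t) ~ (- u, - t), glued along their boundaries. *)
Require Import Defs.
From HB Require Import structures.
From Stdlib Require Import Relation_Operators NArith.
From mathcomp Require Import all_boot all_order all_algebra.
From mathcomp Require Import all_classical all_reals all_analysis.
From mathcomp Require Import lra ring zify.
Set Implicit Arguments.
Unset Strict Implicit.
Unset Printing Implicit Defensive.
Import Order.TTheory GRing.Theory Num.Theory.
Import numFieldNormedType.Exports.
Local Open Scope classical_set_scope.
Local Open Scope ring_scope.

(** * Topology *)

(** The obstacle is to keep the glued complex simplicial, with points that can be recovered from
    their coordinates. Two conditions achieve this: adjacent vertices never get the same label, and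
    two pairs of adjacent vertices with the same labels are related by exactly one of the symmetries
    divided out. They dictate the models. The octahedron modulo -1 violates the second, because v
    and -v are both adjacent to w; the barycentric subdivision of the boundary of the cube satisfies
    it. Likewise an interval glued at its ends needs three edges. The four complexes start with 24,
    18, 52 and 52 vertices. Each manifold is mapped to its complex by one explicit continuous
    bijection; compactness replaces a formula for the inverse. What concerns a particular complex
    (its tetrahedra, the fact that every clique lies in one of them, the flips) is computed on
    lists. Only the test that accompanies a flip is proved sound, so the way in which the flips were
    found need not be trusted. *)

Lemma homeomorphic_trans (X Y Z : topologicalType) :
  homeomorphic X Y -> homeomorphic Y Z -> homeomorphic X Z.
Proof.
move=> [f [f' [cf cf' fK f'K]]] [g [g' [cg cg' gK g'K]]].
exists (g \o f), (f' \o g'); split.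
- by move=> x; apply: continuous_comp; [exact: cf|exact: cg].
- by move=> x; apply: continuous_comp; [exact: cg'|exact: cf'].
- exact: can_comp.
- exact: can_comp.
Qed.

Lemma homeomorphic_sym (X Y : topologicalType) :
  homeomorphic X Y -> homeomorphic Y X.
Proof. by move=> [f [g [? ? ? ?]]]; exists g, f; split. Qed.

Lemma set_val_continuous (X : topologicalType) (A : set X) :
  continuous (\val : A -> X).
Proof. exact: initial_continuous. Qed.

Lemma set_type_continuous (X Y : topologicalType) (A : set Y) (f : X -> A) :
  continuous (\val \o f) -> continuous f.
Proof.
move=> cf; apply/continuousP => U [V oV <-].
by move/continuousP: cf => /(_ _ oV).
Qed.

Lemma compact_set_type (X : topologicalType) (A : set X) :
  compact A -> compact [set: A].
Proof.
move=> cA F FF _.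
have FA : F [set x | A (\val x)] by apply: filterS _ filterT => x _;
  exact: (@set_valP _ A x).
have [p [Ap clp]] := cA (\val @ F) _ FA.
exists (exist _ p (mem_set Ap)); split=> // B C FB [U [[V oV <-] Vp VC]].
have FB' : F [set x | (\val @` B) (\val x)] by apply: filterS FB => x Bx;
  exists x.
have [_ [[x Bx <-] Vx]] := clp _ _ FB' (open_nbhs_nbhs (conj oV Vp)).
by exists x; split=> //; exact: VC.
Qed.

Lemma hausdorff_inj (X Y : topologicalType) (f : X -> Y) :
  continuous f -> injective f -> hausdorff_space Y -> hausdorff_space X.
Proof.
move=> cf fi hY p q clpq; apply/fi/hY => A B /cf /= pA /cf /= qB.
by have [x [/= xA xB]] := clpq _ _ pA qB; exists (f x).
Qed.

Lemma compact_bij_homeomorphic (X Y : topologicalType) (f : X -> Y) :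
  compact [set: X] -> hausdorff_space Y -> continuous f -> injective f ->
  (forall y, exists x, f x = y) -> homeomorphic Y X.
Proof.
move=> cX hY cf fi /choice[g gK].
have fK : cancel f g by move=> x; apply: fi; rewrite gK.
apply: homeomorphic_sym; exists f, g; split=> //.
apply/continuous_closedP => C cC.
rewrite (_ : g @^-1` C = f @` C); last first.
  by apply/seteqP; split=> y /=; [exists (g y)|case=> x Cx <-; rewrite fK].
apply: compact_closed => //; apply: continuous_compact.
  exact: continuous_subspaceT.
exact: subclosed_compact cC cX _.
Qed.

(** Openness of [q] is asked only at [x]. This serves for the product of a quotient map with an
    identity, and for a map on RP^3 that is studied only outside a ball. *)
Lemma open_surj_continuous_at (X Y Z : topologicalType) (q : X -> Y) (F : Y ->
  Z) x :
  (forall U, nbhs x U -> nbhs (q x) (q @` U)) ->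
  {for x, continuous (F \o q)} -> {for q x, continuous F}.
Proof.
move=> qo cF W /cF /= /qo; apply: filterS => _ [x' /= x'W <-]; exact: x'W.
Qed.

Section Quotient.
Variables (X : topologicalType) (r : X -> X -> Prop).

Lemma quotient_by_pi_surj (a : quotient_by r) : exists x,
  a = quotient_by_pi r x.
Proof. by exists (repr a); rewrite /quotient_by_pi reprK. Qed.

Lemma quotient_by_piP x y :
  quotient_by_pi r x = quotient_by_pi r y <-> clos_refl_sym_trans X r x y.
Proof.
split=> [/eqmodP|xy]; first by rewrite /= /gen_rel => /asboolP.
by apply/eqmodP; apply/asboolP.
Qed.

Lemma quotient_by_pi_continuous : continuous (quotient_by_pi r).
Proof. exact: pi_continuous. Qed.

Lemma quotient_by_compact : compact [set: X] -> compact [set: quotient_by r].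
Proof.
move=> cX; rewrite (_ : setT = quotient_by_pi r @` setT); last first.
  by apply/seteqP; split=> // a _; have [x ->] := quotient_by_pi_surj a;
    exists x.
apply: continuous_compact cX.
exact/continuous_subspaceT/quotient_by_pi_continuous.
Qed.

Definition quotient_lift (Y : Type) (f : X -> Y) (a : quotient_by r) : Y :=
  f (repr a).

Lemma quotient_liftE (Y : Type) (f : X -> Y) x :
  (forall x y, r x y -> f x = f y) -> quotient_lift f (quotient_by_pi r x)
    = f x.
Proof.
move=> rf; have cf a b : clos_refl_sym_trans X r a b -> f a = f b.
  by elim=> [? ? /rf||? ? _|? ? ? _ -> _ ->] //.
by apply/cf/quotient_by_piP; rewrite /quotient_by_pi reprK.
Qed.

Lemma quotient_lift_continuous (Y : topologicalType) (f : X -> Y) :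
  (forall x y, r x y -> f x = f y) -> continuous f ->
  continuous (quotient_lift f).
Proof.
move=> rf cf; apply/quotient_continuous.
rewrite (_ : _ \o _ = f) //; apply/funext => x; exact: quotient_liftE.
Qed.

Lemma quotient_lift_inj (Y : Type) (f : X -> Y) :
  (forall x y, f x = f y -> clos_refl_sym_trans X r x y) ->
  injective (quotient_lift f).
Proof.
move=> fr a b /fr /quotient_by_piP; by rewrite /quotient_by_pi !reprK.
Qed.
End Quotient.

(** * Barycentric coordinates of products of order complexes *)

(** Meant for two families of barycentric coordinates: both have total 1, so a pointwise inequality
    between them is an equality. *)
Lemma le_sum_eq (R : realType) (I : finType) (f g : I -> R) :
  (forall i, f i <= g i) -> \sum_i g i <= \sum_i f i -> f =1 g.
Proof.
move=> fg sgf i; apply/eqP; rewrite eq_sym -subr_eq0; apply/eqP.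
have : \sum_i (g i - f i) <= 0 by rewrite sumrB subr_le0.
have gf j : 0 <= g j - f j by rewrite subr_ge0.
move=> s0; apply: (@psumr_eq0P _ _ predT (fun j => g j - f j)) => //.
by apply/eqP; rewrite eq_le s0 sumr_ge0.
Qed.

Lemma le_sum_supp (R : realType) (I : finType) (A B : pred I) (f : I -> R) :
  (forall i, 0 <= f i) -> (forall i, A i -> f i != 0 -> B i) ->
  \sum_(i | A i) f i <= \sum_(i | B i) f i.
Proof.
move=> f0 AB; rewrite !(big_mkcond _ f) /=; apply: ler_sum => i _.
case: ifP => Ai; case: ifP => // Bi.
by case: (eqVneq (f i) 0) => [->//|/(AB _ Ai)]; rewrite Bi.
Qed.

Section Points.
Variables (R : realType).

(* The points of the clique complex of cmp, given by their barycentric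
   coordinates; for cmp := comparability le it is the order complex of le. *)
Definition cpoint (V : finType) (cmp : rel V) (x : V -> R) : Prop :=
  [/\ forall v, 0 <= x v, \sum_v x v = 1
    & forall v w, x v != 0 -> x w != 0 -> cmp v w].

Definition poset (P : finType) (le : rel P) : Prop :=
  [/\ reflexive le, antisymmetric le & transitive le].

Definition comparability (P : finType) (le : rel P) : rel P :=
  fun p q => le p q || le q p.

Section Cumulative.
Variables (P : finType) (le : rel P).

Definition upto (x : P -> R) (p : P) : R := \sum_(q | le q p) x q.
Definition below (x : P -> R) (p : P) : R := \sum_(q | le q p && (q != p)) x q.

Lemma uptoE x p : reflexive le -> upto x p = below x p + x p.
Proof. by move=> r; rewrite /upto (bigD1 p) //= addrC. Qed.

Lemma upto_le_sum x p : (forall q, 0 <= x q) -> upto x p <= \sum_q x q.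
Proof. by move=> x0; apply: le_sum_supp. Qed.

Lemma below_ge0 x p : (forall q, 0 <= x q) -> 0 <= below x p.
Proof. by move=> x0; apply: sumr_ge0. Qed.

Hypothesis po : poset le.
Let r : reflexive le. Proof. by case: po. Qed.
Let a : antisymmetric le. Proof. by case: po. Qed.
Let t : transitive le. Proof. by case: po. Qed.

Lemma chain_max (S : {set P}) : S != finset.set0 ->
  (forall p q, p \in S -> q \in S -> comparability le p q) ->
  exists2 m, m \in S & forall q, q \in S -> le q m.
Proof.
move=> /set0Pn[p0 p0S] chS.
case: (@arg_maxnP _ p0 (mem S) (fun p => #|[set q | le q p]%SET|) p0S) =>
  m mS mmax.
exists m => // q qS; have /orP[//|qm] := chS _ _ qS mS.
have sub : [set u | le u m]%SET \subset [set u | le u q]%SET.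
  by apply/fintype.subsetP => u; rewrite !inE => /t; apply.
have /eqP e : [set u | le u m]%SET == [set u | le u q]%SET.
  by rewrite eqEcard sub; exact: mmax.
have : q \in [set u | le u q]%SET by rewrite inE.
by rewrite -e inE.
Qed.

(** The intervals [[below y p, upto y p]] of the support, a chain, tile [[0, \sum_p y p]], and those
    of the other elements have length 0. The induction removes the greatest element of the support,
    whose interval comes last. *)
Lemma telescope (m : R -> R) (y : P -> R) :
  (forall p q, y p != 0 -> y q != 0 -> comparability le p q) ->
  \sum_p (m (upto y p) - m (below y p)) = m (\sum_p y p) - m 0.
Proof.
move: {2}#|[set p | y p != 0]%SET| (leqnn #|[set p | y p != 0]%SET|) => n.
have zero z q : z q = 0 -> m (upto z q) - m (below z q) = 0.
  by move=> zq; rewrite uptoE // zq addr0 subrr.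
elim: n y => [|n IH] y.
  rewrite leqn0 cards_eq0 => /eqP y0 _.
  have {}y0 p : y p = 0.
    have : p \notin [set p | y p != 0]%SET by rewrite y0 inE.
    by rewrite inE => /negbNE/eqP.
  by rewrite !big1 ?subrr // => p _; rewrite zero.
move=> yn ch; have [S0|] := eqVneq [set p | y p != 0]%SET finset.set0.
  by apply: IH => //; rewrite S0 cards0.
move=> SN0; have [|M] := chain_max SN0; first by move=> p q; rewrite !inE;
  exact: ch.
rewrite inE => yM maxM.
pose y' q := if q == M then 0 else y q.
have y'0 q : y' q != 0 -> y q != 0 by rewrite /y'; case: (q == M) => //;
  rewrite eqxx.
have y'M : y' M = 0 by rewrite /y' eqxx.
have y'E q : q != M -> y' q = y q by rewrite /y' => /negbTE ->.
have -> : \sum_p y p = y M + \sum_p y' p.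
  rewrite (bigD1 M) //= [\sum_p y' p](bigD1 M) //= y'M add0r; congr (_ + _).
  by apply: eq_bigr => q /y'E ->.
have := IH y'; rewrite [in X in X -> _](bigD1 M) //= zero ?add0r //.
move=> IH'; rewrite (bigD1 M) //=.
have sumM : \sum_(i | i != M) (m (upto y i) - m (below y i)) =
            \sum_(i | i != M) (m (upto y' i) - m (below y' i)).
  apply: eq_bigr => q qM; have [yq|yq] := eqVneq (y q) 0.
    by rewrite !zero // y'E.
  (* Setting the coordinate of [M] to 0 does not affect the other elements of the support: by
     maximality and antisymmetry, [M] is not below them. *)
  have e : upto y q = upto y' q.
    apply: eq_bigr => u uq; rewrite /y'; case: eqP => // uM; subst u.
    by move: qM; rewrite (@a q M) ?eqxx // uq maxM ?inE.
  rewrite -e; congr (_ - m _).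
  by apply: (addIr (y q)); rewrite -uptoE // e uptoE // y'E.
rewrite sumM IH' ?addrA.
- have uM : upto y M = y M + \sum_p y' p.
    rewrite /upto (bigD1 M) //=; congr (_ + _).
    rewrite [RHS](bigD1 M) //= y'M add0r [RHS](eq_bigr y) => [|q /y'E -> //].
    rewrite big_mkcond /= [RHS]big_mkcond /=; apply: eq_bigr => q _.
    case: (eqVneq q M) => qM /=; rewrite ?andbF ?andbT //.
    case: ifPn => // leqM; apply/esym/eqP; apply: contraNT leqM => yq.
    by apply: maxM; rewrite inE.
  have -> : below y M = \sum_p y' p.
    by apply: (addIr (y M)); rewrite -uptoE // uM addrC.
  by rewrite uM subrK.
- rewrite -ltnS; apply: leq_trans yn; apply: proper_card.
  apply/properP; split; first by apply/fintype.subsetP => q;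
    rewrite !inE => /y'0.
  by exists M; rewrite !inE // y'M eqxx.
- by move=> p q /y'0 yp /y'0 yq; exact: ch.
Qed.
End Cumulative.
End Points.

Ltac no_minmax t :=
  lazymatch t with
  | context [@Order.max _ _ _ _] => fail
  | context [@Order.min _ _ _ _] => fail
  | _ => idtac
  end.

Ltac minmax_lra :=
  repeat match goal with
  | |- context [@Order.max _ _ ?a ?b] =>
      no_minmax a; no_minmax b; case: (leP a b) => ?
  | |- context [@Order.min _ _ ?a ?b] =>
      no_minmax a; no_minmax b; case: (leP a b) => ?
  end; intros; lra.

Section Product.
Variables (R : realType) (P Q : finType) (lP : rel P) (lQ : rel Q).
Hypotheses (poP : poset lP) (poQ : poset lQ).

Definition prodrel : rel (P * Q) := fun v w => lP v.1 w.1 && lQ v.2 w.2.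

Lemma prodrel_poset : poset prodrel.
Proof.
case: poP poQ => rP aP tP [rQ aQ tQ]; split.
- by move=> v; rewrite /prodrel rP rQ.
- move=> [p q] [p' q'] /andP[/= /andP[pp' qq'] /andP[p'p q'q]].
  by rewrite (@aP p p') ?pp' // (@aQ q q') ?qq'.
- move=> [p q] [p' q'] [p'' q''] /andP[/= h1 h2] /andP[/= h3 h4].
  by rewrite /prodrel /= (tP _ _ _ h1 h3) (tQ _ _ _ h2 h4).
Qed.

(* The intervals [below x p, upto x p] partition [0, 1], and so do the
   intervals [below y q, upto y q]; the coordinate at (p, q) is the length of
   the intersection of the intervals of p and q. *)
Definition prodc (x : P -> R) (y : Q -> R) (v : P * Q) : R :=
  Num.max 0 (Num.min (upto lP x v.1) (upto lQ y v.2)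
             - Num.max (below lP x v.1) (below lQ y v.2)).

Definition marg1 (z : P * Q -> R) (p : P) : R := \sum_q z (p, q).
Definition marg2 (z : P * Q -> R) (q : Q) : R := \sum_p z (p, q).

(** The function [Num.max 0 (Num.min b t - a)] of [t] is the length of the part of [[a, b]] to the
    left of [t]. Written as its increment from [c] to [d], an overlap telescopes over a family of
    adjacent intervals. *)
Lemma interval_overlap (a b c d : R) : a <= b -> c <= d ->
  Num.max 0 (Num.min b d - Num.max a c) =
  Num.max 0 (Num.min b d - a) - Num.max 0 (Num.min b c - a).
Proof.
by move=> ab cd; minmax_lra.
Qed.

Lemma prodc_ge0 x y v : 0 <= prodc x y v.
Proof. by rewrite /prodc le_max lexx. Qed.

Lemma marg1_prodc x y p :
  cpoint (comparability lP) x -> cpoint (comparability lQ) y ->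
  marg1 (prodc x y) p = x p.
Proof.
move=> [x0 x1 _] [y0 y1 ych]; case: (poP) (poQ) => rP _ _ [rQ _ _].
have bu : below lP x p <= upto lP x p by rewrite uptoE // lerDl.
pose m t := Num.max 0 (Num.min (upto lP x p) t - below lP x p).
rewrite /marg1 (eq_bigr (fun q => m (upto lQ y q) - m (below lQ y q)));
  last first.
  by move=> q _; rewrite /prodc interval_overlap // [leRHS]uptoE // lerDl.
rewrite telescope // y1 /m /=.
have := upto_le_sum lP p x0; have := below_ge0 lP p x0; rewrite x1.
have := uptoE x p rP; move: bu.
by minmax_lra.
Qed.

Lemma prodc_prodcC x y p q : prodc x y (p, q) =
  Num.max 0 (Num.min (upto lQ y q) (upto lP x p)
             - Num.max (below lQ y q) (below lP x p)).
Proof. by rewrite /prodc /= minC maxC [Num.max (below _ _ _) _]maxC maxC. Qed.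
End Product.

Section ProductPoints.
Variables (R : realType) (P Q : finType) (lP : rel P) (lQ : rel Q).
Hypotheses (poP : poset lP) (poQ : poset lQ).
Local Notation prodc := (prodc lP lQ).
Local Notation cmpP := (comparability lP).
Local Notation cmpQ := (comparability lQ).
Local Notation cmpPQ := (comparability (prodrel lP lQ)).
Implicit Types (x : P -> R) (y : Q -> R) (z : P * Q -> R).

Lemma marg2_prodc x y q : cpoint cmpP x -> cpoint cmpQ y ->
  marg2 (prodc x y) q = y q.
Proof.
move=> cx cy; rewrite -(marg1_prodc poQ poP q cy cx).
by apply: eq_bigr => p _; rewrite prodc_prodcC.
Qed.

Lemma marg1_neq0 z p : marg1 z p != 0 -> exists q, z (p, q) != 0.
Proof.
move=> h; apply/existsP; apply: contraNT h => /existsPn h.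
by apply/eqP; apply: big1 => q _; apply/eqP; have := h q; rewrite negbK.
Qed.

Lemma marg2_neq0 z q : marg2 z q != 0 -> exists p, z (p, q) != 0.
Proof.
move=> h; apply/existsP; apply: contraNT h => /existsPn h.
by apply/eqP; apply: big1 => p _; apply/eqP; have := h p; rewrite negbK.
Qed.

Lemma sum_marg1 z : \sum_p marg1 z p = \sum_v z v.
Proof. by rewrite pair_big; apply: eq_bigr => -[]. Qed.

Lemma sum_marg2 z : \sum_q marg2 z q = \sum_v z v.
Proof. by rewrite exchange_big; exact: sum_marg1. Qed.

Lemma marg1_point z : cpoint cmpPQ z -> cpoint cmpP (marg1 z).
Proof.
move=> [z0 z1 zch]; split; first by move=> p; apply: sumr_ge0.
  by rewrite sum_marg1.
move=> p p' /marg1_neq0[q h] /marg1_neq0[q' h'].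
by have := zch _ _ h h'; rewrite /comparability => /orP[] /andP[-> _];
  rewrite ?orbT.
Qed.

Lemma marg2_point z : cpoint cmpPQ z -> cpoint cmpQ (marg2 z).
Proof.
move=> [z0 z1 zch]; split; first by move=> p; apply: sumr_ge0.
  by rewrite sum_marg2.
move=> p p' /marg2_neq0[q h] /marg2_neq0[q' h'].
by have := zch _ _ h h'; rewrite /comparability => /orP[] /andP[_ ->];
  rewrite ?orbT.
Qed.

Lemma prodc_neq0 x y v : prodc x y v != 0 ->
  Num.max (below lP x v.1) (below lQ y v.2) <
  Num.min (upto lP x v.1) (upto lQ y v.2).
Proof.
rewrite /prodc -subr_gt0; rewrite /Order.max; case: ifP => // h;
  rewrite eqxx //.
Qed.

Lemma upto_below (T : finType) (le : rel T) (u : T -> R) a b : poset le ->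
  (forall p, 0 <= u p) -> le a b -> a != b -> upto le u a <= below le u b.
Proof.
move=> [r an tr] u0 ab nab; apply: (@le_sum_supp _ _ (le^~ a) (fun q =>
  le q b && (q != b))) => // c ca _.
rewrite (tr _ _ _ ca ab); apply: contra nab => /eqP cb; subst c.
by apply/eqP/an; rewrite ab.
Qed.

(** Overlapping intervals cannot cross. If p comes before p' and q' before q, the overlaps at (p, q)
    and (p', q') give below(q) < upto(p) <= below(p') < upto(q') <= below(q). *)
Lemma prodc_point x y : cpoint cmpP x -> cpoint cmpQ y ->
  cpoint cmpPQ (prodc x y).
Proof.
move=> cx cy; split.
- by move=> v; exact: prodc_ge0.
- rewrite -sum_marg1 -[RHS](let: And3 _ h _ := cx in h).
  by apply: eq_bigr => p _; rewrite marg1_prodc.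
move=> [p q] [p' q'] h h'.
have pos u v : prodc x y (u, v) != 0 -> x u != 0 /\ y v != 0.
  move=> /prodc_neq0; rewrite gt_max !lt_min /= => /andP[/andP[+ _] /andP[_ +]].
  case: (poP) (poQ) => rP _ _ [rQ _ _].
  by rewrite !uptoE // !ltrDl => /lt0r_neq0 -> /lt0r_neq0 ->.
have [xp yq] := pos _ _ h; have [xp' yq'] := pos _ _ h'.
case: cx cy => x0 _ xch [y0 _ ych].
have := prodc_neq0 h; have := prodc_neq0 h'.
rewrite !gt_max !lt_min /= => /andP[/andP[a1 a2] /andP[a3 a4]]
  /andP[/andP[b1 b2] /andP[b3 b4]].
case: (poP) (poQ) => rP _ _ [rQ _ _].
have crossP u v : lP u v -> upto lP x u > below lP x v -> u = v.
  move=> uv h1; apply/eqP; apply: contraTT h1 => nuv; rewrite -leNgt.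
  exact: upto_below.
have crossQ u v : lQ u v -> upto lQ y u > below lQ y v -> u = v.
  move=> uv h1; apply/eqP; apply: contraTT h1 => nuv; rewrite -leNgt.
  exact: upto_below.
rewrite /comparability /prodrel /=.
have [/orP[pp'|p'p] /orP[qq'|q'q]] := (xch _ _ xp xp', ych _ _ yq yq').
- by rewrite pp' qq'.
- have [e|ne] := eqVneq p p'; first by rewrite e rP q'q orbT.
  have [e'|ne'] := eqVneq q q'; first by rewrite e' rQ pp'.
  have l1 := upto_below poP x0 pp' ne.
  have l2 : upto lQ y q' <= below lQ y q by apply: upto_below;
    rewrite // eq_sym.
  lra.
- have [e|ne] := eqVneq p p'; first by rewrite e rP qq'.
  have [e'|ne'] := eqVneq q q'; first by rewrite e' rQ p'p orbT.
  have l1 : upto lP x p' <= below lP x p by apply: upto_below;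
    rewrite // eq_sym.
  have l2 := upto_below poQ y0 qq' ne'.
  lra.
- by rewrite p'p q'q orbT.
Qed.

(** The interval of [v] along the chain that supports [z] has length [z v] and lies in the intervals
    of [v.1] and [v.2] for the marginals, so [z v] is at most their overlap. Both sides have total
    1, hence they agree. *)
Lemma prodc_marg z : cpoint cmpPQ z -> prodc (marg1 z) (marg2 z) =1 z.
Proof.
move=> cz; have [z0 z1 zch] := cz.
have po := prodrel_poset poP poQ; have [rPQ aPQ _] := po.
case: (poP) (poQ) => rP aP _ [rQ aQ _].
apply: fsym; apply: le_sum_eq; last first.
  have [_ -> _] := prodc_point (marg1_point cz) (marg2_point cz).
  by rewrite z1.
move=> v; have [->|zv] := eqVneq (z v) 0; first exact: prodc_ge0.
have u1 : upto (prodrel lP lQ) z v <= upto lP (marg1 z) v.1.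
  rewrite /upto /marg1 pair_big_dep /= [leRHS](eq_bigr z) => [|[]//].
  by apply: le_sum_supp => // w /andP[-> _].
have u2 : upto (prodrel lP lQ) z v <= upto lQ (marg2 z) v.2.
  rewrite /upto /marg2 (exchange_big_dep xpredT) //= pair_big_dep /=
    [leRHS](eq_bigr z) => [|[]//].
  by apply: le_sum_supp => // w /andP[_ ->].
(* Here the chain condition enters: an element of the support whose first component is strictly
   below [v.1] is comparable with [v], hence below it. *)
have b1 : below lP (marg1 z) v.1 <= below (prodrel lP lQ) z v.
  rewrite /below /marg1 pair_big_dep /= [leLHS](eq_bigr z) => [|[]//].
  apply: le_sum_supp => // w; rewrite andbT => /andP[wv nwv] zw.
  have nvw : w != v by apply: contra nwv => /eqP ->.
  rewrite nvw andbT; case/orP: (zch _ _ zw zv) => // /andP[vw _].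
  by case/eqP: nwv; apply: aP; rewrite wv.
have b2 : below lQ (marg2 z) v.2 <= below (prodrel lP lQ) z v.
  rewrite /below /marg2 (exchange_big_dep xpredT) //= pair_big_dep /=
    [leLHS](eq_bigr z) => [|[]//].
  apply: le_sum_supp => // w; rewrite ?andbT => /andP[wv nwv] zw.
  have nvw : w != v by apply: contra nwv => /eqP ->.
  rewrite nvw andbT; case/orP: (zch _ _ zw zv) => // /andP[_ vw].
  by case/eqP: nwv; apply: aQ; rewrite wv.
have := uptoE z v rPQ.
by rewrite /prodc; minmax_lra.
Qed.

Lemma prodc_inj x x' y y' : cpoint cmpP x -> cpoint cmpQ y -> 
  cpoint cmpP x' -> cpoint cmpQ y' -> prodc x y =1 prodc x' y' ->
    x =1 x' /\ y =1 y'.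
Proof.
move=> cx cy cx' cy' e; split=> p.
  rewrite -(marg1_prodc poP poQ p cx cy) -(marg1_prodc poP poQ p cx' cy').
  exact: eq_bigr.
rewrite -(marg2_prodc p cx cy) -(marg2_prodc p cx' cy').
exact: eq_bigr.
Qed.
End ProductPoints.

(** * Bistellar flips *)

Lemma row_continuous_at (R : realType) (n : nat) (X : topologicalType)
    (F : X -> 'I_n -> R) a :
  (forall i, {for a, continuous (fun x => F x i)}) ->
  {for a, continuous (fun x => \row_i F x i : 'rV[R]_n)}.
Proof.
move=> cF U [P nP PU].
have : \forall x \near a, forall i, P 0 i (F x i).
  apply: filter_forall => i; apply: (cF i).
  by have := nP 0 i; rewrite mxE.
by apply: filterS => x h; apply: PU => i j; rewrite [i]ord1 mxE.
Qed.

Lemma sum_continuous_at (R : realType) (X : topologicalType) (I : finType)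
    (P : pred I) (F : I -> X -> R) a :
  (forall i, {for a, continuous (F i)}) ->
  {for a, continuous (fun x => \sum_(i | P i) F i x)}.
Proof.
move=> cF; rewrite /prop_for /continuous_at; elim: (index_enum I) => [|i r IH].
  by rewrite big_nil; under eq_fun do rewrite big_nil; exact: cvg_cst.
rewrite big_cons; under eq_fun do rewrite big_cons.
by case: (P i) => //; exact: (cvgD (cF i) IH).
Qed.

Definition carrier (R : realType) (n : nat) (x : 'rV[R]_n) : {set 'I_n} :=
  [set i | x 0 i != 0]%SET.

(** Compared with [realization], the faces form a predicate: a complex met between two flips is
    described by a list of facets, and labels that are no longer vertices remain as coordinates
    equal to 0. *)
Definition polyhedron (R : realType) (n : nat) (K : {set 'I_n} -> Prop) :
    set 'rV[R]_n :=
  [set x : 'rV[R]_n | [/\ forall i, 0 <= x 0 i,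
    \sum_i x 0 i = 1 & K (carrier x)]].
Arguments polyhedron R {n} K.

Lemma homeomorphic_subsets (X Y : topologicalType) (A : set X) (B : set Y)
    (f : X -> Y) (g : Y -> X) :
  continuous f -> continuous g ->
  (forall x, A x -> B (f x) /\ g (f x) = x) ->
  (forall y, B y -> A (g y) /\ f (g y) = y) -> homeomorphic A B.
Proof.
move=> cf cg fg gf.
have fB (x : A) : f (\val x) \in B.
  by apply/mem_set; have [] := fg _ (set_valP x).
have gA (y : B) : g (\val y) \in A.
  by apply/mem_set; have [] := gf _ (set_valP y).
exists (fun x => exist _ (f (\val x)) (fB x)),
  (fun y => exist _ (g (\val y)) (gA y)).
split.
- apply: set_type_continuous.
  have h : continuous (f \o (\val : A -> X)) by move=> x;
    apply: continuous_comp; [exact: set_val_continuous|exact: cf].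
  exact: h.
- apply: set_type_continuous.
  have h : continuous (g \o (\val : B -> Y)) by move=> x;
    apply: continuous_comp; [exact: set_val_continuous|exact: cg].
  exact: h.
- by move=> x; apply: val_inj => /=; have [] := fg _ (set_valP x).
- by move=> y; apply: val_inj => /=; have [] := gf _ (set_valP y).
Qed.

Section GeometricComplex.
Variables (R : realType) (n : nat).
Implicit Types (K : {set 'I_n} -> Prop) (x : 'rV[R]_n) (A B : {set 'I_n}).

(** The iterated minimum needs a start value; for [a0] in [A] the start value is itself one of the
    coordinates compared, so the result is the true minimum. *)
Definition min_on A a0 x : R := \big[Num.min/x 0 a0]_(i in A) x 0 i.

Lemma min_on_le A a0 x i : i \in A -> min_on A a0 x <= x 0 i.
Proof. exact: bigmin_le_cond. Qed.

Lemma min_on_attained A a0 x : a0 \in A ->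
  exists2 i, i \in A & min_on A a0 x = x 0 i.
Proof.
move=> a0A; rewrite /min_on.
by elim/big_ind: _ => [|u v [i iA ->] [j jA ->]|i iA];
  [exists a0|case: leP => _; [exists i|exists j]|exists i].
Qed.

Lemma min_on_eq A a0 x r : a0 \in A -> (forall i, i \in A -> r <= x 0 i) ->
  (exists2 i, i \in A & x 0 i = r) -> min_on A a0 x = r.
Proof.
move=> a0A rx [i iA xi]; apply/le_anti; rewrite -{1}xi min_on_le //=.
by have [j jA ->] := min_on_attained x a0A; exact: rx.
Qed.

Lemma min_on_continuous A a0 : continuous (min_on A a0).
Proof.
move=> x; suff h (r : seq 'I_n) :
    \big[Num.min/y 0 a0]_(i <- r | i \in A) y 0 i @[y --> x]
    --> \big[Num.min/x 0 a0]_(i <- r | i \in A) x 0 i by exact: h.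
elim: r => [|i r IH].
  by rewrite big_nil; under eq_fun do rewrite big_nil; exact: coord_continuous.
rewrite big_cons; under eq_fun do rewrite big_cons.
case: (i \in A) => //; apply: continuous_min => //; exact: coord_continuous.
Qed.

(* The identity outside the star of A; the inverse is the same map with A and
   B exchanged, because the minimum over B of the coordinates of a point of the
   join of A and the boundary of B is 0. *)
Definition flip A a0 B x : 'rV[R]_n :=
  \row_i (x 0 i - min_on A a0 x * (i \in A)%:R
          + min_on A a0 x * (#|A|%:R / #|B|%:R) * (i \in B)%:R).

Lemma flip_continuous A a0 B : continuous (flip A a0 B).
Proof.
move=> x; apply: row_continuous_at => i.
have cc (c : R) : {for x, continuous (fun=> c : R)} by exact: cst_continuous.
have cm : {for x, continuous (min_on A a0)} by exact: min_on_continuous.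
apply: continuousD; first apply: continuousB; first exact: coord_continuous.
- exact: continuousM cm (cc _).
- exact: continuousM (continuousM cm (cc _)) (cc _).
Qed.

(* K and K' agree except that K contains the join of A and the boundary of B
   where K' contains the join of the boundary of A and B. *)
Definition flip_rel A B K K' : Prop :=
  [/\ forall s, K s -> ~~ (B \subset s),
      forall s, K s -> A \subset s -> s \subset A :|: B,
      forall s, K s -> ~~ (A \subset s) -> K' s &
      forall s : {set 'I_n}, s \subset A :|: B -> A \subset s ->
        ~~ (B \subset s) -> K s].

(** The hypotheses are symmetric under the exchange of [A], [K] with [B], [K']. The same statement
    therefore also treats the reverse flip, and the two maps are mutually inverse. *)
Lemma flip_polyhedron A a0 B b0 K K' x : a0 \in A -> b0 \in B ->
  (forall i, i \in A -> i \notin B) ->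
  flip_rel A B K K' -> flip_rel B A K' K -> polyhedron R K x ->
  polyhedron R K' (flip A a0 B x) /\ flip B b0 A (flip A a0 B x) = x.
Proof.
move=> a0A b0B dAB [KB KA Ks _] [_ _ _ K'AB] [x0 x1 Kx].
have A0 : (0 : R) < #|A|%:R by rewrite ltr0n; apply/card_gt0P; exists a0.
have B0 : (0 : R) < #|B|%:R by rewrite ltr0n; apply/card_gt0P; exists b0.
have AB i : i \in A -> i \in B = false.
  by move=> /dAB/negbTE.
set m := min_on A a0 x; have [a aA mE] := min_on_attained x a0A;
  rewrite -/m in mE.
have m0 : 0 <= m by rewrite mE.
set c := m * (#|A|%:R / #|B|%:R).
have c0 : 0 <= c by rewrite mulr_ge0 // divr_ge0 // ltW.
have fE i : (flip A a0 B x) 0 i = x 0 i - m * (i \in A)%:R + c * (i \in B)%:R.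
  by rewrite mxE.
have mx i : m * (i \in A)%:R <= x 0 i.
  by case: (boolP (i \in A)) => [iA|_]; rewrite ?mulr1 ?mulr0 //;
    exact: min_on_le.
have y0 i : 0 <= (flip A a0 B x) 0 i.
  by rewrite fE addr_ge0 ?subr_ge0 // mulr_ge0.
(* A face of [K] does not contain [B], so some coordinate over [B] was 0 and is now exactly [c]. The
   reverse flip thus measures the amount that was added. *)
have minB : min_on B b0 (flip A a0 B x) = c.
  apply: min_on_eq => // [i iB|].
    by rewrite fE iB mulr1 lerDr subr_ge0.
  have /fintype.subsetPn[b bB] := KB _ Kx; rewrite inE negbK => /eqP xb.
  exists b => //; rewrite fE bB xb.
  by case: (boolP (b \in A)) => [/AB|_]; rewrite ?bB // mulr0 subr0 mulr1 add0r.
have sumI (S : {set 'I_n}) : \sum_i (i \in S)%:R = #|S|%:R :> R.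
  by rewrite -sum1_card natr_sum [RHS]big_mkcond /=; apply: eq_bigr => i _;
    case: ifP.
split; last first.
  apply/rowP => i; rewrite mxE minB fE.
  have -> : c * (#|B|%:R / #|A|%:R) = m.
    by rewrite /c; field; rewrite !lt0r_neq0.
  by ring.
split=> //.
  under eq_bigr do rewrite fE.
  rewrite big_split /= sumrB -!mulr_sumr !sumI x1 /c.
  by field; rewrite !lt0r_neq0.
(* If [m] is 0, the point does not move and its carrier misses a vertex of [A], so it is a face of
   [K']. Otherwise the carrier contains [A] and lies in the join of [A] and [B]; the vertex [a]
   where the minimum is attained then drops out. *)
have [mz|mz] := eqVneq m 0.
  have -> : flip A a0 B x = x.
    by apply/rowP => i; rewrite fE /c mz !mul0r subr0 addr0.
  apply: Ks => //; apply/fintype.subsetPn; exists a => //.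
  by rewrite inE negbK -mE mz.
have mp : 0 < m by rewrite lt0r mz.
have cp : 0 < c by rewrite mulr_gt0 // divr_gt0.
have Ax : A \subset carrier x.
  apply/fintype.subsetP => i iA; rewrite inE lt0r_neq0 //.
  by apply: lt_le_trans mp _; exact: min_on_le.
have /fintype.subsetP xAB := KA _ Kx Ax.
apply: K'AB.
- apply/fintype.subsetP => i; rewrite inE fE finset.setUC => yi.
  have [/xAB//|] := boolP (i \in carrier x).
  rewrite inE negbK !inE => /eqP xi; move: yi; rewrite xi.
  by case: (i \in A); case: (i \in B); rewrite ?orbT // !mulr0 subr0 addr0 eqxx.
- apply/fintype.subsetP => i iB; rewrite inE fE iB mulr1 lt0r_neq0 //.
  by rewrite ltr_wpDl // subr_ge0.
- apply/fintype.subsetPn; exists a => //; rewrite inE fE aA (AB _ aA) -mE.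
  by rewrite mulr1 subrr mulr0 addr0 eqxx.
Qed.

Lemma flip_homeomorphic A B K K' : A != finset.set0 -> B != finset.set0 ->
  (forall i, i \in A -> i \notin B) -> flip_rel A B K K' -> flip_rel B A K' K ->
  homeomorphic (polyhedron R K) (polyhedron R K').
Proof.
move=> /set0Pn[a0 a0A] /set0Pn[b0 b0B] dAB r r'.
have dBA i : i \in B -> i \notin A by apply: contraTN => /dAB.
apply: (@homeomorphic_subsets _ _ _ _ (flip A a0 B) (flip B b0 A)).
- exact: flip_continuous.
- exact: flip_continuous.
- by move=> x; exact: flip_polyhedron.
- by move=> y; exact: flip_polyhedron.
Qed.
End GeometricComplex.

(* A set of labels is encoded by the binary number whose bits are its
   elements. *)
Definition submask (a f : N) : bool := N.eqb (N.ldiff a f) 0.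
Definition mask_of (s : seq N) : N := foldr (fun a m => N.setbit m a) 0%num s.
Definition unmask (n : nat) (f : N) : {set 'I_n} :=
  [set i : 'I_n | N.testbit f (N.of_nat i)]%SET.
Definition facet_complex (n : nat) (L : seq N) (s : {set 'I_n}) : Prop :=
  exists2 f, f \in L & s \subset unmask n f.
Arguments facet_complex : clear implicits.

(** The tests say that no facet contains [B] and that the facets containing [A] are exactly the sets
    [U] minus one element of [B]: the star of [A] is its join with the boundary of [B]. These facets
    give way to the sets [U] minus one element of [A]. *)
Definition flip_step (n : nat) (m : seq N * seq N) (L : seq N) : option (seq N)
  :=
  let A := mask_of m.1 in let B := mask_of m.2 in let U := N.lor A B in
  let starA := seq.filter (submask A) L in
  if [&& m.1 != [::], m.2 != [::], all (N.ltb^~ (N.of_nat n)) (m.1 ++ m.2),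
      N.eqb (N.land A B) 0, all (fun f => ~~ submask B f) L,
      all (fun f => has (fun b => N.eqb f (N.clearbit U b)) m.2) starA
    & all (fun b => has (N.eqb (N.clearbit U b)) starA) m.2]
  then Some (map (N.clearbit U) m.1 ++ seq.filter (fun f => ~~ submask A f) L)
  else None.

Fixpoint flip_steps n (ms : seq (seq N * seq N)) (L : seq N) : option (seq N) :=
  if ms is m :: ms' then
    if flip_step n m L is Some L' then flip_steps n ms' L' else None
  else Some L.

Lemma testbit_mask_of s k : N.testbit (mask_of s) k = (k \in s).
Proof.
elim: s => [//|a s IH]; rewrite /mask_of /= -/(mask_of s)
  N.setbit_eqb inE IH; congr (_ || _).
by apply/N.eqb_spec/eqP.
Qed.

Lemma testbit_clearbit u b k : N.testbit (N.clearbit u b) k = (k != b)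
  && N.testbit u k.
Proof.
rewrite N.clearbit_eqb andbC; congr (_ && _); congr negb.
by apply/N.eqb_spec/eqP.
Qed.

Lemma submaskP a f : reflect (forall k, N.testbit a k ->
  N.testbit f k) (submask a f).
Proof.
apply: (iffP (N.eqb_spec _ _)) => [e k ak|h].
  have := congr1 (N.testbit^~ k) e; rewrite N.ldiff_spec N.bits_0 ak /=.
  by case: N.testbit.
apply: N.bits_inj => k; rewrite N.ldiff_spec N.bits_0.
by case: (boolP (N.testbit a k)) => // /h ->.
Qed.

Section FlipSteps.
Variables (R : realType) (n : nat).

Lemma submask_unmask s f : all (N.ltb^~ (N.of_nat n)) s ->
  submask (mask_of s) f = (unmask n (mask_of s) \subset unmask n f).
Proof.
move=> /allP sn; apply/submaskP/fintype.subsetP => [h i|h k].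
  by rewrite !inE; exact: h.
rewrite testbit_mask_of => ks.
have kn : (N.to_nat k < n)%N by have /N.ltb_lt := sn _ ks; lia.
by have := h (Ordinal kn); rewrite !inE /= Nnat.N2Nat.id testbit_mask_of; apply.
Qed.

Lemma mem_unmask_mask_of s i : (i \in unmask n (mask_of s))
  = (N.of_nat i \in s).
Proof. by rewrite inE testbit_mask_of. Qed.

Lemma unmask_mask_of_neq0 s : all (N.ltb^~ (N.of_nat n)) s -> s != [::] ->
  unmask n (mask_of s) != finset.set0.
Proof.
case: s => // a s /andP[/N.ltb_lt an _] _; apply/set0Pn.
have an' : (N.to_nat a < n)%N by lia.
by exists (Ordinal an'); rewrite mem_unmask_mask_of /= Nnat.N2Nat.id mem_head.
Qed.

Lemma flip_step_homeomorphic m L L' : flip_step n m L = Some L' ->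
  homeomorphic (polyhedron R (facet_complex n L)) (polyhedron R (facet_complex
    n L')).
Proof.
rewrite /flip_step; case: m => sa sb /=.
set A := mask_of sa; set B := mask_of sb; set U := N.lor A B.
case: ifP => // /and5P[sa0 sb0 sn AB0 /and3P[/allP LB /allP SA /allP SB]] [<-].
move: sn; rewrite all_cat => /andP[san sbn].
have UE (i : 'I_n) c : (i \in unmask n (N.clearbit U c)) =
    (N.of_nat i != c) && ((i \in unmask n A) || (i \in unmask n B)).
  by rewrite !inE testbit_clearbit N.lor_spec.
have Uc c : unmask n (N.clearbit U c) \subset unmask n A :|: unmask n B.
  by apply/fintype.subsetP => i; rewrite UE => /andP[_]; rewrite finset.in_setU.
have sub_clear (s : {set 'I_n}) (i : 'I_n) :
    s \subset unmask n A :|: unmask n B -> i \notin s ->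
    s \subset unmask n (N.clearbit U (N.of_nat i)).
  move=> /fintype.subsetP sU si; apply/fintype.subsetP => j js; rewrite UE.
  have := sU _ js; rewrite finset.in_setU => ->; rewrite andbT.
  by apply: contraNneq si => /Nnat.Nat2N.inj/ord_inj <-.
have subAf f (s : {set 'I_n}) : unmask n A \subset s -> s \subset unmask n f ->
  submask A f.
  by move=> As sf; rewrite submask_unmask //; exact: fintype.subset_trans As sf.
have subBf f (s : {set 'I_n}) : unmask n B \subset s -> s \subset unmask n f ->
  submask B f.
  by move=> As sf; rewrite submask_unmask //; exact: fintype.subset_trans As sf.
(* The join of [A] with the boundary of [B] is present before the flip and, by [newface], the join
   of the boundary of [A] with [B] after it. The two facts change places for the reverse flip. *)
have oldface (s : {set 'I_n}) : s \subset unmask n A :|: unmask n B ->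
    ~~ (unmask n B \subset s) -> facet_complex n L s.
  move=> sU /fintype.subsetPn[i iB si].
  move: (iB); rewrite mem_unmask_mask_of => /SB/hasP[f].
  rewrite mem_filter => /andP[_ fL] /N.eqb_spec fE.
  by exists f => //; rewrite -fE; exact: sub_clear.
have newface (s : {set 'I_n}) : s \subset unmask n A :|: unmask n B ->
    ~~ (unmask n A \subset s) ->
    facet_complex n (map (N.clearbit U) sa ++ seq.filter (fun f =>
      ~~ submask A f) L) s.
  move=> sU /fintype.subsetPn[i iA si].
  exists (N.clearbit U (N.of_nat i)); last exact: sub_clear.
  by rewrite mem_cat map_f // -mem_unmask_mask_of.
apply: (@flip_homeomorphic _ _ (unmask n A) (unmask n B)).
- exact: unmask_mask_of_neq0.
- exact: unmask_mask_of_neq0.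
- move=> i; rewrite !inE => iA; apply/negP => iB.
  move/N.eqb_spec: AB0 => /(congr1 (N.testbit^~ (N.of_nat i))).
  by rewrite N.land_spec iA iB N.bits_0.
- split.
  + move=> s [f fL sf]; apply: contra (LB _ fL) => Bs; exact: subBf Bs sf.
  + move=> s [f fL sf] As.
    have /SA/hasP[b _ /N.eqb_spec fE] : f \in seq.filter (submask A) L.
      by rewrite mem_filter fL (subAf _ _ As sf).
    by apply: fintype.subset_trans sf _; rewrite fE.
  + move=> s [f fL sf] As; have [Af|Af] := boolP (submask A f).
      have /SA/hasP[b _ /N.eqb_spec fE] : f \in seq.filter (submask A) L.
        by rewrite mem_filter fL Af.
      apply: newface => //.
      by apply: fintype.subset_trans sf _; rewrite fE.
    by exists f => //; rewrite mem_cat mem_filter fL Af orbT.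
  + by move=> s sU _; exact: oldface.
(* For the reverse flip, no facet of the new list contains [A]: the added ones lack an element of
   [A], and the kept ones passed the filter. *)
- rewrite finset.setUC in newface oldface Uc *; split.
  + move=> s [f]; rewrite mem_cat => /orP[/mapP[a asa ->] sf|].
      have an : (N.to_nat a < n)%N by have /N.ltb_lt := allP san _ asa; lia.
      apply/fintype.subsetPn; exists (Ordinal an).
        by rewrite mem_unmask_mask_of /= Nnat.N2Nat.id.
      apply: contraTN isT => /(fintype.subsetP sf); rewrite UE /= Nnat.N2Nat.id.
      by rewrite eqxx.
    rewrite mem_filter => /andP[Af fL] sf; apply: contra Af => As;
      exact: subAf As sf.
  + move=> s [f]; rewrite mem_cat => /orP[/mapP[a asa ->] sf _|].
      exact: fintype.subset_trans sf (Uc _).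
    rewrite mem_filter => /andP[Af fL] sf Bs.
    by have := LB _ fL; rewrite (subBf _ _ Bs sf).
  + move=> s [f]; rewrite mem_cat => /orP[/mapP[a asa ->] sf Bs|].
      by apply: oldface Bs; exact: fintype.subset_trans sf (Uc _).
    by rewrite mem_filter => /andP[Af fL] sf _; exists f.
  + by move=> s sU _; exact: newface.
Qed.

Lemma flip_steps_homeomorphic ms L L' : flip_steps n ms L = Some L' ->
  homeomorphic (polyhedron R (facet_complex n L)) (polyhedron R (facet_complex
    n L')).
Proof.
elim: ms L => /= [L [->]|m ms IH L].
  by exists id, id; split=> // x; exact: cvg_id.
case E: flip_step => [L1|//] /IH; apply: homeomorphic_trans.
exact: flip_step_homeomorphic E.
Qed.
End FlipSteps.

(** * From a list of facets to a triangulation on the labels that occur *)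

Lemma carrier_neq0 (R : realType) n (x : 'rV[R]_n) :
  \sum_i x 0 i = 1 -> carrier x != finset.set0.
Proof.
move=> x1; apply/eqP => c0; move/eqP: x1; rewrite big1 ?(eq_sym 0) ?oner_eq0 //.
move=> i _; have : i \notin carrier x by rewrite c0 inE.
by rewrite inE negbK => /eqP.
Qed.

(** Flips remove vertices but keep the ambient dimension; this discards the coordinates outside the
    image of [h], which vanish on the polyhedron. The empty set is exempted because
    [simplicial_complex] does not record it. *)
Lemma relabel_homeomorphic (R : realType) (m n : nat) (h : 'I_m -> 'I_n)
    (K : {set 'I_n} -> Prop) (K' : {set 'I_m} -> Prop) :
  injective h -> (forall s, K s -> s \subset codom h) ->
  (forall t : {set 'I_m}, t != finset.set0 -> K' t <-> K (h @: t)%SET) ->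
  homeomorphic (polyhedron R K) (polyhedron R K').
Proof.
move=> hi Kh KK'.
pose f (x : 'rV[R]_n) : 'rV[R]_m := \row_i x 0 (h i).
pose g (y : 'rV[R]_m) : 'rV[R]_n := \row_j \sum_(i | h i == j) y 0 i.
have gh y i : g y 0 (h i) = y 0 i.
  by rewrite mxE (eq_bigl (pred1 i)) ?big_pred1_eq // => j; rewrite (inj_eq hi).
have gnot y j : j \notin codom h -> g y 0 j = 0.
  by move=> jh; rewrite mxE big1 // => i /eqP hij; rewrite -hij codom_f in jh.
have sumh (x : 'rV[R]_n) : (forall j, j \notin codom h -> x 0 j = 0) ->
    \sum_i x 0 (h i) = \sum_j x 0 j.
  move=> x0; rewrite (partition_big h predT) //=; apply: eq_bigr => j _.
  have [/codomP[i ->]|jh] := boolP (j \in codom h).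
    by rewrite (eq_bigl (pred1 i)) ?big_pred1_eq // => k; rewrite (inj_eq hi).
  by rewrite x0 // big1 // => i /eqP hij; rewrite -hij codom_f in jh.
have cgh (y : 'rV[R]_m) : carrier (g y) = (h @: carrier y)%SET.
  apply/finset.setP => j; rewrite inE; apply/idP/imsetP => [gy|[i iy ->]].
    have /codomP[i ji] : j \in codom h by apply: contraNT gy => /gnot ->.
    by exists i => //; rewrite inE -gh -ji.
  by rewrite gh; rewrite inE in iy.
apply: (@homeomorphic_subsets _ _ _ _ f g).
- move=> x; apply: row_continuous_at => i.
  exact: coord_continuous.
- move=> y; apply: row_continuous_at => j.
  by apply: sum_continuous_at => i; exact: coord_continuous.
- move=> x [x0 x1 Kx].
  have xn j : j \notin codom h -> x 0 j = 0.
    move=> jh; apply/eqP; apply: contraNT jh => xj.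
    by apply: (fintype.subsetP (Kh _ Kx)); rewrite inE.
  have gf : g (f x) = x.
    apply/rowP => j; have [/codomP[i ->]|jh] := boolP (j \in codom h).
      by rewrite gh mxE.
    by rewrite gnot // xn.
  have f1 : \sum_i f x 0 i = 1 by under eq_bigr do rewrite mxE; rewrite sumh.
  split=> //; split=> //; first by move=> i; rewrite mxE.
  by apply/KK'; [exact: carrier_neq0|rewrite -cgh gf].
- move=> y [y0 y1 Ky]; have fg : f (g y) = y by apply/rowP => i; rewrite mxE gh.
  split=> //; split.
  + by move=> j; rewrite mxE; apply: sumr_ge0.
  + rewrite -sumh; last exact: gnot.
    by rewrite -y1; apply: eq_bigr => i _; rewrite gh.
  + by rewrite cgh; apply/KK' => //; exact: carrier_neq0.
Qed.

(** The third test excludes labels outside [s]; the last one makes every element of [s] a vertex, as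
    [simplicial_complex] demands of all indices. *)
Definition labels_check n (s : seq N) (L : seq N) : bool :=
  [&& uniq s, all (N.ltb^~ (N.of_nat n)) s,
      all (submask^~ (mask_of s)) L & all (fun a => has (N.testbit^~ a) L) s].

Lemma labels_triangulation (R : realType) n s L (M : topologicalType) :
  labels_check n.+1 s L ->
  homeomorphic (polyhedron R (facet_complex n.+1 L)) M ->
  has_triangulation_le R (size s) M.
Proof.
move=> /and4P[us /allP sn /allP Ls /allP sL] homM.
pose h (i : 'I_(size s)) : 'I_n.+1 := inord (N.to_nat (nth 0%num s i)).
have sn' k : k \in s -> (N.to_nat k < n.+1)%N by move=> /sn /N.ltb_lt; lia.
have hE i : N.of_nat (h i) = nth 0%num s i.
  by rewrite /h inordK ?Nnat.N2Nat.id //; apply/sn'/mem_nth.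
have hi : injective h.
  move=> i j /(congr1 (fun k : 'I__ => N.of_nat k)); rewrite !hE => /eqP.
  by rewrite nth_uniq // => /eqP/ord_inj.
pose K : {set {set 'I_(size s)}} := [set t | (t != finset.set0) &&
  has (fun f => h @: t \subset unmask n.+1 f)%SET L]%SET.
exists (size s), K; split=> //; split.
  split.
  - move=> i; rewrite inE; apply/andP; split.
      by apply/set0Pn; exists i; rewrite inE.
    have /hasP[f fL fi] := sL _ (mem_nth 0%num (ltn_ord i)).
    apply/hasP; exists f => //; apply/fintype.subsetP => j /imsetP[k].
    by rewrite inE => /eqP -> ->; rewrite inE hE.
  - by rewrite inE eqxx.
  - move=> t u; rewrite !inE => /andP[_ /hasP[f fL tf]] ut -> /=.
    apply/hasP; exists f => //; apply: fintype.subset_trans tf; exact: imsetS.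
apply: homeomorphic_trans homM; apply: homeomorphic_sym.
apply: (@relabel_homeomorphic R _ _ h (facet_complex n.+1 L) (fun t =>
  t \in K)) => //.
- move=> t [f fL tf]; apply/fintype.subsetP => j /(fintype.subsetP tf).
  rewrite inE => fj; have /submaskP/(_ _ fj) := Ls _ fL.
  rewrite testbit_mask_of => js; apply/codomP.
  have js' : (index (N.of_nat j) s < size s)%N by rewrite index_mem.
  exists (Ordinal js'); apply/val_inj/Nnat.Nat2N.inj; rewrite hE /=.
  by rewrite nth_index.
- move=> t t0; rewrite inE t0 /=; split=> [/hasP[f fL tf]|[f fL tf]].
    by exists f.
  by apply/hasP; exists f.
Qed.

Definition flips_check n (ms : seq (seq N * seq N)) (s L : seq N) : bool :=
  if flip_steps n ms L is Some L' then labels_check n s L' else false.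

Lemma flips_triangulation (R : realType) n ms s L (M : topologicalType) :
  flips_check n.+1 ms s L ->
  homeomorphic (polyhedron R (facet_complex n.+1 L)) M ->
  has_triangulation_le R (size s) M.
Proof.
rewrite /flips_check; case E: flip_steps => [L'|//] chk homM.
apply: (labels_triangulation chk); apply: homeomorphic_trans homM.
exact/homeomorphic_sym/(flip_steps_homeomorphic R E).
Qed.

Section Cliques.
Variables (V : eqType) (cmp : rel V).

(** * Gluing the vertices of a clique complex *)

Lemma all_pairwise s : (forall v w, v \in s -> w \in s -> cmp v w) ->
  pairwise cmp s.
Proof.
elim: s => //= v s IH h; apply/andP; split.
  by apply/allP => w ws; apply: h; rewrite inE ?eqxx ?ws ?orbT.
by apply: IH => a b as_ bs; apply: h; rewrite inE ?as_ ?bs orbT.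
Qed.

Lemma pairwise_all s v w : symmetric cmp -> pairwise cmp s ->
  v \in s -> w \in s -> v != w -> cmp v w.
Proof.
move=> cmpC; elim: s => //= u s IH /andP[/allP us sp]; rewrite !inE.
move=> /orP[/eqP->|vs] /orP[/eqP->|ws]; first by rewrite eqxx.
- by move=> _; exact: us.
- by move=> _; rewrite cmpC; exact: us.
- exact: IH.
Qed.

(** A chosen vertex is followed only by neighbours that come later in [c], so a clique is generated
    in the order of [c]. With [k] equal to 4 these are the tetrahedra of a 3-dimensional complex. *)
Fixpoint cliques (k : nat) (c : seq V) : seq (seq V) :=
  if k is k'.+1 then
    (fix go c := if c is v :: c' then
       map (cons v) (cliques k' [seq w <- c' | cmp v w]) ++ go c' else [::]) c
  else [:: [::]].

(** Along the search [F] shrinks to those of its members that contain all vertices chosen so far.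
    Finding it nonempty at every node shows that each clique lies in a member of [F]; at depth 0 no
    candidate may remain, so the search has been exhaustive. *)
Fixpoint covers (k : nat) (c : seq V) (F : seq (seq V)) : bool :=
  (F != [::]) &&
  if k is k'.+1 then
    (fix go c := if c is v :: c' then
       covers k' [seq w <- c' | cmp v w] [seq f <- F | v \in f]
         && go c' else true) c
  else c == [::].

Lemma cliquesP k c s : s \in cliques k c -> {subset s <= c} /\ pairwise cmp s.
Proof.
elim: k c s => [|k IH] c s /=; first by rewrite inE => /eqP ->.
elim: c => [//|v c IHc]; rewrite mem_cat => /orP[/mapP[t /IH[tc tp]
  ->]|/IHc[sc sp]].
  split; last first.
    by rewrite /= tp andbT; apply/allP => w /tc; rewrite mem_filter => /andP[].
  move=> w; rewrite !inE => /orP[->//|/tc]; rewrite mem_filter => /andP[_ ->].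
  by rewrite orbT.
by split=> // w /sc; rewrite inE orbC => ->.
Qed.

Lemma coversP k c F s : covers k c F -> subseq s c -> pairwise cmp s ->
  exists2 f, f \in F & {subset s <= f}.
Proof.
have empty (F' : seq (seq V)) : F' != [::] -> exists2 f,
  f \in F' & {subset [::] <= f}.
  by case: F' => // f F' _; exists f; rewrite ?mem_head.
elim: k c F s => [|k IH] c F s /=.
  by move=> /andP[/empty F0 /eqP ->]; rewrite subseq0 => /eqP -> _.
move=> /andP[/empty F0]; case: s => [//|v s].
elim: c => [//|w c IHc] /andP[covw /IHc{}IHc] /=.
case: eqP => [->|_] sc /andP[vs sp]; last by apply: IHc => //=; rewrite vs.
have [|f] := IH _ _ s covw _ sp; first by rewrite subseq_filter vs.
rewrite mem_filter => /andP[wf fF] sf; exists f => // u; rewrite inE.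
by move=> /orP[/eqP ->//|/sf].
Qed.
End Cliques.

Section Gluing.
Variables (R : realType) (V : finType) (cmp : rel V) (vs : seq V).
Variables (n : nat) (p : V -> N).
Hypothesis cmpC : symmetric cmp.
Hypothesis mem_vs : forall v, (v \in vs) = cmp v v.
Hypothesis p_lt : forall v, cmp v v -> (p v < N.of_nat n)%num.
Hypothesis p_inj : forall v w, cmp v w -> p v = p w -> v = w.

Definition glued_facets : seq N :=
  undup [seq mask_of (map p c) | c <- cliques cmp 4 vs].

(** The simplicial map induced by the labelling. At a point of the clique complex each sum has at
    most one nonzero term, because [p] separates adjacent vertices. *)
Definition push (x : V -> R) : 'rV[R]_n :=
  \row_(j < n) \sum_(v | p v == N.of_nat j) x v.

Lemma label_of v : cmp v v -> exists j : 'I_n, p v = N.of_nat j.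
Proof.
move=> /p_lt vn; have vn' : (N.to_nat (p v) < n)%N by lia.
by exists (Ordinal vn'); rewrite /= Nnat.N2Nat.id.
Qed.

Lemma push_continuous_at (X : topologicalType) (x : X -> V -> R) a :
  (forall v, {for a, continuous (fun t => x t v)}) ->
  {for a, continuous (fun t => push (x t))}.
Proof.
move=> cx; apply: row_continuous_at => j; exact: sum_continuous_at.
Qed.

Lemma push_val x v (j : 'I_n) : cpoint cmp x -> x v != 0 -> p v = N.of_nat j ->
  push x 0 j = x v.
Proof.
move=> [_ _ xch] xv vj; rewrite mxE (bigD1 v) ?vj //= big1 ?addr0 // => w.
move=> /andP[/eqP wj nwv]; apply/eqP; apply: contraNT nwv => xw.
by apply/eqP/p_inj; [exact: xch|rewrite wj].
Qed.

Lemma push_neq0 x (j : 'I_n) : push x 0 j != 0 ->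
  exists2 v, p v = N.of_nat j & x v != 0.
Proof.
rewrite mxE => h.
have /existsP[v /andP[/eqP vj xv]] : [exists v,
  (p v == N.of_nat j) && (x v != 0)].
  apply: contraNT h => /existsPn h; apply/eqP; apply: big1 => v vj; apply/eqP.
  by have := h v; rewrite vj negbK.
by exists v.
Qed.

Lemma push_sum x : cpoint cmp x -> \sum_j push x 0 j = 1.
Proof.
move=> [_ x1 xch]; under eq_bigr do rewrite mxE.
rewrite (exchange_big_dep predT) //= -[RHS]x1; apply: eq_bigr => v _.
have [->|xv] := eqVneq (x v) 0; first by rewrite big1.
have [j vj] := label_of (xch v v xv xv).
rewrite (big_pred1 j) // => i; rewrite vj; apply/eqP/eqP => [|->//].
by move=> /Nnat.Nat2N.inj/ord_inj.
Qed.

Lemma push_polyhedron x : covers cmp 5 vs (cliques cmp 4 vs) -> cpoint cmp x ->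
  polyhedron R (facet_complex n glued_facets) (push x).
Proof.
move=> cov cx; have [x0 x1 xch] := cx; split.
- by move=> j; rewrite mxE; apply: sumr_ge0.
- exact: push_sum.
have [|c cc sc] := coversP cov (filter_subseq (fun v => x v != 0) vs).
  apply: all_pairwise => v w; rewrite !mem_filter => /andP[xv _] /andP[xw _].
  exact: xch.
exists (mask_of (map p c)).
  by rewrite mem_undup; apply/mapP; exists c.
apply/fintype.subsetP => j; rewrite inE => /push_neq0[v vj xv].
rewrite inE testbit_mask_of -vj map_f // sc // mem_filter xv mem_vs; exact: xch.
Qed.

(** A facet of the image is the set of labels of a clique [c]. Since [p] is injective on [c], the
    coordinates of [y] can be transported back to [c]. *)
Lemma push_surjective y : polyhedron R (facet_complex n glued_facets) y ->
  exists2 x, cpoint cmp x & push x = y.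
Proof.
move=> [y0 y1 [f]]; rewrite mem_undup => /mapP[c cc ->] /fintype.subsetP yc.
have [cvs cp] := cliquesP cc.
have ccmp v w : v \in c -> w \in c -> cmp v w.
  move=> vc wc; have [<-|vw] := eqVneq v w; first by rewrite -mem_vs cvs.
  exact: pairwise_all cp vc wc vw.
have lab v : v \in c -> exists j : 'I_n, p v = N.of_nat j.
  by move=> vc; apply: label_of; exact: ccmp.
(* The option accounts for vertices outside [c], whose labels may be out of range. *)
have [q qE] : exists q : V -> option 'I_n, forall v, v \in c -> 
    exists2 j, q v = Some j & p v = N.of_nat j.
  exists (fun v => [pick j : 'I_n | p v == N.of_nat j]) => v /lab[j vj].
  case: pickP => [i /eqP vi|/(_ j)]; first by exists i.
  by rewrite vj eqxx.
pose x v := if v \in c then if q v is Some j then y 0 j else 0 else 0.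
have xE v (j : 'I_n) : v \in c -> p v = N.of_nat j -> x v = y 0 j.
  move=> vc vj; rewrite /x vc; have [i -> vi] := qE _ vc.
  by congr (y 0 _); apply/ord_inj/Nnat.Nat2N.inj; rewrite -vi.
have xc v : x v != 0 -> v \in c by rewrite /x; case: ifP => //; rewrite eqxx.
have px : push x = y.
  apply/rowP => j; rewrite mxE; have [yj|yj] := eqVneq (y 0 j) 0.
    rewrite yj; apply: big1 => v /eqP vj; apply/eqP.
    have [vc|vc] := boolP (v \in c); first by rewrite (xE v j) // yj.
    by rewrite /x (negbTE vc).
  have : N.of_nat j \in map p c.
    by rewrite -testbit_mask_of; have := yc j; rewrite !inE; apply.
  move=> /mapP[v vc vj]; rewrite (bigD1 v) ?vj //= (xE v j) // big1 ?addr0 //.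
  move=> w /andP[/eqP wj nwv]; apply/eqP; apply: contraNT nwv => xw.
  by apply/eqP/p_inj; [apply: ccmp => //; exact: xc|rewrite wj].
exists x => //.
have x0 v : 0 <= x v by rewrite /x; case: ifP => // _; case: (q v).
split=> //; last by move=> v w /xc vc /xc wc; exact: ccmp.
rewrite -y1 -px; under [RHS]eq_bigr do rewrite mxE.
rewrite [RHS](exchange_big_dep predT) //=; apply: eq_bigr => v _.
have [->|xv] := eqVneq (x v) 0; first by rewrite big1.
have [j vj] := lab _ (xc _ xv).
rewrite (big_pred1 j) // => i; rewrite vj; apply/eqP/eqP => [|->//].
by move=> /Nnat.Nat2N.inj/ord_inj.
Qed.

(* G indexes the partial symmetries that are quotiented out by p, and E g is the
   graph of g. *)
Lemma push_fiber (G : Type) (E : G -> V -> V -> Prop) x x' :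
  (forall v v', cmp v v -> cmp v' v' -> p v = p v' -> exists g, E g v v') ->
  (forall g h v v' w w', cmp v w -> cmp v' w' -> E g v v' -> E h w w' -> g = h)
    ->
  cpoint cmp x -> cpoint cmp x' -> push x = push x' ->
  exists g, forall v, x v != 0 -> exists2 v', E g v v' & x' v' = x v.
Proof.
move=> E1 E2 cx cx' xx'; have [x0 x1 xch] := cx; have [_ _ xch'] := cx'.
(* Equal images force each vertex of the support of [x] to have a partner with the same label and
   coordinate in that of [x']. The symmetry found may depend on the vertex; comparison with one
   fixed vertex [v0] through [E2] shows that it does not. *)
have partner v : x v != 0 -> exists g v', [/\ E g v v',
  x' v' != 0 & x' v' = x v].
  move=> xv; have [j vj] := label_of (xch _ _ xv xv).
  have e := push_val cx xv vj.
  have [|v' vj' xv'] := @push_neq0 x' j; first by rewrite -xx' e.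
  have [g Eg] := E1 v v' (xch _ _ xv xv) (xch' _ _ xv' xv')
    (etrans vj (esym vj')).
  by exists g, v'; split=> //; rewrite -e xx' (push_val cx' xv' vj').
have [v0 xv0] : exists v, x v != 0.
  apply/existsP; apply: contraPT x1 => /existsPn h.
  rewrite big1 => [/esym/eqP|v _]; first by rewrite oner_eq0.
  by apply/eqP; have := h v; rewrite negbK.
have [g [v0' [Eg xv0' _]]] := partner _ xv0.
exists g => v xv; have [h [v' [Eh xv' e]]] := partner _ xv.
by exists v' => //; rewrite (E2 g h _ _ _ _ (xch _ _ xv0 xv)
  (xch' _ _ xv0' xv') Eg Eh).
Qed.

(** Agreement on the support gives [x v <= x' (s v)] everywhere, and both families have total 1. *)
Lemma cpoint_reindex (s : V -> V) (x x' : V -> R) : injective s ->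
  cpoint cmp x -> cpoint cmp x' -> (forall v, x v != 0 -> x' (s v) = x v) ->
  forall v, x' (s v) = x v.
Proof.
move=> si [x0 x1 _] [x0' x1' _] e v; apply/esym; move: v; apply: le_sum_eq.
  by move=> v; have [->|/e ->] := eqVneq (x v) 0.
by rewrite x1 -x1' [leRHS](reindex_inj si).
Qed.
End Gluing.

Lemma polyhedron_homeomorphic (R : realType) n (K : {set 'I_n} -> Prop)
    (M : topologicalType) (F : M -> 'rV[R]_n) :
  compact [set: M] -> continuous F -> injective F ->
  (forall m, polyhedron R K (F m)) ->
  (forall y, polyhedron R K y -> exists m, F m = y) ->
  homeomorphic (polyhedron R K) M.
Proof.
move=> cM cF Fi FK Fs.
have FK' m : F m \in polyhedron R K by apply/mem_set.
pose f m : polyhedron R K := exist _ (F m) (FK' m).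
apply: (@compact_bij_homeomorphic M (polyhedron R K) f) => //.
- apply: (@hausdorff_inj _ _ (\val : polyhedron R K -> 'rV[R]_n)).
  + exact: set_val_continuous.
  + exact: val_inj.
  + exact: norm_hausdorff.
- exact: set_type_continuous.
- by move=> m m' /(congr1 val) /Fi.
- by move=> y; have [m e] := Fs _ (set_valP y); exists m; apply: val_inj.
Qed.

(** * Spheres and intervals *)

(** In [cpoint] an element can carry weight only if it is related to itself, so cutting the relation
    down to [D], diagonal included, deletes the vertices outside [D]. *)
Definition induced (V : Type) (D : pred V) (cmp : rel V) : rel V :=
  fun v w => [&& D v, D w & cmp v w].

Lemma cpoint_on (R : realType) (V : finType) (D : pred V) (cmp : rel V)
  (x : V -> R) :
  cpoint (induced D cmp) x <-> cpoint cmp x /\ forall v, x v != 0 -> D v.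
Proof.
split=> [[x0 x1 ch]|[[x0 x1 ch] xD]]; last first.
  by split=> // v w xv xw; rewrite /induced !xD // ch.
split; last by move=> v xv; have /and3P[] := ch v v xv xv.
by split=> // v w xv xw; have /and3P[] := ch v w xv xw.
Qed.

Lemma upto_aut (R : realType) (P : finType) (le : rel P) (s : P -> P) (x : P ->
  R) p :
  injective s -> {mono s : a b / le a b} -> upto le (x \o s)
    p = upto le x (s p).
Proof.
move=> si sm; rewrite /upto [RHS](reindex_inj si) /=.
by apply: eq_bigl => q; rewrite sm.
Qed.

Lemma below_aut (R : realType) (P : finType) (le : rel P) (s : P ->
  P) (x : P -> R) p :
  injective s -> {mono s : a b / le a b} -> below le (x \o s)
    p = below le x (s p).
Proof.
move=> si sm; rewrite /below [RHS](reindex_inj si) /=.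
by apply: eq_bigl => q; rewrite sm (inj_eq si).
Qed.

Lemma prodc_aut (R : realType) (P Q : finType) (lP : rel P) (lQ : rel Q)
    (s : P -> P) (t : Q -> Q) (x : P -> R) (y : Q -> R) v :
  injective s -> {mono s : a b / lP a b} -> injective t ->
    {mono t : a b / lQ a b} ->
  prodc lP lQ (x \o s) (y \o t) v = prodc lP lQ x y (s v.1, t v.2).
Proof. 
move=> si sm ti tm; rewrite /prodc (upto_aut x v.1 si sm)
  (upto_aut y v.2 ti tm).
by rewrite (below_aut x v.1 si sm) (below_aut y v.2 ti tm).
 Qed.

Section ProductSupport.
Variables (R : realType) (P Q : finType) (lP : rel P) (lQ : rel Q).
Hypotheses (poP : poset lP) (poQ : poset lQ).
Variables (x : P -> R) (y : Q -> R).
Hypotheses (cx : cpoint (comparability lP) x) (cy : cpoint (comparability lQ)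
  y).

Lemma prodc_supp v : prodc lP lQ x y v != 0 -> x v.1 != 0 /\ y v.2 != 0.
Proof.
case: v => p q h /=; split; apply: contra_neq h => h.
  have := marg1_prodc poP poQ p cx cy; rewrite h /marg1 => /psumr_eq0P;
    apply=> //.
  by move=> *; exact: prodc_ge0.
have := marg2_prodc poP poQ q cx cy; rewrite h /marg2 => /psumr_eq0P;
  apply=> //.
by move=> *; exact: prodc_ge0.
Qed.

Lemma prodc_vertex q0 v : (forall q, q != q0 -> y q = 0) ->
  prodc lP lQ x y v = if v.2 == q0 then x v.1 else 0.
Proof.
case: v => p q y0 /=; case: eqP => [->|/eqP qq0].
  rewrite -(marg1_prodc poP poQ p cx cy) /marg1 (bigD1 q0) //= big1 ?addr0 //.
  move=> q' /y0 yq'; apply/eqP; apply: contraTT isT => /prodc_supp[_].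
  by rewrite yq' eqxx.
by apply/eqP; apply: contraTT isT => /prodc_supp[_]; rewrite y0 ?eqxx.
Qed.

End ProductSupport.

Lemma prodc_ext (R : realType) (P Q : finType) (lP : rel P) (lQ : rel Q)
  (x x' : P -> R) (y y' : Q -> R) : x =1 x' -> y =1 y' ->
  prodc lP lQ x y =1 prodc lP lQ x' y'.
Proof. by move=> /funext -> /funext ->. Qed.

Lemma push_eq (R : realType) (V : finType) n (p : V -> N) (s : V ->
  V) (x x' : V -> R) :
  injective s -> (forall v, x' (s v) = x v) -> (forall v,
    x v != 0 -> p (s v) = p v) ->
  push n p x = push n p x'.
Proof.
move=> si xx' ps; apply/rowP => j; rewrite !mxE [RHS](reindex_inj si) /=.
rewrite big_mkcond [RHS]big_mkcond; apply: eq_bigr => v _; rewrite xx'.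
by have [->|/ps ->//] := eqVneq (x v) 0; do 2!case: ifP.
Qed.

Lemma sqnormZ (R : realType) n (a : R) (w : 'rV[R]_n) :
  sqnorm (a *: w) = a ^+ 2 * sqnorm w.
Proof. by rewrite /sqnorm mulr_sumr; apply: eq_bigr => i _;
  rewrite mxE exprMn. Qed.

Lemma radial_eq (R : realType) n (u u' : 'rV[R]_n) (c c' : R) :
  0 < c -> 0 < c' -> sqnorm u = 1 -> sqnorm u' = 1 -> c *: u = c' *: u' ->
    u = u'.
Proof.
move=> c0 c'0 u1 u1' e.
have := congr1 (@sqnorm R n) e; rewrite !sqnormZ u1 u1' !mulr1 => /eqP.
rewrite eqrXn2 ?ltW // => /eqP cc'; move: e; rewrite cc'.
by apply: scalerI; rewrite lt0r_neq0.
Qed.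

Lemma sqnorm_ge0 (R : realType) n (w : 'rV[R]_n) : 0 <= sqnorm w.
Proof. by apply: sumr_ge0 => i _; exact: sqr_ge0. Qed.

Lemma sqnorm_gt0 (R : realType) n (w : 'rV[R]_n) : w != 0 -> 0 < sqnorm w.
Proof.
move=> w0; rewrite lt0r sqnorm_ge0 andbT; apply: contra_neq w0 => w0.
apply/rowP => i; rewrite mxE.
have /(_ i isT)/eqP := psumr_eq0P (fun j _ => sqr_ge0 (w 0 j)) w0.
by rewrite sqrf_eq0 => /eqP.
Qed.

Lemma sqnorm_normalize (R : realType) n (w : 'rV[R]_n) :
  w != 0 -> sqnorm (normalize w) = 1.
Proof.
move=> /sqnorm_gt0 w0; rewrite sqnormZ exprVn sqr_sqrtr ?ltW // mulVf //.
exact: lt0r_neq0.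
Qed.

(** * Spheres as boundaries of cross-polytopes *)

Section CrossPolytope.
Variables (R : realType) (n : nat).

(** The chains contain at most one of the two signs for each axis: the order complex is the boundary
    of the cross-polytope. The order of the axes only serves to triangulate products. *)
Definition cross_le : rel ('I_n * bool) := fun v w => (v == w) || (v.1 < w.1)%N.

Lemma cross_le_poset : poset cross_le.
Proof.
split=> [v|v w|v w u]; first by rewrite /cross_le eqxx.
  rewrite /cross_le; case: (eqVneq v w) => //= _; case: (eqVneq w v) => //= _.
  by move=> /andP[h h']; have := ltn_trans h h'; rewrite ltnn.
rewrite /cross_le => /predU1P[->//|h] /predU1P[<-|h']; first by rewrite h orbT.
by rewrite (ltn_trans h h') orbT.
Qed.

Definition norm1 (u : 'rV[R]_n) : R := \sum_i `|u 0 i|.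

(** The radial projection to the unit sphere of the 1-norm; the positive and negative parts of its
    coordinates are the weights of the vertices. *)
Definition cross (u : 'rV[R]_n) (v : 'I_n * bool) : R :=
  Num.max 0 (if v.2 then u 0 v.1 else - u 0 v.1) / norm1 u.

Lemma norm1_ge0 u : 0 <= norm1 u.
Proof. exact: sumr_ge0. Qed.

Lemma norm1_gt0 u : u != 0 -> 0 < norm1 u.
Proof.
move=> u0; rewrite lt0r norm1_ge0 andbT; apply: contra_neq u0 => u0.
apply/rowP => i; rewrite mxE; apply/eqP; rewrite -normr_eq0.
by have /(_ i isT) -> := psumr_eq0P (fun j _ => normr_ge0 (u 0 j)) u0.
Qed.

Lemma max0_sub (a : R) : Num.max 0 a - Num.max 0 (- a) = a.
Proof. by minmax_lra. Qed.

Lemma max0_add (a : R) : Num.max 0 a + Num.max 0 (- a) = `|a|.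
Proof.
have [h|h] := boolP (0 <= a); first by rewrite ger0_norm //; minmax_lra.
by rewrite ltr0_norm ?ltNge //; move: h; rewrite -ltNge; minmax_lra.
Qed.

Lemma sum_sign (f : 'I_n * bool -> R) :
  \sum_v f v = \sum_i (f (i, true) + f (i, false)).
Proof.
rewrite (eq_bigr (fun v => f (v.1, v.2))) => [|[]//].
by rewrite -(pair_bigA _ (fun i b => f (i, b))); apply: eq_bigr => i _;
  rewrite big_bool.
Qed.

Lemma cross_point u : u != 0 -> cpoint (comparability cross_le) (cross u).
Proof.
move=> u0; have n0 := norm1_gt0 u0; split.
- by move=> v; rewrite mulr_ge0 ?invr_ge0 ?norm1_ge0 // le_max lexx.
- rewrite sum_sign; under eq_bigr do rewrite -mulrDl max0_add.
  by rewrite -mulr_suml divff // lt0r_neq0.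
move=> [i b] [j c]; rewrite /cross /= => h h';
  rewrite /comparability /cross_le /=.
have [ij|ji|/ord_inj ij] := ltngtP i j; rewrite ?orbT //; subst j.
suff -> : b = c by rewrite eqxx.
apply/eqP; apply: contraTT isT => bc; move: h h'.
rewrite !mulf_eq0 !negb_or => /andP[h _] /andP[h' _]; move: bc h h'.
by case: b; case: c => //= _; rewrite /Order.max; case: ltP => ?;
  case: ltP => ?;
  rewrite ?eqxx //; lra.
Qed.

Lemma crossE u i : cross u (i, true) - cross u (i,
  false) = (norm1 u)^-1 * u 0 i.
Proof. by rewrite /cross /= -mulrBl max0_sub mulrC. Qed.

Lemma cross_inj u u' : sqnorm u = 1 -> sqnorm u' = 1 -> u != 0 -> u' != 0 ->
  cross u =1 cross u' -> u = u'.
Proof.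
move=> u1 u1' u0 u0' e.
apply: (radial_eq (c := (norm1 u)^-1) (c' := (norm1 u')^-1)) => //.
- by rewrite invr_gt0 norm1_gt0.
- by rewrite invr_gt0 norm1_gt0.
by apply/rowP => i; rewrite !mxE -!crossE !e.
Qed.

Lemma crossZ (a : R) u : 0 < a -> cross (a *: u) =1 cross u.
Proof.
move=> a0 [i b]; rewrite /cross /=.
have -> : norm1 (a *: u) = a * norm1 u.
  by rewrite /norm1 mulr_sumr; apply: eq_bigr => j _;
    rewrite mxE normrM gtr0_norm.
have -> : Num.max 0 (if b then (a *: u) 0 i else - (a *: u) 0 i) =
    a * Num.max 0 (if b then u 0 i else - u 0 i).
  by rewrite maxr_pMr ?ltW // mulr0 mxE; case: b; rewrite ?mulrN.
by rewrite invfM mulrACA divff ?mul1r // lt0r_neq0.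
Qed.

Lemma cross_surj x : cpoint (comparability cross_le) x ->
  exists u : 'rV[R]_n, sqnorm u = 1 /\ cross u =1 x.
Proof.
move=> [x0 x1 xch]; pose w : 'rV[R]_n := \row_i (x (i, true) - x (i, false)).
have excl i : x (i, true) = 0 \/ x (i, false) = 0.
  have [|h] := eqVneq (x (i, true)) 0; [by left|right].
  apply/eqP; apply: contraTT isT => h'; have := xch _ _ h h'.
  by rewrite /comparability /cross_le /= ltnn !xpair_eqE !andbF.
have nw : norm1 w = 1.
  rewrite -x1 sum_sign; apply: eq_bigr => i _; rewrite mxE.
  by have := x0 (i, true); have := x0 (i, false); case: (excl i) => -> ? ?;
    rewrite ?subr0 ?sub0r ?normrN ger0_norm ?addr0 ?add0r.
have w0 : w != 0.
  apply/eqP => w0; move: nw; rewrite w0 /norm1 big1 => [/esym/eqP|i _].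
    by rewrite oner_eq0.
  by rewrite mxE normr0.
exists (normalize w); split; first exact: sqnorm_normalize.
move=> [i b]; rewrite crossZ ?invr_gt0 ?sqrtr_gt0 ?sqnorm_gt0 // /cross nw
  divr1 mxE /=.
have := x0 (i, true); have := x0 (i, false).
by case: b => /=; case: (excl i) => ->; minmax_lra.
Qed.

Lemma cross_continuous_at v u : u != 0 -> {for u, continuous (cross^~ v)}.
Proof.
move=> u0; apply: (@continuousM R).
  apply: continuous_max; first exact: cst_continuous.
  by case: v.2; [|apply: continuousN]; exact: coord_continuous.
apply: (@continuousV R); first by rewrite lt0r_neq0 ?norm1_gt0.
apply: sum_continuous_at => i; apply: continuous_comp;
  first exact: coord_continuous.
exact: norm_continuous.
Qed.
End CrossPolytope.

Lemma sum_option_bool (R : realType) (f : option bool -> R) :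
  \sum_a f a = f None + f (Some true) + f (Some false).
Proof.
rewrite (bigD1 None) //= (bigD1 (Some true)) //= (bigD1 (Some false)) //=.
by rewrite big1 ?addr0 ?addrA // => -[[]|].
Qed.

(** * The interval [-1, 1] with a vertex at 0 *)

Section Interval.
Variable R : realType.

(** The midpoint [None] lies below both ends; this choice is invariant under [optN], which a linear
    order from one end to the other would not be. *)
Definition star_le : rel (option bool) := fun a b => (a == None) || (a == b).

Lemma star_le_poset : poset star_le.
Proof. by split=> [[[]|]|[[]|] [[]|]|[[]|] [[]|] [[]|]]. Qed.

Definition optN (a : option bool) : option bool := omap negb a.

Lemma optNK : involutive optN. Proof. by case=> [[]|]. Qed.

Lemma star_leN : {mono optN : a b / star_le a b}.
Proof. by case=> [[]|] [[]|]. Qed.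

Definition ival (w : R) (a : option bool) : R :=
  if a is Some b then Num.max 0 (if b then w else - w) else 1 - `|w|.

Lemma ivalN w : ival (- w) =1 ival w \o optN.
Proof. by move=> [[]|]; rewrite /ival /= ?normrN ?opprK. Qed.

Lemma ivalE w : ival w (Some true) - ival w (Some false) = w.
Proof. exact: max0_sub. Qed.

Lemma ival_point w : `|w| <= 1 -> cpoint (comparability star_le) (ival w).
Proof.
move=> w1; split.
- by move=> [[]|]; rewrite /ival ?subr_ge0 ?le_max ?lexx.
- by rewrite sum_option_bool /ival -addrA max0_add subrK.
have opp b : ival w (Some b) != 0 -> ival w (Some (~~ b)) != 0 -> False.
  move=> h h'; have : ival w (Some b) = 0 \/ ival w (Some (~~ b)) = 0.
    rewrite /ival; case: b {h h'} => /=; rewrite /Order.max;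
    by case: ltP => ?; case: ltP => ?; try (by left); try (by right); lra.
  by case=> e; [move: h|move: h']; rewrite e eqxx.
move=> [[]|] [[]|] // h h'; exfalso.
  exact: opp h h'.
exact: opp h h'.
Qed.

Lemma ival_surj x : cpoint (comparability star_le) x ->
  exists2 w, `|w| <= 1 & ival w =1 x.
Proof.
move=> [x0 x1 xch]; exists (x (Some true) - x (Some false)).
  rewrite -x1 sum_option_bool ler_norml.
  by have := x0 None; have := x0 (Some true); have := x0 (Some false); lra.
have : x (Some true) = 0 \/ x (Some false) = 0.
  have [|h] := eqVneq (x (Some true)) 0; [by left|right].
  by apply/eqP; apply: contraTT isT => h'; have := xch _ _ h h'.
have := x0 None; have := x0 (Some true); have := x0 (Some false).
have := x1; rewrite sum_option_bool => ? ? ? ? h.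
move=> [[]|]; rewrite /ival; case: h => e; rewrite e.
- by minmax_lra.
- by minmax_lra.
- by minmax_lra.
- by minmax_lra.
- by rewrite sub0r normrN ger0_norm //; lra.
- by rewrite subr0 ger0_norm //; lra.
Qed.

Lemma ival_continuous_at a w : {for w, continuous (ival^~ a)}.
Proof.
case: a => [b|]; rewrite /ival.
  apply: continuous_max; first exact: cst_continuous.
  by case: b; [|apply: continuousN]; exact: cvg_id.
by apply: continuousB; [exact: cst_continuous|exact: norm_continuous].
Qed.
End Interval.

Lemma prodc_bottom (R : realType) (P Q : finType) (lP : rel P) (lQ : rel Q)
    (x : P -> R) (y : Q -> R) p q :
  (forall p', lP p' p = (p' == p)) -> (forall q', lQ q' q = (q' == q)) ->
  prodc lP lQ x y (p, q) = Num.max 0 (Num.min (x p) (y q)).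
Proof.
move=> pb qb; rewrite /prodc /upto /below /=.
rewrite (big_pred1 p) // (big_pred1 q) //.
rewrite !big_pred0 => [|i|i]; rewrite ?pb ?qb ?andbN //.
by rewrite maxxx subr0.
Qed.

(** * The 2-sphere as the subdivided boundary of the cube *)

Section Cube.
Variable R : realType.

Implicit Types u : 'rV[R]_3.
Definition cube_center : option bool * option bool * option bool :=
  (None, None, None).
Local Notation square_le := (prodrel star_le star_le).
Definition cube_le : rel (option bool * option bool * option bool) :=
  prodrel square_le star_le.

Lemma square_le_poset : poset square_le.
Proof. exact: prodrel_poset star_le_poset star_le_poset. Qed.

Lemma cube_le_poset : poset cube_le.
Proof. exact: prodrel_poset square_le_poset star_le_poset. Qed.

Definition cubeV (v : option bool * option bool * option bool) :=
  (optN v.1.1, optN v.1.2, optN v.2).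

Lemma cubeVK : involutive cubeV.
Proof. by move=> [[a b] c]; rewrite /cubeV /= !optNK. Qed.

Lemma cube_leV : {mono cubeV : v w / cube_le v w}.
Proof. by move=> v w; rewrite /cube_le /prodrel /= !star_leN. Qed.

Definition maxnorm (u : 'rV[R]_3) : R :=
  Num.max (Num.max `|u 0 (inord 0)| `|u 0 (inord 1)|) `|u 0 (inord 2)|.

(* The cube [-1, 1]^3 is the order complex of the product of three copies of
   None < Some true, Some false; its boundary avoids the least element. *)
Definition cube3 (a b c : R) : option bool * option bool * option bool -> R :=
  prodc square_le star_le (prodc star_le star_le (ival a) (ival b)) (ival c).

Definition cube (u : 'rV[R]_3) : option bool * option bool * option bool -> R :=
  cube3 (u 0 (inord 0) / maxnorm u) (u 0 (inord 1) / maxnorm u)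
        (u 0 (inord 2) / maxnorm u).

Lemma cube3_point a b c : `|a| <= 1 -> `|b| <= 1 -> `|c| <= 1 ->
  cpoint (comparability cube_le) (cube3 a b c).
Proof.
move=> a1 b1 c1; apply: prodc_point; [exact: square_le_poset|exact:
  star_le_poset| |].
  by apply: prodc_point; [exact: star_le_poset|exact: star_le_poset|exact:
    ival_point..].
exact: ival_point.
Qed.

(** The centre is minimal in each factor, so its intervals all start at 0 and the overlap is the
    shortest of them. The value is 1 minus the maximum norm, which vanishes exactly on the boundary
    of the cube. *)
Lemma cube3_center a b c : `|a| <= 1 -> `|b| <= 1 -> `|c| <= 1 ->
  cube3 a b c cube_center = Num.min (Num.min (1 - `|a|) (1 - `|b|)) (1 - `|c|).
Proof.
move=> a1 b1 c1; rewrite /cube3 /cube_center !prodc_bottom //=.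
- by minmax_lra.
- by move=> [[]|].
- by move=> [[]|].
- by move=> [[[]|] [[]|]].
- by move=> [[]|].
Qed.

Lemma cube3_inj a b c a' b' c' : `|a| <= 1 -> `|b| <= 1 -> `|c| <= 1 ->
  `|a'| <= 1 -> `|b'| <= 1 -> `|c'| <= 1 ->
  cube3 a b c =1 cube3 a' b' c' -> [/\ a = a', b = b' & c = c'].
Proof.
move=> a1 b1 c1 a1' b1' c1' e.
have sq (x y : R) : `|x| <= 1 -> `|y| <= 1 ->
    cpoint (comparability square_le) (prodc star_le star_le (ival x) (ival y)).
  by move=> x1 y1; apply: prodc_point; [exact: star_le_poset|exact:
    star_le_poset|exact: ival_point..].
have [e1 e2] := prodc_inj square_le_poset star_le_poset (sq _ _ a1 b1)
  (ival_point c1)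
  (sq _ _ a1' b1') (ival_point c1') e.
have [e3 e4] := prodc_inj star_le_poset star_le_poset (ival_point a1)
  (ival_point b1)
  (ival_point a1') (ival_point b1') e1.
by split; [rewrite -(ivalE a) !e3|rewrite -(ivalE b) !e4|rewrite -(ivalE c)
  !e2]; rewrite ivalE.
Qed.

Lemma cube3_surj x : cpoint (comparability cube_le) x ->
  exists a b c, [/\ `|a| <= 1, `|b| <= 1, `|c| <= 1 & cube3 a b c =1 x].
Proof.
move=> cx; have cx2 := marg2_point cx; have cx1 := marg1_point cx.
have [c c1 ec] := ival_surj cx2.
have [a a1 ea] := ival_surj (marg1_point cx1).
have [b b1 eb] := ival_surj (marg2_point cx1).
exists a, b, c; split=> // v.
rewrite -(prodc_marg square_le_poset star_le_poset cx v).
apply: prodc_ext => // w; rewrite -(prodc_marg star_le_poset star_le_poset cx1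
  w).
exact: prodc_ext.
Qed.

Lemma cube3N a b c : cube3 (- a) (- b) (- c) =1 cube3 a b c \o cubeV.
Proof.
have iN := inv_inj optNK; have mN := star_leN.
have e1 : prodc star_le star_le (ival (- a)) (ival (- b)) =1
    prodc star_le star_le (ival a) (ival b) \o (fun w => (optN w.1, optN w.2)).
  move=> w /=; rewrite -(prodc_aut (ival a) (ival b) w iN mN iN mN).
  exact: prodc_ext (ivalN a) (ivalN b) w.
have iN2 : injective (fun w : option bool * option bool => (optN w.1,
  optN w.2)).
  by move=> [? ?] [? ?] [] /iN -> /iN ->.
have mN2 : {mono (fun w => (optN w.1, optN w.2)) : v w / prodrel star_le
  star_le v w}.
  by move=> ? ?; rewrite /prodrel /= !mN.
move=> v; have := prodc_aut (prodc star_le star_le (ival a) (ival b)) (ival c)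
  v iN2 mN2 iN mN.
by rewrite /cube3 /= /cubeV => <-; apply: prodc_ext; [exact: e1|exact: ivalN].
Qed.

Lemma forall_ord3 (Q : 'I_3 -> Prop) :
  Q (inord 0) -> Q (inord 1) -> Q (inord 2) -> forall i, Q i.
Proof.
move=> q0 q1 q2 [[|[|[|//]]] lt].
- by rewrite (_ : Ordinal _ = inord 0) //; apply: ord_inj; rewrite inordK.
- by rewrite (_ : Ordinal _ = inord 1) //; apply: ord_inj; rewrite inordK.
- by rewrite (_ : Ordinal _ = inord 2) //; apply: ord_inj; rewrite inordK.
Qed.

Lemma maxnorm_ge (u : 'rV[R]_3) i : `|u 0 i| <= maxnorm u.
Proof. by move: i; apply: forall_ord3; rewrite /maxnorm !le_max lexx ?orbT. Qed.

Lemma maxnorm_gt0 u : u != 0 -> 0 < maxnorm u.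
Proof.
apply: contraNT; rewrite -leNgt => m0; apply/eqP/rowP => i; rewrite mxE.
by apply/eqP; rewrite -normr_le0; exact: le_trans (maxnorm_ge u i) m0.
Qed.

Lemma maxnorm_coord u i : u != 0 -> `|u 0 i / maxnorm u| <= 1.
Proof.
move=> u0; have m0 := maxnorm_gt0 u0.
by rewrite normrM normfV (gtr0_norm m0) ler_pdivrMr // mul1r maxnorm_ge.
Qed.

Lemma maxnormZ (a : R) u : 0 < a -> maxnorm (a *: u) = a * maxnorm u.
Proof.
by move=> a0; rewrite /maxnorm !mxE !normrM gtr0_norm // !maxr_pMr ?ltW.
Qed.

Lemma cubeZ (a : R) u : 0 < a -> cube (a *: u) = cube u.
Proof.
move=> a0; rewrite /cube maxnormZ // !mxE.
by congr cube3; rewrite invfM mulrACA divff ?mul1r // lt0r_neq0.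
Qed.

Lemma cubeN u : cube (- u) =1 cube u \o cubeV.
Proof.
move=> v; rewrite /cube (_ : maxnorm (- u) = maxnorm u).
  by rewrite !mxE !mulNr cube3N.
by rewrite /maxnorm !mxE !normrN.
Qed.

Lemma cube_point u : u != 0 ->
  cpoint (induced (predC1 cube_center) (comparability cube_le)) (cube u).
Proof.
move=> u0; apply/cpoint_on; split; first by apply: cube3_point;
  exact: maxnorm_coord.
have m0 := maxnorm_gt0 u0.
move=> v; apply: contraNneq => ->; rewrite /cube cube3_center;
  [|exact: maxnorm_coord..].
rewrite !normrM normfV (gtr0_norm m0).
have e (t : R) : t = maxnorm u -> 1 - t / maxnorm u = 0.
  by move=> ->; rewrite divff ?subrr // lt0r_neq0.
have le1 i : 0 <= 1 - `|u 0 i| / maxnorm u.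
  by rewrite subr_ge0 ler_pdivrMr // mul1r maxnorm_ge.
have : [\/ `|u 0 (inord 0)| = maxnorm u, `|u 0 (inord 1)| = maxnorm u
        | `|u 0 (inord 2)| = maxnorm u].
  rewrite /maxnorm; case: (leP `|u 0 (inord 0)|) => _; case: leP => _;
    by [apply: Or33|apply: Or32|apply: Or31].
have := le1 (inord 0); have := le1 (inord 1); have := le1 (inord 2).
move=> ? ? ?; case=> /e h; apply/eqP; move: h; minmax_lra.
Qed.

Lemma cube_inj u u' : sqnorm u = 1 -> sqnorm u' = 1 -> u != 0 -> u' != 0 ->
  cube u =1 cube u' -> u = u'.
Proof.
move=> u1 u1' u0 u0'.
move=> /(cube3_inj (maxnorm_coord _ u0) (maxnorm_coord _ u0)
  (maxnorm_coord _ u0)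
  (maxnorm_coord _ u0') (maxnorm_coord _ u0') (maxnorm_coord _ u0')) [e0 e1 e2].
apply: (radial_eq (c := (maxnorm u)^-1) (c' := (maxnorm u')^-1)) => //.
- by rewrite invr_gt0 maxnorm_gt0.
- by rewrite invr_gt0 maxnorm_gt0.
by apply/rowP; apply: forall_ord3; rewrite !mxE mulrC ?e0 ?e1 ?e2 mulrC.
Qed.

Lemma cube_surj x : cpoint (induced (predC1 cube_center)
  (comparability cube_le)) x ->
  exists u : 'rV[R]_3, sqnorm u = 1 /\ cube u =1 x.
Proof.
move=> /cpoint_on[/cube3_surj[a [b [c [a1 b1 c1 e]]]] xD].
have := cube3_center a1 b1 c1; rewrite e.
have -> : x cube_center = 0.
  by apply/eqP; apply: contraTT isT => /xD /=; rewrite ?eqxx.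
move=> m0; pose w : 'rV[R]_3 := \row_i [:: a; b; c]`_i.
have w3 : [/\ w 0 (inord 0) = a, w 0 (inord 1) = b & w 0 (inord 2) = c].
  by split; rewrite mxE inordK.
have mw : maxnorm w = 1.
  by rewrite /maxnorm; case: w3 => -> -> ->; move: m0; minmax_lra.
have w0 : w != 0.
  apply/eqP => w0; move: mw; rewrite w0 /maxnorm !mxE normr0 !maxxx.
  by move=> /esym/eqP; rewrite oner_eq0.
exists (normalize w); split; first exact: sqnorm_normalize.
move=> v; rewrite cubeZ ?invr_gt0 ?sqrtr_gt0 ?sqnorm_gt0 // /cube mw !divr1.
by case: w3 => -> -> ->.
Qed.
End Cube.

Lemma prodc_continuous_at (R : realType) (X : topologicalType) (P Q : finType)
    (lP : rel P) (lQ : rel Q) (x : X -> P -> R) (y : X -> Q -> R) a v :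
  (forall p, {for a, continuous (fun t => x t p)}) ->
  (forall q, {for a, continuous (fun t => y t q)}) ->
  {for a, continuous (fun t => prodc lP lQ (x t) (y t) v)}.
Proof.
move=> cx cy.
have cux : {for a, continuous (fun t => upto lP (x t)
  v.1)} by exact: sum_continuous_at.
have cuy : {for a, continuous (fun t => upto lQ (y t)
  v.2)} by exact: sum_continuous_at.
have cbx : {for a, continuous (fun t => below lP (x t)
  v.1)} by exact: sum_continuous_at.
have cby : {for a, continuous (fun t => below lQ (y t)
  v.2)} by exact: sum_continuous_at.
apply: continuous_max; first exact: cst_continuous.
apply: (@continuousB R); first exact: continuous_min cux cuy.
exact: continuous_max cbx cby.
Qed.

Lemma cube_continuous_at (R : realType) (u : 'rV[R]_3) v :
  u != 0 -> {for u, continuous (fun t => cube t v)}.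
Proof.
move=> u0.
have cn i : {for u, continuous (fun t : 'rV[R]_3 => `|t 0 i|)}.
  by apply: continuous_comp; [exact: coord_continuous|exact: norm_continuous].
have cm : {for u, continuous (@maxnorm R)}.
  exact: continuous_max (continuous_max (cn _) (cn _)) (cn _).
have cd i : {for u, continuous (fun t : 'rV[R]_3 => t 0 i / maxnorm t)}.
  apply: (@continuousM R); first exact: coord_continuous.
  by apply: (@continuousV R) => //; rewrite lt0r_neq0 ?maxnorm_gt0.
have ci i a : {for u, continuous (fun t : 'rV[R]_3 => ival (t 0 i / maxnorm t)
  a)}.
  exact: (continuous_comp (cd i) (@ival_continuous_at R a _)).
apply: prodc_continuous_at => [w|w]; last exact: ci.
by apply: prodc_continuous_at => w'; exact: ci.
Qed.

(** * The interval [0, 1] cut into thirds *)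

Section Zigzag.
Variable R : realType.

(** The fence 0 < 1 > 2 < 3, whose comparability graph is a path. With only two edges the middle
    level would be adjacent to both ends, and after gluing the ends an edge would no longer
    determine the gluing symmetry. *)
Definition zigzag_le : rel 'I_4 := fun a b =>
  (a == b) || [&& ~~ odd a, odd b & (a == b.+1 :> nat) || (b == a.+1 :> nat)].

Lemma zigzag_le_poset : poset zigzag_le.
Proof.
split.
- by move=> a; rewrite /zigzag_le eqxx.
- move=> a b; rewrite /zigzag_le; case: (eqVneq a b) => //= _.
  by case: (eqVneq b a) => //= _; case: (odd a); case: (odd b); rewrite ?andbF.
move=> y x z; rewrite /zigzag_le => /predU1P[->//|h]
  /predU1P[<-|/and3P[oy _ _]].
  by rewrite h orbT.
by case/and3P: h => _; rewrite (negbTE oy).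
Qed.

(* The hat functions of the subdivision of [0, 1] into thirds. *)
Definition zigzag (t : R) (l : 'I_4) : R :=
  Num.max 0 (Num.min (1 + 3 * t - l%:R) (1 - 3 * t + l%:R)).

Lemma forall_ord4 (Q : 'I_4 -> Prop) :
  (forall l : 'I_4, val l = 0%N -> Q l) -> (forall l : 'I_4,
    val l = 1%N -> Q l) ->
  (forall l : 'I_4, val l = 2 -> Q l) -> (forall l : 'I_4, val l = 3 -> Q l) ->
  forall l, Q l.
Proof.
move=> q0 q1 q2 q3 [[|[|[|[|//]]]] lt]; [exact: q0|exact: q1|exact: q2|exact:
  q3].
Qed.

Lemma sum_ord4 (f : 'I_4 -> R) :
  \sum_l f l = f (inord 0) + f (inord 1) + f (inord 2) + f (inord 3).
Proof.
rewrite !big_ord_recr big_ord0 /= add0r.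
by congr (f _ + f _ + f _ + f _); apply: ord_inj; rewrite inordK.
Qed.

Lemma zigzag_cases t : 0 <= t <= 1 ->
  [\/ [/\ zigzag t (inord 0) = 1 - 3 * t, zigzag t (inord 1) = 3 * t,
          zigzag t (inord 2) = 0, zigzag t (inord 3) = 0 & 3 * t <= 1],
      [/\ zigzag t (inord 0) = 0, zigzag t (inord 1) = 2 - 3 * t,
          zigzag t (inord 2) = 3 * t - 1,
            zigzag t (inord 3) = 0 & 1 <= 3 * t <= 2] |
      [/\ zigzag t (inord 0) = 0, zigzag t (inord 1) = 0,
          zigzag t (inord 2) = 3 - 3 * t,
            zigzag t (inord 3) = 3 * t - 2 & 2 <= 3 * t]].
Proof.
move=> /andP[t0 t1].
have [h1|h1] := leP (3 * t) 1; [|have [h2|h2] := leP (3 * t) 2].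
- by apply: Or31; rewrite /zigzag !inordK //; split=> //; minmax_lra.
- by apply: Or32; rewrite /zigzag !inordK //; split=> //; try minmax_lra;
  apply/andP; split=> //; exact: ltW.
- by apply: Or33; rewrite /zigzag !inordK //; split=> //; try minmax_lra;
  exact: ltW.
Qed.

Lemma zigzag_comparable (k l : 'I_4) : (k <= l.+1)%N -> (l <= k.+1)%N ->
  comparability zigzag_le k l.
Proof. by move: k l => [[|[|[|[|//]]]] ?] [[|[|[|[|//]]]] ?]. Qed.

Lemma zigzag_incomparable (k l : 'I_4) : comparability zigzag_le k l ->
  (k <= l.+1)%N && (l <= k.+1)%N.
Proof. by move: k l => [[|[|[|[|//]]]] ?] [[|[|[|[|//]]]] ?]. Qed.

Lemma ord4_inord (k : 'I_4) : [\/ k = inord 0,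
  k = inord 1 | k = inord 2 \/ k = inord 3].
Proof.
move: k; apply: forall_ord4 => l lE.
- by apply: Or31; apply: ord_inj; rewrite inordK.
- by apply: Or32; apply: ord_inj; rewrite inordK.
- by apply: Or33; left; apply: ord_inj; rewrite inordK.
- by apply: Or33; right; apply: ord_inj; rewrite inordK.
Qed.

Lemma zigzag_point t : 0 <= t <= 1 -> cpoint (comparability zigzag_le)
  (zigzag t).
Proof.
move=> t01; split.
- by move=> l; rewrite /zigzag le_max lexx.
- by rewrite sum_ord4; case: (zigzag_cases t01) => -[-> -> -> -> _]; lra.
move=> k l hk hl; apply: zigzag_comparable; move: hk hl;
  case: (zigzag_cases t01) => -[e0 e1 e2 e3 _];
  case: (ord4_inord k) => [->|->|[->|->]];
    case: (ord4_inord l) => [->|->|[->|->]];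
  by rewrite ?e0 ?e1 ?e2 ?e3 ?eqxx // !inordK.
Qed.

Lemma zigzagE t : 0 <= t <= 1 ->
  zigzag t (inord 1) + 2 * zigzag t (inord 2) + 3 * zigzag t (inord 3) = 3 * t.
Proof. by move=> /zigzag_cases[] [_ -> -> -> _]; lra. Qed.

Lemma zigzag_inj t t' : 0 <= t <= 1 -> 0 <= t' <= 1 -> zigzag t =1 zigzag t' ->
  t = t'.
Proof. by move=> /zigzagE e /zigzagE e' h; move: e e'; rewrite !h => e e';
  lra. Qed.

Lemma zigzag_surj x : cpoint (comparability zigzag_le) x ->
  exists2 t, 0 <= t <= 1 & zigzag t =1 x.
Proof.
move=> [x0 x1 xch].
(* The mean of the levels, weighted by [x], is [3 * t]. *)
pose t := (x (inord 1) + 2 * x (inord 2) + 3 * x (inord 3)) / 3.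
have t3 : 3 * t = x (inord 1) + 2 * x (inord 2) + 3 * x (inord 3)
  by rewrite /t; lra.
have excl (k l : nat) : (k.+1 < l < 4)%N -> x (inord k) = 0 \/ x (inord l) = 0.
  move=> /andP[kl l4]; have [|h] := eqVneq (x (inord k)) 0; [by left|right].
  apply/eqP; apply: contraTT isT => h'; have /zigzag_incomparable := xch _ _ h
    h'.
  by rewrite !inordK //; lia.
move: x1; rewrite sum_ord4 => x1.
have := x0 (inord 0); have := x0 (inord 1); have := x0 (inord 2);
  have := x0 (inord 3).
move=> p3 p2 p1 p0.
have t01 : 0 <= t <= 1 by apply/andP; split; lra.
exists t => // l.
have [e02|e02] := excl 0%N 2 isT; have [e03|e03] := excl 0%N 3 isT;
have [e13|e13] := excl 1%N 3 isT;
case: (zigzag_cases t01) => -[z0 z1 z2 z3 z];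
case: (ord4_inord l) => [->|->|[->|->]]; lra.
Qed.

Lemma zigzag0 l : l != ord0 -> zigzag 0 l = 0.
Proof.
move=> l0; have h : (1 : R) <= l%:R by rewrite ler1n lt0n.
by rewrite /zigzag; move: h; minmax_lra.
Qed.

Lemma zigzag1 l : l != ord_max -> zigzag 1 l = 0.
Proof.
move=> l3; have h : (l%:R : R) <= 2%:R.
  by rewrite ler_nat; have := ltn_ord l; move: l3; rewrite -val_eqE /=; lia.
by rewrite /zigzag; move: h; minmax_lra.
Qed.

Lemma zigzag_continuous_at l t : {for t, continuous (zigzag^~ l)}.
Proof.
have cc (c : R) : {for t, continuous (fun=> c : R)} by exact: cst_continuous.
have c3 : {for t, continuous (fun t : R => 3 * t)}.
  by apply: continuousM => //; exact: cvg_id.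
apply: continuous_max => //; apply: continuous_min.
  by apply: continuousB => //; exact: continuousD.
by apply: continuousD => //; exact: continuousB.
Qed.
End Zigzag.

Section Sphere.
Variable R : realType.

Lemma sqnorm_continuous n : continuous (@sqnorm R n).
Proof.
move=> x; apply: sum_continuous_at => i.
rewrite (_ : (fun y => _) = (fun y : 'rV[R]_n => y 0 i * y 0 i)); last first.
  by apply/funext => y; rewrite expr2.
by apply: continuousM; exact: coord_continuous.
Qed.

Lemma sqnorm_coord n (x : 'rV[R]_n) i : (x 0 i) ^+ 2 <= sqnorm x.
Proof. by rewrite /sqnorm (bigD1 i) //= lerDl; apply: sumr_ge0 => j _;
  exact: sqr_ge0. Qed.

Lemma sphere_compact n : compact (sphere R n).
Proof.
apply: bounded_closed_compact; last first.
  have -> : sphere R n = @sqnorm R n.+1 @^-1` [set 1] by [].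
  by apply: closed_comp; [move=> x _; exact: sqnorm_continuous|exact:
    closed_eq].
exists 1; split; first exact: num_real.
move=> M M1 x xs; apply: le_trans (ltW M1).
rewrite [leLHS]/Num.Def.normr /= mx_normrE; apply/bigmax_leP;
  split => // -[i j] _ /=.
rewrite [i]ord1 -(@expr_le1 _ 2) // real_normK ?num_real //.
by rewrite -xs; exact: sqnorm_coord.
Qed.

Lemma compact_sphere n : compact [set: sphere R n].
Proof. exact/compact_set_type/sphere_compact. Qed.

Lemma sphere_eq n (x : sphere R n) : sqnorm (\val x) = 1.
Proof. exact: (@set_valP _ _ x). Qed.

Lemma sphere_neq0 n (x : sphere R n) : \val x != 0.
Proof.
apply/eqP => x0; have := sphere_eq x; rewrite x0 /sqnorm big1 =>
  [/esym/eqP|i _].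
  by rewrite oner_eq0.
by rewrite mxE expr0n.
Qed.

Lemma sphere_mem n (x : 'rV[R]_n.+1) : sqnorm x = 1 -> x \in sphere R n.
Proof. by move=> x1; apply/mem_set. Qed.
End Sphere.

(** * Vertex maps and flips *)

(* The suffixes 1, 2, 3 and 4 refer to S^2 x S^1, the twisted bundle, RP^2 x S^1
   and RP^3 # RP^3. The sequences of flips were found by simulated annealing;
   the labels are those of the vertices that remain. *)
Definition flips1 : seq (seq N * seq N) :=
[:: ([:: 0; 2; 14], [:: 18; 22]); ([:: 2; 14], [:: 1; 18; 22]); ([:: 0; 2],
[:: 10; 18; 22]); ([:: 0; 10], [:: 8; 18; 22]); ([:: 1; 14], [:: 13; 18; 22]);
([:: 2], [:: 1; 10; 18; 22]); ([:: 0; 14], [:: 12; 18; 22]); ([:: 13; 14], [::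
5; 18; 22]); ([:: 12; 14], [:: 4; 18; 22]); ([:: 5; 14], [:: 6; 18; 22]); ([::
14], [:: 4; 6; 18; 22]); ([:: 1; 10], [:: 9; 18; 22]); ([:: 1; 9; 11], [:: 19;
23]); ([:: 12; 16; 19], [:: 0; 4]); ([:: 1; 11], [:: 3; 19; 23]); ([:: 3; 11],
[:: 0; 19; 23]); ([:: 9; 11], [:: 5; 19; 23]); ([:: 12; 19], [:: 0; 4; 15]);
([:: 0; 12; 20], [:: 22; 23]); ([:: 0; 20], [:: 8; 22; 23]); ([:: 12; 15], [::
0; 4; 23]); ([:: 3; 19; 23], [:: 0; 1]); ([:: 8; 20], [:: 4; 22; 23]); ([::
12; 16], [:: 0; 4; 18]); ([:: 16; 19], [:: 0; 4; 8]); ([:: 3; 23], [:: 0; 1;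
15]); ([:: 0; 11], [:: 8; 19; 23]); ([:: 8; 11], [:: 4; 19; 23]); ([:: 4; 11],
[:: 7; 19; 23]); ([:: 4; 7], [:: 15; 19; 23]); ([:: 12; 18], [:: 0; 4; 22]);
([:: 16], [:: 0; 4; 8; 18]); ([:: 3], [:: 0; 1; 15; 19]); ([:: 20], [:: 4; 12;
22; 23]); ([:: 12], [:: 0; 4; 22; 23]); ([:: 11], [:: 5; 7; 19; 23]); ([:: 7],
[:: 5; 15; 19; 23]); ([:: 5; 15], [:: 13; 19; 23]); ([:: 6; 10; 22], [:: 4;
5]); ([:: 6; 22], [:: 4; 5; 18]); ([:: 0; 8; 22], [:: 18; 23]); ([:: 6], [::
4; 5; 10; 18])]%num.

Definition labels1 : seq N :=
[:: 0; 1; 4; 5; 8; 9; 10; 13; 15; 17; 18; 19; 21; 22; 23]%num.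

Definition flips2 : seq (seq N * seq N) :=
[:: ([:: 4; 10; 16], [:: 3; 5]); ([:: 4; 10], [:: 3; 5; 13]); ([:: 4; 13], [::
3; 5; 7]); ([:: 4], [:: 3; 5; 7; 16]); ([:: 3; 6; 7], [:: 13; 16]); ([:: 6;
7], [:: 0; 13; 16]); ([:: 0; 7], [:: 1; 13; 16]); ([:: 3; 7], [:: 5; 13; 16]);
([:: 1; 7], [:: 2; 13; 16]); ([:: 0; 1], [:: 10; 13; 16]); ([:: 5; 7], [:: 8;
13; 16]); ([:: 7], [:: 2; 8; 13; 16]); ([:: 1], [:: 2; 10; 13; 16])]%num.

Definition labels2 : seq N :=
[:: 0; 2; 3; 5; 6; 8; 9; 10; 11; 12; 13; 14; 15; 16; 17]%num.

Definition flips3 : seq (seq N * seq N) :=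
[:: ([:: 8; 48; 50], [:: 0; 4]); ([:: 1; 3; 11], [:: 35; 51]); ([:: 25; 26;
50], [:: 1; 17]); ([:: 0; 8; 35], [:: 11; 32]); ([:: 3; 11], [:: 0; 35; 51]);
([:: 8; 50], [:: 0; 4; 10]); ([:: 8; 48], [:: 0; 4; 51]); ([:: 8; 10], [:: 0;
4; 34]); ([:: 20; 32; 34], [:: 0; 16]); ([:: 19; 43; 51], [:: 16; 17]); ([::
4; 40; 42], [:: 46; 50]); ([:: 8; 51], [:: 0; 4; 11]); ([:: 40; 42], [:: 16;
46; 50]); ([:: 1; 2; 22], [:: 34; 46]); ([:: 1; 11], [:: 9; 35; 51]); ([:: 19;
43], [:: 16; 17; 47]); ([:: 16; 42], [:: 18; 46; 50]); ([:: 19; 51], [:: 16;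
17; 27]); ([:: 20; 34], [:: 0; 16; 22]); ([:: 8; 35], [:: 4; 11; 32]); ([::
20; 22], [:: 0; 16; 46]); ([:: 4; 42], [:: 6; 46; 50]); ([:: 8; 11], [:: 0; 4;
32]); ([:: 1; 22], [:: 21; 34; 46]); ([:: 1; 25; 27], [:: 39; 51]); ([:: 6;
42], [:: 5; 46; 50]); ([:: 19; 47], [:: 16; 17; 23]); ([:: 19; 27], [:: 16;
17; 39]); ([:: 25; 26], [:: 1; 17; 38]); ([:: 5; 42], [:: 41; 46; 50]); ([::
6; 10; 50], [:: 4; 5]); ([:: 25; 27], [:: 17; 39; 51]); ([:: 1; 2; 14], [::
38; 46]); ([:: 41; 42], [:: 17; 46; 50]); ([:: 17; 25; 37], [:: 38; 39]); ([::
8], [:: 0; 4; 32; 34]); ([:: 11; 32], [:: 0; 4; 35]); ([:: 1; 14], [:: 13; 38;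
46]); ([:: 0; 11], [:: 4; 35; 51]); ([:: 19; 39], [:: 16; 17; 31]); ([:: 17;
37], [:: 29; 38; 39]); ([:: 9; 11], [:: 5; 35; 51]); ([:: 19; 31], [:: 16; 17;
35]); ([:: 1; 27], [:: 3; 39; 51]); ([:: 2; 14], [:: 0; 38; 46]); ([:: 19],
[:: 16; 17; 23; 35]); ([:: 21; 22], [:: 17; 34; 46]); ([:: 20; 46], [:: 0; 16;
44]); ([:: 20; 44], [:: 0; 16; 47]); ([:: 6; 50], [:: 4; 5; 46]); ([:: 4; 11],
[:: 7; 35; 51]); ([:: 25; 50], [:: 1; 17; 49]); ([:: 13; 14], [:: 5; 38; 46]);
([:: 3; 27], [:: 0; 39; 51]); ([:: 5; 14], [:: 6; 38; 46]); ([:: 25; 49], [::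
1; 17; 51]); ([:: 20; 32], [:: 0; 16; 35]); ([:: 11], [:: 5; 7; 35; 51]); ([::
42], [:: 17; 18; 46; 50]); ([:: 17; 27], [:: 16; 39; 51]); ([:: 25; 51], [::
1; 17; 39]); ([:: 6; 14], [:: 4; 38; 46]); ([:: 0; 27], [:: 24; 39; 51]); ([::
25; 37], [:: 1; 38; 39]); ([:: 4; 14], [:: 12; 38; 46]); ([:: 29; 37], [:: 5;
38; 39]); ([:: 20; 47], [:: 0; 16; 23]); ([:: 2; 22], [:: 0; 34; 46]); ([:: 6;
46], [:: 4; 5; 38]); ([:: 25], [:: 1; 17; 38; 39]); ([:: 0; 22], [:: 16; 34;
46]); ([:: 20], [:: 0; 16; 23; 35]); ([:: 17; 22], [:: 18; 34; 46]); ([:: 6;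
10], [:: 4; 5; 34]); ([:: 14], [:: 0; 12; 38; 46]); ([:: 27], [:: 16; 24; 39;
51]); ([:: 6; 38], [:: 4; 5; 30]); ([:: 6], [:: 4; 5; 30; 34]); ([:: 1; 37],
[:: 13; 38; 39]); ([:: 37], [:: 5; 13; 38; 39]); ([:: 22], [:: 16; 18; 34;
46]); ([:: 28; 32; 34], [:: 4; 16]); ([:: 28; 34], [:: 4; 16; 30]); ([:: 32;
34], [:: 0; 4; 16]); ([:: 28; 30], [:: 4; 16; 38]); ([:: 0; 3; 23], [:: 35;
47]); ([:: 0; 23], [:: 16; 35; 47]); ([:: 3; 23], [:: 1; 35; 47]); ([:: 0;
32], [:: 4; 16; 35]); ([:: 4; 10; 50], [:: 0; 5]); ([:: 4; 10], [:: 0; 5;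
34]); ([:: 5; 29; 39], [:: 31; 38]); ([:: 29; 39], [:: 17; 31; 38]); ([:: 0;
2; 26], [:: 38; 50]); ([:: 0; 3; 15], [:: 39; 47]); ([:: 28; 38], [:: 4; 16;
36]); ([:: 3; 15], [:: 1; 39; 47]); ([:: 28; 36], [:: 4; 16; 39]); ([:: 0;
26], [:: 24; 38; 50]); ([:: 4; 12; 44], [:: 46; 47]); ([:: 0; 15], [:: 12; 39;
47]); ([:: 4; 44], [:: 40; 46; 47]); ([:: 32], [:: 4; 16; 28; 35]); ([:: 2;
26], [:: 1; 38; 50]); ([:: 1; 15], [:: 13; 39; 47]); ([:: 16; 23], [:: 17; 35;
47]); ([:: 1; 23], [:: 21; 35; 47]); ([:: 28; 35], [:: 4; 16; 31]); ([:: 12;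
15], [:: 4; 39; 47]); ([:: 24; 26], [:: 16; 38; 50]); ([:: 12; 44], [:: 0; 46;
47]); ([:: 28], [:: 4; 16; 31; 39]); ([:: 13; 15], [:: 5; 39; 47]); ([:: 1;
26], [:: 17; 38; 50]); ([:: 16; 26], [:: 18; 38; 50]); ([:: 23], [:: 17; 21;
35; 47]); ([:: 0; 44], [:: 16; 46; 47]); ([:: 4; 15], [:: 7; 39; 47]); ([::
44], [:: 16; 40; 46; 47]); ([:: 15], [:: 5; 7; 39; 47]); ([:: 26], [:: 17; 18;
38; 50]); ([:: 1; 3; 39], [:: 47; 51]); ([:: 9; 10; 50], [:: 1; 5]); ([:: 1;
3], [:: 35; 47; 51]); ([:: 9; 50], [:: 1; 5; 49]); ([:: 9; 10], [:: 1; 5;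
34]); ([:: 3; 39], [:: 0; 47; 51]); ([:: 3], [:: 0; 35; 47; 51]); ([:: 9; 34],
[:: 1; 5; 33]); ([:: 9; 49], [:: 1; 5; 51]); ([:: 9; 51], [:: 1; 5; 35]); ([::
9], [:: 1; 5; 33; 35]); ([:: 5; 31; 38], [:: 29; 39]); ([:: 31; 38], [:: 17;
29; 39]); ([:: 29; 31; 35], [:: 5; 17]); ([:: 29; 35], [:: 5; 17; 33]); ([::
29; 33], [:: 5; 17; 34]); ([:: 29; 31], [:: 5; 17; 39]); ([:: 29; 34], [:: 5;
17; 30]); ([:: 29; 39], [:: 5; 17; 38]); ([:: 16; 24; 39], [:: 36; 51]); ([::
24; 39], [:: 0; 36; 51]); ([:: 0; 24; 36], [:: 38; 51]); ([:: 24; 36], [:: 16;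
38; 51]); ([:: 0; 24; 48], [:: 50; 51]); ([:: 0; 24], [:: 38; 50; 51]); ([::
0; 48], [:: 4; 50; 51]); ([:: 24; 48], [:: 16; 50; 51]); ([:: 2; 38; 46], [::
0; 1]); ([:: 4; 7; 31], [:: 35; 39]); ([:: 24], [:: 16; 38; 50; 51]); ([:: 7;
31], [:: 5; 35; 39]); ([:: 2; 38], [:: 0; 1; 50]); ([:: 2; 50], [:: 0; 1;
10]); ([:: 17; 18; 30], [:: 34; 38]); ([:: 18; 30], [:: 16; 34; 38]); ([:: 16;
30], [:: 4; 34; 38]); ([:: 5; 31], [:: 17; 35; 39]); ([:: 2; 46], [:: 0; 1;
34]); ([:: 4; 31], [:: 16; 35; 39]); ([:: 10; 50], [:: 0; 1; 5]); ([:: 2], [::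
0; 1; 10; 34]); ([:: 10], [:: 0; 1; 5; 34]); ([:: 4; 30], [:: 5; 34; 38]);
([:: 31], [:: 16; 17; 35; 39]); ([:: 29], [:: 5; 17; 30; 38]); ([:: 30], [::
5; 17; 34; 38]); ([:: 4; 34; 38], [:: 5; 16]); ([:: 4; 36; 39], [:: 12; 16]);
([:: 4; 36], [:: 12; 16; 38]); ([:: 1; 13; 39], [:: 38; 47]); ([:: 13; 39],
[:: 5; 38; 47]); ([:: 17; 43; 51], [:: 16; 41]); ([:: 17; 43], [:: 16; 41;
47]); ([:: 17; 21; 34], [:: 33; 46]); ([:: 0; 36; 39], [:: 12; 51]); ([:: 21;
34], [:: 1; 33; 46]); ([:: 0; 39], [:: 12; 47; 51]); ([:: 0; 36], [:: 12; 38;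
51]); ([:: 0; 12; 47], [:: 46; 51]); ([:: 4; 34], [:: 0; 5; 16]); ([:: 36;
39], [:: 12; 16; 51]); ([:: 17; 49; 50], [:: 1; 41]); ([:: 17; 49], [:: 1; 41;
51]); ([:: 36], [:: 12; 16; 38; 51]); ([:: 16; 18; 38], [:: 34; 50]); ([:: 16;
40; 47], [:: 43; 46]); ([:: 49; 50], [:: 1; 5; 41]); ([:: 18; 38], [:: 17; 34;
50]); ([:: 40; 47], [:: 4; 43; 46]); ([:: 49], [:: 1; 5; 41; 51]); ([:: 17;
18], [:: 34; 46; 50]); ([:: 18], [:: 16; 34; 46; 50]); ([:: 4; 12; 47], [::
39; 46]); ([:: 12; 47], [:: 39; 46; 51]); ([:: 1; 21; 47], [:: 35; 45]); ([::
21; 47], [:: 17; 35; 45]); ([:: 1; 5; 33], [:: 34; 35]); ([:: 5; 33], [:: 17;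
34; 35]); ([:: 4; 7; 51], [:: 35; 43]); ([:: 16; 17; 47], [:: 35; 41]); ([::
7; 51], [:: 5; 35; 43]); ([:: 0; 5; 34], [:: 1; 16]); ([:: 0; 34], [:: 1; 16;
46]); ([:: 17; 47], [:: 35; 41; 45]); ([:: 1; 13; 46], [:: 38; 45]); ([:: 13;
46], [:: 5; 38; 45]); ([:: 1; 13], [:: 38; 45; 47]); ([:: 13], [:: 5; 38; 45;
47]); ([:: 1; 17; 51], [:: 39; 41]); ([:: 17; 51], [:: 16; 39; 41]); ([:: 16;
17], [:: 35; 39; 41]); ([:: 1; 38; 39], [:: 17; 47]); ([:: 38; 39], [:: 5; 17;
47]); ([:: 1; 21; 33], [:: 35; 46]); ([:: 21; 33], [:: 17; 35; 46]); ([:: 1;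
17; 47], [:: 38; 39]); ([:: 5; 45; 47], [:: 38; 41]); ([:: 41; 45; 47], [::
35; 38]); ([:: 5; 45], [:: 38; 41; 46]); ([:: 17; 21], [:: 35; 45; 46]); ([::
21], [:: 1; 35; 45; 46]); ([:: 1; 33], [:: 34; 35; 46]); ([:: 17; 47], [:: 5;
38; 39]); ([:: 4; 48], [:: 40; 50; 51]); ([:: 45; 47], [:: 1; 35; 38]); ([::
33], [:: 17; 34; 35; 46]); ([:: 48], [:: 16; 40; 50; 51]); ([:: 1; 45], [::
35; 38; 46]); ([:: 17; 45], [:: 35; 41; 46]); ([:: 45], [:: 35; 38; 41; 46]);
([:: 5; 7; 35], [:: 39; 43]); ([:: 7; 35], [:: 4; 39; 43]); ([:: 5; 7], [::
39; 43; 47]); ([:: 1; 17; 38], [:: 39; 50]); ([:: 1; 17], [:: 39; 41; 50]);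
([:: 7], [:: 4; 39; 43; 47]); ([:: 4; 47], [:: 39; 43; 46]); ([:: 5; 41; 51],
[:: 1; 43]); ([:: 5; 51], [:: 1; 35; 43]); ([:: 34; 35; 46], [:: 1; 17]); ([::
5; 38; 46], [:: 4; 41]); ([:: 1; 5; 16], [:: 0; 34]); ([:: 1; 16], [:: 0; 34;
46]); ([:: 5; 34; 38], [:: 16; 17]); ([:: 5; 46], [:: 4; 41; 50]); ([:: 0; 5;
50], [:: 1; 4]); ([:: 5; 50], [:: 1; 4; 41]); ([:: 34; 38], [:: 16; 17; 50]);
([:: 16; 40; 51], [:: 43; 50]); ([:: 16; 40], [:: 43; 46; 50]); ([:: 34; 50],
[:: 16; 17; 46]); ([:: 16; 17; 38], [:: 5; 50]); ([:: 1; 4; 5], [:: 0; 41]);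
([:: 34; 35], [:: 1; 5; 17]); ([:: 17; 38], [:: 5; 39; 50]); ([:: 0; 35; 51],
[:: 4; 47]); ([:: 1; 4], [:: 0; 41; 50]); ([:: 35; 43; 51], [:: 1; 4]); ([::
35; 51], [:: 1; 4; 47]); ([:: 1; 41; 50], [:: 0; 39]); ([:: 40; 51], [:: 4;
43; 50]); ([:: 1; 34; 46], [:: 0; 17]); ([:: 1; 4; 43], [:: 35; 51]); ([:: 34;
46], [:: 0; 16; 17]); ([:: 40], [:: 4; 43; 46; 50]); ([:: 1; 4], [:: 35; 47;
51]); ([:: 17; 41; 46], [:: 35; 50]); ([:: 5; 17; 34], [:: 1; 16]); ([:: 17;
41], [:: 35; 39; 50]); ([:: 1; 50], [:: 0; 38; 39]); ([:: 17; 34], [:: 0; 1;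
16]); ([:: 34], [:: 0; 1; 5; 16]); ([:: 4; 47], [:: 0; 35; 51]); ([:: 1; 35;
43], [:: 5; 51]); ([:: 4; 35; 51], [:: 0; 43]); ([:: 4; 51], [:: 0; 43; 50]);
([:: 1; 43], [:: 5; 41; 51]); ([:: 5; 39; 47], [:: 38; 43]); ([:: 5; 47], [::
38; 41; 43]); ([:: 0; 12], [:: 38; 46; 51]); ([:: 12; 16; 39], [:: 4; 51]);
([:: 17; 39], [:: 5; 35; 50]); ([:: 12; 16], [:: 4; 38; 51]); ([:: 12; 38],
[:: 4; 46; 51]); ([:: 38; 39; 43], [:: 5; 47]); ([:: 12], [:: 4; 39; 46;
  51])]%num.

Definition labels3 : seq N :=
[:: 0; 1; 4; 5; 16; 17; 35; 38; 39; 41; 43; 46; 47; 50; 51]%num.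

Definition flips4 : seq (seq N * seq N) :=
[:: ([:: 16; 24; 48], [:: 13; 14]); ([:: 16; 48], [:: 13; 14; 30]); ([:: 16;
30], [:: 13; 14; 39]); ([:: 0; 26; 32], [:: 41; 50]); ([:: 1; 7; 9], [:: 39;
50]); ([:: 1; 9], [:: 3; 39; 50]); ([:: 26; 32], [:: 13; 41; 50]); ([:: 0;
32], [:: 3; 41; 50]); ([:: 7; 9], [:: 4; 39; 50]); ([:: 3; 32], [:: 1; 41;
50]); ([:: 13; 32], [:: 16; 41; 50]); ([:: 16; 32], [:: 14; 41; 50]); ([:: 3;
9], [:: 0; 39; 50]); ([:: 0; 9], [:: 6; 39; 50]); ([:: 16; 39], [:: 13; 14;
22]); ([:: 10; 46; 48], [:: 1; 4]); ([:: 16; 24], [:: 13; 14; 41]); ([:: 10;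
46], [:: 1; 4; 47]); ([:: 10; 48], [:: 1; 4; 11]); ([:: 1; 32], [:: 31; 41;
50]); ([:: 5; 8; 38], [:: 0; 4]); ([:: 5; 8], [:: 0; 4; 51]); ([:: 10; 47],
[:: 1; 4; 12]); ([:: 28; 46; 47], [:: 1; 14]); ([:: 5; 38], [:: 0; 4; 35]);
([:: 18; 35; 41], [:: 13; 17]); ([:: 13; 14; 30], [:: 39; 48]); ([:: 32], [::
14; 31; 41; 50]); ([:: 5; 51], [:: 0; 4; 45]); ([:: 14; 30], [:: 28; 39; 48]);
([:: 28; 47], [:: 1; 14; 29]); ([:: 18; 41], [:: 13; 17; 24]); ([:: 0; 6; 36],
[:: 39; 42]); ([:: 28; 46], [:: 1; 14; 48]); ([:: 20; 21; 38], [:: 14; 17]);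
([:: 9], [:: 4; 6; 39; 50]); ([:: 28; 30], [:: 1; 39; 48]); ([:: 5; 35], [::
0; 4; 41]); ([:: 18; 24], [:: 13; 17; 48]); ([:: 18; 35], [:: 13; 17; 38]);
([:: 1; 2; 33], [:: 42; 51]); ([:: 20; 38], [:: 14; 17; 37]); ([:: 16; 41],
[:: 13; 14; 50]); ([:: 1; 33], [:: 31; 42; 51]); ([:: 10; 11], [:: 1; 4; 41]);
([:: 18; 38], [:: 13; 17; 21]); ([:: 5; 41], [:: 0; 4; 11]); ([:: 10; 41], [::
1; 4; 40]); ([:: 5; 11], [:: 0; 4; 48]); ([:: 28; 29], [:: 1; 14; 38]); ([::
1; 30], [:: 3; 39; 48]); ([:: 0; 36], [:: 27; 39; 42]); ([:: 31; 33], [:: 14;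
42; 51]); ([:: 18; 21], [:: 13; 17; 51]); ([:: 18; 48], [:: 13; 17; 45]); ([::
28; 38], [:: 1; 14; 37]); ([:: 5], [:: 0; 4; 45; 48]); ([:: 2; 33], [:: 0; 42;
51]); ([:: 3; 30], [:: 0; 39; 48]); ([:: 27; 36], [:: 13; 39; 42]); ([:: 18],
[:: 13; 17; 45; 51]); ([:: 20; 37], [:: 14; 17; 39]); ([:: 16], [:: 13; 14;
22; 50]); ([:: 10; 12], [:: 1; 4; 42]); ([:: 20; 39], [:: 14; 17; 22]); ([::
0; 30], [:: 27; 39; 48]); ([:: 0; 33], [:: 27; 42; 51]); ([:: 20; 21], [:: 14;
17; 51]); ([:: 13; 36], [:: 19; 39; 42]); ([:: 6; 36], [:: 4; 39; 42]); ([::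
4; 36], [:: 34; 39; 42]); ([:: 19; 36], [:: 17; 39; 42]); ([:: 10], [:: 1; 4;
40; 42]); ([:: 20; 22], [:: 14; 17; 50]); ([:: 28; 48], [:: 1; 14; 39]); ([::
28], [:: 1; 14; 37; 39]); ([:: 36], [:: 17; 34; 39; 42]); ([:: 27; 33], [::
13; 42; 51]); ([:: 20; 50], [:: 14; 17; 49]); ([:: 14; 33], [:: 15; 42; 51]);
([:: 20], [:: 14; 17; 49; 51]); ([:: 30], [:: 13; 27; 39; 48]); ([:: 33], [::
13; 15; 42; 51]); ([:: 14; 31; 40], [:: 41; 42]); ([:: 31; 40], [:: 1; 41;
42]); ([:: 1; 40], [:: 4; 41; 42]); ([:: 14; 40], [:: 23; 41; 42]); ([:: 23;
40], [:: 17; 41; 42]); ([:: 17; 40], [:: 34; 41; 42]); ([:: 17; 23; 24], [::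
41; 48]); ([:: 13; 17; 35], [:: 38; 41]); ([:: 23; 24], [:: 14; 41; 48]); ([::
40], [:: 4; 34; 41; 42]); ([:: 17; 35], [:: 34; 38; 41]); ([:: 17; 24], [::
13; 41; 48]); ([:: 34; 35], [:: 4; 38; 41]); ([:: 24], [:: 13; 14; 41; 48]);
([:: 4; 35], [:: 0; 38; 41]); ([:: 13; 35], [:: 26; 38; 41]); ([:: 35], [:: 0;
26; 38; 41]); ([:: 4; 44; 50], [:: 6; 43]); ([:: 4; 44], [:: 6; 43; 47]); ([::
13; 19; 25], [:: 42; 47]); ([:: 17; 46; 47], [:: 23; 43]); ([:: 19; 25], [::
17; 42; 47]); ([:: 1; 46; 47], [:: 4; 14]); ([:: 23; 46; 47], [:: 14; 43]);
([:: 17; 19; 39], [:: 22; 42]); ([:: 3; 39; 50], [:: 0; 1]); ([:: 46; 47], [::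
4; 14; 43]); ([:: 3; 39], [:: 0; 1; 48]); ([:: 17; 25], [:: 23; 42; 47]); ([::
17; 46], [:: 23; 43; 48]); ([:: 23; 25], [:: 14; 42; 47]); ([:: 19; 39], [::
13; 22; 42]); ([:: 14; 21; 38], [:: 15; 17]); ([:: 1; 46], [:: 4; 14; 48]);
([:: 21; 38], [:: 13; 15; 17]); ([:: 13; 21], [:: 15; 17; 51]); ([:: 13; 25],
[:: 15; 42; 47]); ([:: 4; 46], [:: 14; 43; 48]); ([:: 21], [:: 14; 15; 17;
51]); ([:: 25], [:: 14; 15; 42; 47]); ([:: 3; 50], [:: 0; 1; 41]); ([:: 3;
41], [:: 0; 1; 11]); ([:: 46], [:: 14; 23; 43; 48]); ([:: 11; 41], [:: 0; 1;
4]); ([:: 3], [:: 0; 1; 11; 48]); ([:: 11], [:: 0; 1; 4; 48]); ([:: 27; 45;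
48], [:: 0; 13]); ([:: 27; 45], [:: 0; 13; 51]); ([:: 27; 48], [:: 0; 13;
39]); ([:: 27; 39], [:: 0; 13; 42]); ([:: 1; 7; 8], [:: 38; 51]); ([:: 7; 8],
[:: 4; 38; 51]); ([:: 17; 23; 42], [:: 41; 47]); ([:: 4; 8], [:: 0; 38; 51]);
([:: 14; 31; 49], [:: 50; 51]); ([:: 23; 42], [:: 14; 41; 47]); ([:: 14; 49],
[:: 17; 50; 51]); ([:: 1; 8], [:: 2; 38; 51]); ([:: 6; 44; 47], [:: 0; 43]);
([:: 27], [:: 0; 13; 42; 51]); ([:: 31; 49], [:: 1; 50; 51]); ([:: 1; 49], [::
7; 50; 51]); ([:: 17; 49], [:: 43; 50; 51]); ([:: 43; 49], [:: 4; 50; 51]);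
([:: 8], [:: 0; 2; 38; 51]); ([:: 49], [:: 4; 7; 50; 51]); ([:: 6; 44], [:: 0;
43; 50]); ([:: 34; 38; 41], [:: 4; 17]); ([:: 34; 38], [:: 4; 17; 37]); ([::
17; 43; 44], [:: 47; 50]); ([:: 43; 44], [:: 0; 47; 50]); ([:: 34; 37], [:: 4;
17; 39]); ([:: 34; 41], [:: 4; 17; 42]); ([:: 34], [:: 4; 17; 39; 42]); ([::
17; 44], [:: 19; 47; 50]); ([:: 19; 44], [:: 13; 47; 50]); ([:: 0; 44], [::
26; 47; 50]); ([:: 0; 43], [:: 6; 47; 50]); ([:: 6; 43], [:: 4; 47; 50]); ([::
44], [:: 13; 26; 47; 50]); ([:: 14; 17; 37], [:: 38; 39]); ([:: 14; 37], [::
1; 38; 39]); ([:: 17; 37], [:: 4; 38; 39]); ([:: 4; 37], [:: 7; 38; 39]); ([::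
37], [:: 1; 7; 38; 39]); ([:: 17; 45; 48], [:: 13; 43]); ([:: 17; 45], [:: 13;
43; 51]); ([:: 1; 2; 51], [:: 38; 42]); ([:: 2; 51], [:: 0; 38; 42]); ([:: 43;
45; 51], [:: 4; 13]); ([:: 43; 45], [:: 4; 13; 48]); ([:: 45; 51], [:: 0; 4;
13]); ([:: 17; 19; 22], [:: 42; 50]); ([:: 19; 22], [:: 13; 42; 50]); ([:: 17;
19], [:: 42; 47; 50]); ([:: 19], [:: 13; 42; 47; 50]); ([:: 45], [:: 0; 4; 13;
48]); ([:: 1; 7; 38], [:: 39; 51]); ([:: 7; 38], [:: 4; 39; 51]); ([:: 0; 39;
48], [:: 1; 13]); ([:: 39; 48], [:: 1; 13; 14]); ([:: 0; 48], [:: 1; 4; 13]);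
([:: 1; 48], [:: 4; 13; 14]); ([:: 4; 7], [:: 39; 50; 51]); ([:: 4; 48], [::
13; 14; 43]); ([:: 7], [:: 1; 39; 50; 51]); ([:: 0; 2; 29], [:: 38; 47]); ([::
2; 29], [:: 1; 38; 47]); ([:: 1; 29], [:: 14; 38; 47]); ([:: 13; 17; 48], [::
41; 43]); ([:: 14; 29], [:: 15; 38; 47]); ([:: 17; 48], [:: 23; 41; 43]); ([::
23; 48], [:: 14; 41; 43]); ([:: 48], [:: 13; 14; 41; 43]); ([:: 14; 23], [::
41; 43; 47]); ([:: 0; 29], [:: 26; 38; 47]); ([:: 23], [:: 17; 41; 43; 47]);
([:: 15; 29], [:: 13; 38; 47]); ([:: 29], [:: 13; 26; 38; 47]); ([:: 14; 31;
42], [:: 41; 51]); ([:: 31; 42], [:: 1; 41; 51]); ([:: 1; 31], [:: 41; 50;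
51]); ([:: 31], [:: 14; 41; 50; 51]); ([:: 0; 6; 42], [:: 12; 39]); ([:: 6;
42], [:: 4; 12; 39]); ([:: 0; 2; 42], [:: 12; 38]); ([:: 0; 2], [:: 12; 38;
47]); ([:: 1; 4; 13], [:: 0; 14]); ([:: 1; 13], [:: 0; 14; 39]); ([:: 2; 47],
[:: 1; 12; 38]); ([:: 13; 14; 39], [:: 0; 22]); ([:: 2], [:: 1; 12; 38; 42]);
([:: 4; 13; 14], [:: 0; 43]); ([:: 4; 13], [:: 0; 43; 51]); ([:: 13; 39], [::
0; 22; 42]); ([:: 14; 41; 42], [:: 47; 51]); ([:: 14; 42], [:: 15; 47; 51]);
([:: 15; 42], [:: 13; 47; 51]); ([:: 4; 6; 12], [:: 39; 47]); ([:: 6; 12], [::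
0; 39; 47]); ([:: 4; 6], [:: 39; 47; 50]); ([:: 0; 13; 22], [:: 14; 42]); ([::
6], [:: 0; 39; 47; 50]); ([:: 13; 22], [:: 14; 42; 50]); ([:: 22; 50], [:: 14;
17; 42]); ([:: 0; 22], [:: 14; 39; 42]); ([:: 22], [:: 14; 17; 39; 42]); ([::
0; 38; 41], [:: 4; 26]); ([:: 26; 38; 41], [:: 4; 13]); ([:: 38; 41], [:: 4;
13; 17]); ([:: 4; 13; 38], [:: 17; 26]); ([:: 4; 13], [:: 17; 26; 41]); ([::
13; 17; 26], [:: 38; 41]); ([:: 17; 26], [:: 4; 38; 41]); ([:: 17; 41; 47],
[:: 42; 43]); ([:: 17; 47], [:: 42; 43; 50]); ([:: 14; 15; 51], [:: 17; 47]);
([:: 4; 26], [:: 0; 38; 41]); ([:: 1; 50; 51], [:: 39; 41]); ([:: 14; 15], [::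
17; 38; 47]); ([:: 1; 50], [:: 0; 39; 41]); ([:: 15; 51], [:: 13; 17; 47]);
([:: 15], [:: 13; 17; 38; 47]); ([:: 13; 26; 41], [:: 38; 50]); ([:: 26; 41],
[:: 0; 38; 50]); ([:: 13; 26], [:: 38; 47; 50]); ([:: 26], [:: 0; 38; 47;
50])]%num.

Definition labels4 : seq N :=
[:: 0; 1; 4; 12; 13; 14; 17; 38; 39; 41; 42; 43; 47; 50; 51]%num.

Definition ord3s : seq 'I_3 :=
  [:: @Ordinal 3 0 isT; @Ordinal 3 1 isT; @Ordinal 3 2 isT].
Definition ord2s : seq 'I_2 := [:: @Ordinal 2 0 isT; @Ordinal 2 1 isT].
Definition ord4s : seq 'I_4 :=
  [:: @Ordinal 4 0 isT; @Ordinal 4 1 isT; @Ordinal 4 2 isT; @Ordinal 4 3 isT].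
Definition signs : seq bool := [:: true; false].
Definition levels : seq (option bool) := [:: None; Some true; Some false].
Definition octahedron : seq ('I_3 * bool) :=
  [seq (i, b) | i <- ord3s, b <- signs].
Definition square : seq ('I_2 * bool) := [seq (i, b) | i <- ord2s, b <- signs].
Definition cubes : seq (option bool * option bool * option bool) :=
  [seq v <- [seq (ab, c) | ab <- [seq (a, b) | a <- levels, b <- levels],
    c <- levels] | v != cube_center].
(** Of two antipodal faces, the one whose first coordinate other than [None] is [Some true]. *)
Definition cube_rep (v : option bool * option bool * option bool) :=
  let: (a, b, c) := v in
  if (if a is Some s then s else if b is Some s then s else
      if c is Some s then s else true) then v else cubeV v.
Definition cube_reps := [seq v <- cubes | cube_rep v == v].

Definition label_in (V : eqType) (can : V -> V) (lab : seq V) (v : V) : N :=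
  N.of_nat (index (can v) lab).

Definition verts1 : seq ('I_3 * bool * ('I_2 * bool)) :=
  [seq (v, w) | v <- octahedron, w <- square].
Definition cmp1 : rel ('I_3 * bool * ('I_2 * bool)) :=
  comparability (prodrel (@cross_le 3) (@cross_le 2)).
Definition p1 := label_in id verts1.

Definition reflV (v : 'I_3 * bool) : 'I_3 * bool :=
  (v.1, if v.1 == ord0 then ~~ v.2 else v.2).
Definition verts2 : seq ('I_3 * bool * 'I_4) :=
  [seq (v, l) | v <- octahedron, l <- ord4s].
Definition cmp2 : rel ('I_3 * bool * 'I_4) :=
  comparability (prodrel (@cross_le 3) zigzag_le).
(* can2, can3 and can4 choose a representative of each class of identified
   vertices. *)
Definition can2 (v : 'I_3 * bool * 'I_4) :=
  if v.2 == ord_max then (reflV v.1, ord0) else v.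
Definition p2 := label_in can2 [seq v <- verts2 | v.2 != ord_max].

Definition cubeT : finType := (option bool * option bool * option bool)%type.
Definition verts3 : seq (cubeT * ('I_2 * bool)) :=
  [seq (e, w) | e <- cubes, w <- square].
Definition cmp3 : rel (cubeT * ('I_2 * bool)) :=
  induced (fun v => v.1 != cube_center) (comparability (prodrel cube_le
    (@cross_le 2))).
Definition can3 (v : cubeT * ('I_2 * bool)) := (cube_rep v.1, v.2).
Definition p3 := label_in can3 [seq (e, w) | e <- cube_reps, w <- square].

Definition verts4 : seq (bool * (cubeT * option bool)) :=
  [seq (c, v) | c <- signs, v <- [seq (e, l) | e <- cubes, l <- levels]].
Definition cmp4 : rel (bool * (cubeT * option bool)) :=
  induced (fun v => v.2.1 != cube_center)
     (fun v w => (v.1 == w.1) && comparability (prodrel cube_le star_le)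
       v.2 w.2).
Definition can4 (v : bool * (cubeT * option bool)) :=
  let: (c, (e, l)) := v in
  if l is Some s then (false, (if s then e else cubeV e, Some true))
  else (c, (cube_rep e, None)).
(** A cube has 26 proper faces, in 13 antipodal pairs. Each copy contributes 13 classes at its
    middle level; the boundary sphere common to both contributes 26, written at the level
    [Some true] of the copy [false]. This makes 52 labels. *)
Definition p4 := label_in can4
  ([seq (c, (e, None)) | c <- signs, e <- cube_reps] ++ [seq (false, (e,
    Some true)) | e <- cubes]).

Lemma flips1_check : flips_check 24 flips1 labels1 (glued_facets cmp1 verts1
  p1).
Proof. by vm_compute. Qed.

Lemma covers1 : covers cmp1 5 verts1 (cliques cmp1 4 verts1).
Proof. by vm_compute. Qed.

Lemma flips2_check : flips_check 18 flips2 labels2 (glued_facets cmp2 verts2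
  p2).
Proof. by vm_compute. Qed.

Lemma covers2 : covers cmp2 5 verts2 (cliques cmp2 4 verts2).
Proof. by vm_compute. Qed.

Lemma flips3_check : flips_check 52 flips3 labels3 (glued_facets cmp3 verts3
  p3).
Proof. by vm_compute. Qed.

Lemma covers3 : covers cmp3 5 verts3 (cliques cmp3 4 verts3).
Proof. by vm_compute. Qed.

Lemma flips4_check : flips_check 52 flips4 labels4 (glued_facets cmp4 verts4
  p4).
Proof. by vm_compute. Qed.

Lemma covers4 : covers cmp4 5 verts4 (cliques cmp4 4 verts4).
Proof. by vm_compute. Qed.

(** * The four manifolds *)

Section Projective.
Variables (R : realType) (n : nat).
Local Notation S := (sphere R n).
Local Notation pi := (quotient_by_pi (fun x y : S => \val y = - \val x)).

Lemma antipode_subproof (x : S) : - \val x \in sphere R n.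
Proof.
by apply: sphere_mem; rewrite -[RHS](sphere_eq x); apply: eq_bigr => i _;
  rewrite mxE sqrrN.
Qed.

Definition antipode (x : S) : S := exist _ (- \val x) (antipode_subproof x).

Lemma antipode_continuous : continuous antipode.
Proof.
apply: set_type_continuous.
have h : continuous (-%R \o (\val : S -> 'rV[R]_n.+1)).
  by move=> x; apply: continuous_comp; [exact: set_val_continuous|exact:
    opp_continuous].
exact: h.
Qed.

Lemma projective_piP x y : pi x = pi y <-> \val y = \val x \/ \val y = - \val x.
Proof.
rewrite quotient_by_piP; split.
  elim=> [a b ->|a|a b _ []->|a b c _ [] -> _ [] ->]; rewrite ?opprK; auto.
case=> [/val_inj ->|e]; [exact: rst_refl|exact: rst_step].
Qed.

(** The saturation of an open set is its union with its antipodal image, so the projection is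
    open. *)
Lemma projective_pi_nbhs x U : nbhs x U -> nbhs (pi x) (pi @` U).
Proof.
rewrite nbhsE => - [W [oW Wx] WU].
apply: (@filterS _ _ _ (pi @` W)); first exact: image_subset.
apply: open_nbhs_nbhs; split; last by exists x.
rewrite /open /= /quotient_open.
rewrite (_ : _ @^-1` _ = W `|` antipode @^-1` W).
  by apply: openU => //; move/continuousP: antipode_continuous; apply.
apply/seteqP; split=> y /=.
  move=> [z Wz /projective_piP[/val_inj ->|e]]; [by left|right].
  by rewrite (_ : antipode y = z) //; apply: val_inj; rewrite /= e opprK.
case=> [Wy|Wy]; first by exists y.
by exists (antipode y) => //; apply/projective_piP; right; rewrite /= opprK.
Qed.

Lemma projective_compact : compact [set: projective_space R n].
Proof. exact/quotient_by_compact/compact_sphere. Qed.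

Lemma projective_lift (Y : Type) (f : S -> Y) x :
  (forall x, f (antipode x) = f x) -> quotient_lift f (pi x) = f x.
Proof.
move=> fN; apply: quotient_liftE => a b ab; rewrite -(fN a); congr f.
exact: val_inj.
Qed.
End Projective.

Lemma compact_setXT (X Y : topologicalType) :
  compact [set: X] -> compact [set: Y] -> compact [set: X * Y].
Proof. by move=> cX cY; have := compact_setX cX cY; rewrite setXTT. Qed.

Section Labels.
Variables (V : eqType) (can : V -> V) (lab : seq V).

Lemma label_in_inj v w : can v \in lab -> can w \in lab ->
  label_in can lab v = label_in can lab w -> can v = can w.
Proof.
move=> vl wl /Nnat.Nat2N.inj e.
by rewrite -(nth_index (can v) vl) e nth_index.
Qed.

Lemma label_in_lt v : can v \in lab -> (label_in can lab v < N.of_nat (size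
  lab))%num.
Proof. by rewrite -index_mem /label_in => h; lia. Qed.
End Labels.

Lemma comparabilityC (P : finType) (le : rel P) : symmetric (comparability le).
Proof. by move=> v w; rewrite /comparability orbC. Qed.

Lemma mem_octahedron v : v \in octahedron.
Proof. by move: v => [[[|[|[|//]]] ?] []]. Qed.

Lemma mem_square v : v \in square.
Proof. by move: v => [[[|[|//]] ?] []]. Qed.

Lemma mem_ord4s v : v \in ord4s.
Proof. by move: v => [[|[|[|[|//]]]] ?]. Qed.

Lemma mem_cubes v : (v \in cubes) = (v != cube_center).
Proof. by move: v => [[[[]|] [[]|]] [[]|]]. Qed.

Lemma mem_levels v : v \in levels.
Proof. by move: v => [[]|]. Qed.

Lemma continuous_fst_at (X Y Z : topologicalType) (f : X -> Z) (m : X * Y) :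
  {for m.1, continuous f} -> {for m, continuous (fun t : X * Y => f t.1)}.
Proof. by move=> cf; apply: (@continuous_comp _ _ _ fst f) => //;
  exact: cvg_fst. Qed.

Lemma continuous_snd_at (X Y Z : topologicalType) (f : Y -> Z) (m : X * Y) :
  {for m.2, continuous f} -> {for m, continuous (fun t : X * Y => f t.2)}.
Proof. by move=> cf; apply: (@continuous_comp _ _ _ snd f) => //;
  exact: cvg_snd. Qed.

Lemma continuous_val_at (X Z : topologicalType) (A : set X) (f : X ->
  Z) (m : A) :
  {for \val m, continuous f} -> {for m, continuous (fun t : A => f (\val t))}.
Proof.
by move=> cf; apply: (@continuous_comp _ _ _ (\val : A -> X) f) => //;
  exact: set_val_continuous.
Qed.

(** * The product of S^2 and S^1 *)

Section Product1.
Variable R : realType.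
Local Notation M := (sphere R 2 * sphere R 1)%type.

Definition coord1 (m : M) : ('I_3 * bool) * ('I_2 * bool) -> R :=
  prodc (@cross_le 3) (@cross_le 2) (cross (\val m.1)) (cross (\val m.2)).

Lemma product_sphere_circle_triangulation : has_triangulation_le R 15 M.
Proof.
have memv v : v \in verts1.
  case: v => v w; rewrite /verts1; by apply/allpairsP; exists (v, w); split;
    [exact: mem_octahedron|exact: mem_square|].
have pos := prodrel_poset (@cross_le_poset 3) (@cross_le_poset 2).
have p_lt v : cmp1 v v -> (p1 v < N.of_nat 24)%num by move=> _;
  exact: label_in_lt.
have p_inj v w : cmp1 v w -> p1 v = p1 w -> v = w by move=> _;
  exact: label_in_inj.
have c1 m : cpoint cmp1 (coord1 m).
  by apply: prodc_point; [exact: cross_le_poset|exact: cross_le_poset|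
     exact/cross_point/sphere_neq0..].
have cC : symmetric cmp1 by exact: comparabilityC.
have memvs v : (v \in verts1) = cmp1 v v.
  by rewrite memv /cmp1 /comparability (let: And3 r _ _ := pos in r).
apply: (flips_triangulation flips1_check).
apply: (@polyhedron_homeomorphic R _ _ _ (fun m => push 24 p1 (coord1 m))).
- by apply: compact_setXT; exact: compact_sphere.
- move=> m; apply: push_continuous_at => v; apply: prodc_continuous_at => w.
    apply: (continuous_fst_at (f := fun u : sphere R 2 => cross (\val u) w)).
    apply: (continuous_val_at (f := fun u => cross u w)).
    exact/cross_continuous_at/sphere_neq0.
  apply: (continuous_snd_at (f := fun u : sphere R 1 => cross (\val u) w)).
  apply: (continuous_val_at (f := fun u => cross u w)).
  exact/cross_continuous_at/sphere_neq0.
- move=> m m' e.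
  (* Nothing is glued here: the only symmetry is the identity, and [push] is a mere change of
     indices. *)
  have [||_ h] := push_fiber (G := unit) (E := fun _ v v' => v = v')
    p_lt p_inj _ _ (c1 m) (c1 m') e.
  + by move=> v v' _ _ /(label_in_inj (memv _) (memv _)) vv'; exists tt.
  + by move=> [] [].
  have h' v : coord1 m v != 0 -> coord1 m' (id v) = coord1 m v by move=>
    /h[v' <-].
  have hh : coord1 m' =1 coord1 m := cpoint_reindex (@inj_id _) (c1 m) (c1 m')
    h'.
  have [e1 e2] := prodc_inj (@cross_le_poset 3) (@cross_le_poset 2)
    (cross_point (sphere_neq0 m'.1)) (cross_point (sphere_neq0 m'.2)) 
    (cross_point (sphere_neq0 m.1)) (cross_point (sphere_neq0 m.2)) hh.
  case: m m' {e h h' hh} e1 e2 => [u w] [u' w'] /= e1 e2.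
  have eu : \val u' = \val u := cross_inj (sphere_eq u') (sphere_eq u)
    (sphere_neq0 u') (sphere_neq0 u) e1.
  have ew : \val w' = \val w := cross_inj (sphere_eq w') (sphere_eq w)
    (sphere_neq0 w') (sphere_neq0 w) e2.
  by rewrite (val_inj eu) (val_inj ew).
- by move=> m; apply: push_polyhedron; [exact: memvs|exact: p_lt|exact:
  covers1|exact: c1].
- move=> y /(push_surjective cC memvs p_lt p_inj)[x cx <-].
  have [u [u1 eu]] := cross_surj (marg1_point cx).
  have [w [w1 ew]] := cross_surj (marg2_point cx).
  exists (exist _ u (sphere_mem u1), exist _ w (sphere_mem w1)).
  congr push; apply/funext => v; rewrite /coord1 /=.
  rewrite -[RHS](prodc_marg (@cross_le_poset 3) (@cross_le_poset 2) cx).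
  exact: prodc_ext.
Qed.
End Product1.

Lemma quotient_polyhedron_homeomorphic (R : realType) n (K : {set 'I_n} -> Prop)
    (X : topologicalType) (r : X -> X -> Prop) (F : X -> 'rV[R]_n) :
  compact [set: X] -> continuous F -> (forall x y, r x y -> F x = F y) ->
  (forall x y, F x = F y -> clos_refl_sym_trans X r x y) ->
  (forall x, polyhedron R K (F x)) ->
  (forall y, polyhedron R K y -> exists x, F x = y) ->
  homeomorphic (polyhedron R K) (quotient_by r).
Proof.
move=> cX cF rF Fr FK Fs.
apply: (@polyhedron_homeomorphic R _ _ _ (quotient_lift F)).
- exact: quotient_by_compact.
- exact: quotient_lift_continuous.
- exact: quotient_lift_inj.
- by move=> m; exact: FK.
- by move=> y /Fs[x <-]; exists (quotient_by_pi r x); exact: quotient_liftE.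
Qed.

Lemma reflVK : involutive reflV.
Proof. by move=> [i b]; rewrite /reflV /=; case: (i == ord0);
  rewrite ?negbK. Qed.

Lemma cross_reflect (R : realType) (u : 'rV[R]_3) : cross (reflect_fun u)
  =1 cross u \o reflV.
Proof.
have n1 : norm1 (reflect_fun u) = norm1 u.
  by apply: eq_bigr => i _; rewrite mxE; case: ifP => // _; rewrite normrN.
move=> [i b]; rewrite /cross n1 /reflV /= mxE (_ : (i == 0) = (i == ord0)) //.
by case: (i == ord0) => //; case: b => //=; rewrite opprK.
Qed.

(** * The nonorientable S^2-bundle over S^1 *)

Section Twisted.
Variable R : realType.
Local Notation X := (sphere R 2 * set_type (`[0, 1] : set R))%type.

Definition coord2 (m : X) : ('I_3 * bool) * 'I_4 -> R :=
  prodc (@cross_le 3) zigzag_le (cross (\val m.1)) (zigzag (\val m.2)).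

Lemma itv_val (t : set_type (`[0, 1] : set R)) : 0 <= \val t <= 1.
Proof. by have := set_valP t; rewrite /= in_itv. Qed.

(** Besides the identity [None], the gluing of the bottom to the top and its inverse, each of them
    defined on one end level only. *)
Definition glue2 (g : option bool) (v v' : ('I_3 * bool) * 'I_4) : Prop :=
  match g with
  | None => v' = v
  | Some true => [/\ v.2 = ord0, v'.2 = ord_max & v'.1 = reflV v.1]
  | Some false => [/\ v.2 = ord_max, v'.2 = ord0 & v'.1 = reflV v.1]
  end.

(** A permutation of all vertices that extends both partial gluings of [glue2], as [push_eq] and
    [cpoint_reindex] require. What it does to the inner levels does not matter where their
    coordinates vanish. *)
Definition flip2 (v : ('I_3 * bool) * 'I_4) : ('I_3 * bool) * 'I_4 :=
  (reflV v.1, rev_ord v.2).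

Lemma flip2K : involutive flip2.
Proof. by move=> [v l]; rewrite /flip2 /= reflVK rev_ordK. Qed.

Lemma cross_sphere_point n (x : sphere R n) :
  cpoint (comparability (@cross_le n.+1)) (cross (\val x)).
Proof. exact/cross_point/sphere_neq0. Qed.

Lemma coord2_inj (m m' : X) : coord2 m' =1 coord2 m -> m = m'.
Proof.
move=> e; have [e1 e2] := prodc_inj (@cross_le_poset 3) zigzag_le_poset
  (cross_sphere_point m'.1) (zigzag_point (itv_val m'.2))
  (cross_sphere_point m.1) (zigzag_point (itv_val m.2)) e.
have eu : \val m'.1 = \val m.1 := cross_inj (sphere_eq m'.1) (sphere_eq m.1)
  (sphere_neq0 m'.1) (sphere_neq0 m.1) e1.
have et : \val m'.2 = \val m.2 := zigzag_inj (itv_val m'.2) (itv_val m.2) e2.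
by case: m m' eu et {e e1 e2} => [u t] [u' t'] /= /val_inj -> /val_inj ->.
Qed.

(** Weight on the bottom level alone forces parameter 0 for [m]; [flip2] moves that weight to the
    top level, which forces parameter 1 for [m']. The first marginals then compare the points of the
    sphere. *)
Lemma coord2_glued (m m' : X) : (forall v, coord2 m' (flip2 v) = coord2 m v) ->
  (forall v, coord2 m v != 0 -> v.2 = ord0) ->
  [/\ \val m.2 = 0, \val m'.2 = 1 & m'.1 = sphere_reflection m.1].
Proof.
move=> e supp0.
have poX := @cross_le_poset 3; have poZ := zigzag_le_poset.
have m1 (a : X) p : marg1 (coord2 a) p = cross (\val a.1) p.
  by apply: marg1_prodc => //; [exact:
    cross_sphere_point|exact/zigzag_point/itv_val].
have m2 (a : X) l : marg2 (coord2 a) l = zigzag (\val a.2) l.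
  by apply: marg2_prodc => //; [exact:
    cross_sphere_point|exact/zigzag_point/itv_val].
have t0 l : l != ord0 -> zigzag (\val m.2) l = 0.
  move=> l0; apply/eqP; apply: contraNT l0; rewrite -m2 => /marg2_neq0[p].
  by move=> /supp0 /= ->.
have t1 l : l != ord_max -> zigzag (\val m'.2) l = 0.
  move=> l3; rewrite -(rev_ordK l) -m2 /marg2 (reindex_inj (inv_inj reflVK)) /=.
  rewrite (eq_bigr (fun p => coord2 m (p, rev_ord l))) => [|p _];
    last by rewrite -e.
  rewrite -[LHS]/(marg2 (coord2 m) (rev_ord l)) m2 t0 //.
  by apply: contra l3 => /eqP h; rewrite -(rev_ordK l) h; apply/eqP/val_inj.
split.
- have := zigzagE (itv_val m.2); rewrite !t0 -?val_eqE /= ?inordK //; lra.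
- have [_ + _] := zigzag_point (itv_val m'.2); rewrite sum_ord4.
  have := zigzagE (itv_val m'.2).
  by rewrite !(t1 (inord 0)) ?(t1 (inord 1)) ?(t1 (inord 2))
    -?val_eqE /= ?inordK //; lra.
- apply: val_inj; apply: (@cross_inj R 3);
  [exact: sphere_eq|exact: sphere_eq|exact: sphere_neq0|exact: sphere_neq0|].
  move=> p; rewrite /= cross_reflect /= -m1 -m1 /marg1.
  rewrite (reindex_inj rev_ord_inj) /=; apply: eq_bigr => l _.
  by rewrite -(e (reflV p, l)) /flip2 /= reflVK.
Qed.

Lemma twisted_sphere_bundle_triangulation : has_triangulation_le R 15
  (twisted_sphere_bundle R).
Proof.
have poX := @cross_le_poset 3; have poZ := zigzag_le_poset.
have pos := prodrel_poset poX poZ.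
have memv v : v \in verts2.
  case: v => v w; rewrite /verts2; by apply/allpairsP; exists (v, w); split;
    [exact: mem_octahedron|exact: mem_ord4s|].
have can_lab v : can2 v \in [seq v <- verts2 | v.2 != ord_max].
  rewrite mem_filter; apply/andP; split; last exact: memv.
  by rewrite /can2; case: (eqVneq v.2 ord_max) => [_|vl]; [|exact: vl].
have p_lt v : cmp2 v v -> (p2 v < N.of_nat 18)%num by move=> _;
  exact: label_in_lt (can_lab v).
have p_can v w : p2 v = p2 w -> can2 v = can2 w.
  exact: label_in_inj (can_lab v) (can_lab w).
have lev v w : cmp2 v w -> (v.2 <= w.2.+1)%N && (w.2 <= v.2.+1)%N.
  move=> vw; apply: zigzag_incomparable; move: vw; rewrite /cmp2 /comparability.
  by case/orP => /andP[_ ->]; rewrite ?orbT.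
have glue v v' : p2 v = p2 v' -> exists g, glue2 g v v'.
  move=> /p_can; case: v v' => [v l] [v' l']; rewrite /can2 /=.
  case: eqP => [->|_]; case: eqP => [->|_] e;
    have := congr1 snd e; have := congr1 fst e; rewrite /=.
  - by move=> /(inv_inj reflVK) -> _; exists None.
  - by move=> <- <-; exists (Some false).
  - by move=> -> ->; exists (Some true); split=> //=; rewrite reflVK.
  - by move=> -> ->; exists None.
(* Adjacent vertices differ by at most one level, while a gluing jumps by three: it cannot move one
   end of an edge and fix the other, nor move the two ends in opposite directions. *)
have glue_uniq g h v v' w w' : cmp2 v w -> cmp2 v' w' -> glue2 g v v' ->
  glue2 h w w' -> g = h.
  move=> /lev l /lev l'; move: l l'.
  case: g => [[]|]; case: h => [[]|] //=.
  - by move=> l l' [vl vl' _] [wl wl' _]; move: l; rewrite vl wl.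
  - by move=> l l' [vl vl' _] wE; move: l l'; rewrite wE vl vl' /=; lia.
  - by move=> l l' [vl vl' _] [wl wl' _]; move: l; rewrite vl wl.
  - by move=> l l' [vl vl' _] wE; move: l l'; rewrite wE vl vl' /=; lia.
  - by move=> l l' vE [wl wl' _]; move: l l'; rewrite vE wl wl' /=; lia.
  - by move=> l l' vE [wl wl' _]; move: l l'; rewrite vE wl wl' /=; lia.
have p_inj v w : cmp2 v w -> p2 v = p2 w -> v = w.
  move=> vw /glue[[[]|]]; last by [].
  - by move=> [vl wl _]; have := lev _ _ vw; rewrite vl wl.
  - by move=> [vl wl _]; have := lev _ _ vw; rewrite vl wl.
have cX (m : sphere R 2) : cpoint (comparability (@cross_le 3))
  (cross (\val m)).
  exact/cross_point/sphere_neq0.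
have cZ t := zigzag_point (itv_val t).
have c2 m : cpoint cmp2 (coord2 m) by apply: prodc_point;
  [exact: poX|exact: poZ|exact: cX|exact: cZ].
have cC : symmetric cmp2 by exact: comparabilityC.
have memvs v : (v \in verts2) = cmp2 v v.
  by rewrite memv /cmp2 /comparability (let: And3 r _ _ := pos in r).
apply: (flips_triangulation flips2_check).
apply: (@quotient_polyhedron_homeomorphic R _ _ _ _ (fun m =>
  push 18 p2 (coord2 m))).
- by apply: compact_setXT; [exact:
  compact_sphere|exact/compact_set_type/segment_compact].
- move=> m; apply: push_continuous_at => v; apply: prodc_continuous_at => w.
    apply: (continuous_fst_at (f := fun u : sphere R 2 => cross (\val u) w)).
    apply: (continuous_val_at (f := fun u => cross u w)).
    exact/cross_continuous_at/sphere_neq0.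
  apply: (continuous_snd_at (f := fun u : set_type (`[0,
    1] : set R) => zigzag (\val u) w)).
  apply: (continuous_val_at (f := fun u => zigzag u w)).
  exact: zigzag_continuous_at.
(* At the parameters 0 and 1 all the weight sits on an end level, where [flip2] is the gluing and
   preserves labels. *)
- move=> [u t] [u' t'] /= [t0 t1 ->].
  have z0 l : l != ord0 -> zigzag (\val t) l = 0 by (have ->
    : \val t = 0 by exact: t0); exact: zigzag0.
  have z1 l : l != ord_max -> zigzag (\val t') l = 0 by (have ->
    : \val t' = 1 by exact: t1); exact: zigzag1.
  have E v : coord2 (u, t) v = if v.2 == ord0 then cross (\val u) v.1 else 0.
    exact: (prodc_vertex poX poZ (cX u) (cZ t) v z0).
  have E' v : coord2 (sphere_reflection u, t') v =
      if v.2 == ord_max then cross (\val (sphere_reflection u)) v.1 else 0.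
    exact: (prodc_vertex poX poZ (cX _) (cZ t') v z1).
  apply: (@push_eq _ _ _ _ flip2).
  + exact: inv_inj flip2K.
  + move=> [v l]; rewrite E E' /= cross_reflect /= reflVK.
    have -> : (ord_max : 'I_4) = rev_ord ord0 by apply: val_inj.
    by rewrite (inj_eq rev_ord_inj).
  + move=> [v l]; rewrite E /=; case: (eqVneq l ord0) => [->|_] => [_|];
    last by rewrite eqxx.
    suff e1 : can2 (flip2 (v, ord0)) = can2 (v,
      ord0) by rewrite /p2 /label_in e1.
    by rewrite /can2 /flip2 /= reflVK.
- move=> m m' e.
  have [g h] := push_fiber p_lt p_inj (fun v v' _ _ => @glue v v')
    glue_uniq (c2 m) (c2 m') e.
  case: g h => [[]|] h.
  + apply: rst_step; apply: coord2_glued => [|v /h[v' []//]].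
    apply: (cpoint_reindex (inv_inj flip2K) (c2 m) (c2 m')) => v /h[[w l]
      /= [vl -> ->] <-].
    by congr coord2; rewrite /flip2 vl; congr pair; apply: val_inj.
  + have e' v : coord2 m' (flip2 v) = coord2 m v.
      apply: (cpoint_reindex (inv_inj flip2K) (c2 m) (c2 m')) => {}v /h[[w l]
        /= [vl -> ->] <-].
      by congr coord2; rewrite /flip2 vl; congr pair; apply: val_inj.
    apply/rst_sym/rst_step; apply: coord2_glued => v.
      by rewrite -e' flip2K.
    rewrite -{1}(flip2K v) e' => /h[_ [+ _ _] _].
    by move=> /(congr1 (@rev_ord 4)); rewrite /= rev_ordK => ->; apply: val_inj.
  + rewrite (@coord2_inj m m'); first exact: rst_refl.
    have h' v : coord2 m v != 0 -> coord2 m' (id v) = coord2 m v by move=>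
      /h[v' -> <-].
    exact: (cpoint_reindex (@inj_id _) (c2 m) (c2 m') h').
- by move=> m; apply: push_polyhedron; [exact: memvs|exact: p_lt|exact:
  covers2|exact: c2].
- move=> y /(push_surjective cC memvs p_lt p_inj)[x cx <-].
  have [u [u1 eu]] := cross_surj (marg1_point cx).
  have [t t01 et] := zigzag_surj (marg2_point cx).
  have t01' : t \in (`[0, 1]%classic : set R) by apply/mem_set;
    rewrite /= in_itv.
  exists (exist _ u (sphere_mem u1), exist _ t t01').
  congr push; apply/funext => v; rewrite /coord2 /=.
  rewrite -[RHS](prodc_marg poX poZ cx).
  exact: prodc_ext.
Qed.
End Twisted.

(** Comparable faces other than the centre have a common coordinate different from [None], and agree
    wherever both differ from [None]; the antipode reverses that sign. This is the compatibility of
    the subdivided cube with the antipodal map, checked on all pairs. *)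
Lemma cubeV_incomparable e f : e != cube_center -> f != cube_center ->
  comparability cube_le e f -> comparability cube_le (cubeV e) f = false.
Proof.
rewrite -!mem_cubes => ec fc ef.
have /allP/(_ _ ec)/allP/(_ _ fc) : all (fun e => all (fun f =>
  ~~ (comparability cube_le e f && comparability cube_le (cubeV e) f)) cubes)
    cubes.
  by vm_compute.
by rewrite ef /= => /negbTE.
Qed.

Lemma cube_rep_or e : cube_rep e = e \/ cube_rep e = cubeV e.
Proof. by move: e => [[a b] c]; rewrite /cube_rep; case: ifP; [left|right]. Qed.

Lemma cube_repV e : cube_rep (cubeV e) = cube_rep e.
Proof. by move: e => [[[[]|] [[]|]] [[]|]]. Qed.

Lemma cube_rep_inj e f : cube_rep e = cube_rep f -> f = e \/ f = cubeV e.
Proof.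
case: (cube_rep_or e) => ->; case: (cube_rep_or f) => ->.
- by left.
- by move=> ->; right; rewrite cubeVK.
- by right.
- by move=> /(inv_inj cubeVK); left.
Qed.

Lemma mem_cube_reps e : e != cube_center -> cube_rep e \in cube_reps.
Proof.
rewrite -mem_cubes => ec.
have /allP/(_ _ ec) : all (fun e => cube_rep e \in cube_reps)
  cubes by vm_compute.
by [].
Qed.

Lemma cubeV_center e : (cubeV e == cube_center) = (e == cube_center).
Proof. by move: e => [[[[]|] [[]|]] [[]|]]. Qed.

Lemma cube_sphere_point (R : realType) (u : sphere R 2) :
  cpoint (comparability cube_le) (cube (\val u)).
Proof. by have /cpoint_on[] := cube_point (sphere_neq0 u). Qed.

Lemma cube_sphere_center (R : realType) (u : sphere R 2) e :
  cube (\val u) e != 0 -> e != cube_center.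
Proof. by have /cpoint_on[_ h] := cube_point (sphere_neq0 u) => /h. Qed.

Lemma cube_sphere_inj (R : realType) (u u' : sphere R 2) :
  cube (\val u) =1 cube (\val u') -> u = u'.
Proof.
move=> e; apply: val_inj; apply: (@cube_inj R);
  [exact: sphere_eq|exact: sphere_eq|
  exact: sphere_neq0|exact: sphere_neq0|exact: e].
Qed.

Lemma cross_sphere_inj (R : realType) n (u u' : sphere R n) :
  cross (\val u) =1 cross (\val u') -> u = u'.
Proof.
move=> e; apply: val_inj; apply: (@cross_inj R);
  [exact: sphere_eq|exact: sphere_eq|
  exact: sphere_neq0|exact: sphere_neq0|exact: e].
Qed.

(** * The product of RP^2 and S^1 *)

Section ProjectiveProduct.
Variable R : realType.
Local Notation X := (sphere R 2 * sphere R 1)%type.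

Definition coord3 (m : X) : cubeT * ('I_2 * bool) -> R :=
  prodc cube_le (@cross_le 2) (cube (\val m.1)) (cross (\val m.2)).

Definition act3 (g : bool) (v : cubeT * ('I_2 * bool)) : cubeT * ('I_2 * bool)
  :=
  (if g then cubeV v.1 else v.1, v.2).

Lemma act3K g : involutive (act3 g).
Proof. by move=> [e w]; case: g; rewrite /act3 //= cubeVK. Qed.

Lemma coord3_antipode u w v : coord3 (antipode u, w) v = coord3 (u,
  w) (act3 true v).
Proof.
have := prodc_aut (cube (\val u)) (cross (\val w)) v (inv_inj cubeVK) cube_leV
  (@inj_id _) (fun a b => erefl (@cross_le 2 a b)).
by rewrite /coord3 /act3 /= => <-; apply: prodc_ext => // a; rewrite cubeN.
Qed.

Lemma coord3_point m : cpoint cmp3 (coord3 m).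
Proof.
have poC := cube_le_poset; have poX := @cross_le_poset 2.
apply/cpoint_on; split.
  by apply: prodc_point; [exact: poC|exact: poX|exact: cube_sphere_point|exact:
    cross_sphere_point].
move=> v /(prodc_supp poC poX (cube_sphere_point m.1)
  (cross_sphere_point m.2))[h _].
exact: cube_sphere_center h.
Qed.

Lemma coord3_inj m m' : coord3 m =1 coord3 m' -> m = m'.
Proof.
move=> e; have [e1 e2] := prodc_inj cube_le_poset (@cross_le_poset 2)
  (cube_sphere_point m.1) (cross_sphere_point m.2)
  (cube_sphere_point m'.1) (cross_sphere_point m'.2) e.
by case: m m' e1 e2 {e} => [u w] [u' w'] /= /cube_sphere_inj ->
  /cross_sphere_inj ->.
Qed.

Lemma coord3_surj x : cpoint cmp3 x -> exists m, coord3 m =1 x.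
Proof.
move=> /cpoint_on[cx xD].
have [u [u1 eu]] : exists u : 'rV[R]_3, sqnorm u = 1 /\ cube u =1 marg1 x.
  apply: cube_surj; apply/cpoint_on; split; first exact: marg1_point cx.
  by move=> e /marg1_neq0[w /xD].
have [w [w1 ew]] := cross_surj (marg2_point cx).
exists (exist _ u (sphere_mem u1), exist _ w (sphere_mem w1)) => v.
rewrite -(prodc_marg cube_le_poset (@cross_le_poset 2) cx v).
exact: prodc_ext.
Qed.

Lemma coord3_continuous_at v m : {for m, continuous (fun m => coord3 m v)}.
Proof.
apply: prodc_continuous_at => w.
  apply: (continuous_fst_at (f := fun u : sphere R 2 => cube (\val u) w)).
  apply: (continuous_val_at (f := fun u => cube u w)).
  exact/cube_continuous_at/sphere_neq0.
apply: (continuous_snd_at (f := fun u : sphere R 1 => cross (\val u) w)).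
apply: (continuous_val_at (f := fun u => cross u w)).
exact/cross_continuous_at/sphere_neq0.
Qed.

Lemma p3_act g v : p3 (act3 g v) = p3 v.
Proof.
suff e : can3 (act3 g v) = can3 v by rewrite /p3 /label_in e.
by case: v => e w; rewrite /can3 /act3 /=; case: g; rewrite ?cube_repV.
Qed.

Lemma can3_label v : v.1 != cube_center ->
  can3 v \in [seq (e, w) | e <- cube_reps, w <- square].
Proof.
move=> h; apply/allpairsP; exists (can3 v); split;
  [exact: mem_cube_reps|exact: mem_square|by []].
Qed.

Lemma cmp3_diag v : cmp3 v v = (v.1 != cube_center).
Proof.
have [r _ _] := prodrel_poset cube_le_poset (@cross_le_poset 2).
by rewrite /cmp3 /induced /comparability r !andbT andbb.
Qed.

Lemma cmp3_cube v w : cmp3 v w ->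
  [/\ v.1 != cube_center, w.1 != cube_center & comparability cube_le v.1 w.1].
Proof.
move=> /and3P[-> -> h]; split=> //; move: h; rewrite /comparability.
by case/orP => /andP[-> _]; rewrite ?orbT.
Qed.

Lemma p3_lt v : cmp3 v v -> (p3 v < N.of_nat 52)%num.
Proof. by rewrite cmp3_diag => h; exact: label_in_lt (can3_label h). Qed.

Lemma p3_fiber v v' : cmp3 v v -> cmp3 v' v' -> p3 v = p3 v' ->
  exists g, v' = act3 g v.
Proof.
rewrite !cmp3_diag => h h' /(label_in_inj (can3_label h) (can3_label h')) e.
have := congr1 fst e; have := congr1 snd e;
  case: v v' {h h' e} => [e w] [e' w'] /= <-.
by move=> /cube_rep_inj[] ->; [exists false|exists true].
Qed.

(** If the symmetries differed, one end of the edge would be replaced by its antipode and the other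
    kept, against [cubeV_incomparable]. *)
Lemma act3_uniq g h v v' w w' : cmp3 v w -> cmp3 v' w' ->
  v' = act3 g v -> w' = act3 h w -> g = h.
Proof.
move=> /cmp3_cube[v0 w0 vw] + e e'; rewrite {}e {}e' => /cmp3_cube[_ _ /=].
case: g; case: h => //; first by rewrite (cubeV_incomparable v0 w0 vw).
by rewrite comparabilityC cubeV_incomparable // comparabilityC.
Qed.

Lemma p3_inj v w : cmp3 v w -> p3 v = p3 w -> v = w.
Proof.
move=> vw e; have [v0 w0 c] := cmp3_cube vw.
have [|||[] we] := @p3_fiber v w; rewrite ?cmp3_diag //;
  last by case: (v) we => ? ? ->.
move: c; rewrite we /= comparabilityC cubeV_incomparable // /comparability.
by have [r _ _] := cube_le_poset; rewrite r.
Qed.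

Lemma mem_verts3 v : (v \in verts3) = cmp3 v v.
Proof.
rewrite cmp3_diag; apply/allpairsP/idP => [[[e w] [/= ec _ ->]]|h].
  by rewrite -mem_cubes.
by exists v; split; [rewrite mem_cubes|exact: mem_square|case: (v)].
Qed.

Lemma cmp3C : symmetric cmp3.
Proof. by move=> v w; rewrite /cmp3 /induced comparabilityC andbCA. Qed.

Definition map3 (m : projective_space R 2 * sphere R 1) : 'rV[R]_52 :=
  quotient_lift (fun u => push 52 p3 (coord3 (u, m.2))) m.1.

Lemma map3_pi u w : map3 (quotient_by_pi _ u, w) = push 52 p3 (coord3 (u, w)).
Proof.
apply: (projective_lift (f := fun u => push 52 p3 (coord3 (u, w)))) => {}u.
apply: (@push_eq _ _ _ _ (act3 true)); first exact: inv_inj (act3K _).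
- by move=> v; rewrite coord3_antipode.
- by move=> v _; exact: p3_act.
Qed.

Lemma product_projective_circle_triangulation : has_triangulation_le R 15
  (projective_space R 2 * sphere R 1)%type.
Proof.
apply: (flips_triangulation flips3_check).
apply: (@polyhedron_homeomorphic R _ _ _ map3).
- by apply: compact_setXT; [exact: projective_compact|exact: compact_sphere].
- move=> [a w]; have [u ->] := quotient_by_pi_surj a.
  (* The space is a product with a quotient rather than a quotient of the product. As the product of
     an open map with the identity, [q] still lets continuity descend. *)
  pose q (m : X) : projective_space R 2 * sphere R 1 := (quotient_by_pi _ m.1,
    m.2).
  apply: (@open_surj_continuous_at X _ _ q map3 (u,
    w)) => [U [[A B] /= [uA wB] AB]|].
    exists (quotient_by_pi _ @` A, B) => /=.
      by split=> //; exact: projective_pi_nbhs.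
    move=> [_ w'] /= [[u' Au' <-] Bw']; exists (u', w') => //; exact: AB.
  have -> : map3 \o q = (fun m => push 52 p3 (coord3 m)).
    by apply/funext => -[? ?]; exact: map3_pi.
  apply: push_continuous_at => v; exact: coord3_continuous_at.
- move=> [a w] [a' w']; have [u ->] := quotient_by_pi_surj a.
  have [u' ->] := quotient_by_pi_surj a'; rewrite !map3_pi => e.
  have [g h] := push_fiber p3_lt p3_inj p3_fiber act3_uniq (coord3_point (u, w))
    (coord3_point (u', w')) e.
  have h' v : coord3 (u, w) v != 0 -> coord3 (u', w') (act3 g v) = coord3 (u,
    w) v.
    by move=> /h[v' -> <-].
  have {}h := cpoint_reindex (inv_inj (act3K g)) (coord3_point (u,
    w)) (coord3_point (u', w')) h'.
  case: g h {h'} => h.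
    have [<- <-] : (antipode u', w') = (u, w).
      by apply: coord3_inj => v; rewrite coord3_antipode h.
    by congr pair; apply/projective_piP; right; rewrite /= opprK.
  by have [-> ->] : (u', w') = (u, w) by apply: coord3_inj => -[? ?];
    rewrite -h.
- move=> [a w]; have [u ->] := quotient_by_pi_surj a; rewrite map3_pi.
  by apply: push_polyhedron; [exact: mem_verts3|exact: p3_lt|exact:
    covers3|exact: coord3_point].
- move=> y /(push_surjective cmp3C mem_verts3 p3_lt p3_inj)[x /coord3_surj[[u
  w] e] <-].
  by exists (quotient_by_pi _ u, w); rewrite map3_pi; congr push; apply/funext.
Qed.
End ProjectiveProduct.

(* The complement of an open ball in RP^3 is S^2 x [-1, 1] modulo
   (u, t) ~ (- u, - t), where x in S^3 corresponds to u = tl x / |tl x| and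
   t = hd x / |tl x|; the boundary sphere is t = 1, or t = -1. *)
Section HalfSpace.
Variable R : realType.
Implicit Types x y : 'rV[R]_4.
Local Notation half_cmp := (induced (fun v : cubeT * option bool =>
  v.1 != cube_center)
  (comparability (prodrel cube_le star_le))).

Definition hd x : R := x 0 ord0.
Definition tl x : 'rV[R]_3 := \row_i x 0 (lift ord0 i).
Definition slope x : R := hd x / Num.sqrt (sqnorm (tl x)).

Lemma sqnorm_hd_tl x : sqnorm x = hd x ^+ 2 + sqnorm (tl x).
Proof.
by rewrite /sqnorm big_ord_recl; congr (_ + _); apply: eq_bigr => i _;
  rewrite mxE.
Qed.

Lemma hd_tl_inj x y : hd x = hd y -> tl x = tl y -> x = y.
Proof.
move=> h t; apply/rowP => i; case: (unliftP ord0 i) => [j ->|->]; last exact: h.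
by have /rowP/(_ j) := t; rewrite !mxE.
Qed.

Lemma hdZ (a : R) x : hd (a *: x) = a * hd x. Proof. by rewrite /hd mxE. Qed.

Lemma tlZ (a : R) x : tl (a *: x) = a *: tl x.
Proof. by apply/rowP => i; rewrite !mxE. Qed.

Lemma hdN x : hd (- x) = - hd x. Proof. by rewrite /hd mxE. Qed.

Lemma tlN x : tl (- x) = - tl x.
Proof. by apply/rowP => i; rewrite !mxE. Qed.

Lemma sqnormN n (u : 'rV[R]_n) : sqnorm (- u) = sqnorm u.
Proof. by apply: eq_bigr => i _; rewrite mxE sqrrN. Qed.

Lemma slopeN x : slope (- x) = - slope x.
Proof. by rewrite /slope hdN tlN sqnormN mulNr. Qed.

Lemma slopeZ (a : R) x : 0 < a -> slope (a *: x) = slope x.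
Proof.
move=> a0; rewrite /slope hdZ tlZ sqnormZ sqrtrM ?sqr_ge0 // sqrtr_sqr
  gtr0_norm //.
by rewrite invfM mulrACA divff ?mul1r // lt0r_neq0.
Qed.

Definition half_coord x : cubeT * option bool -> R :=
  prodc cube_le star_le (cube (tl x)) (ival (slope x)).

Definition half_neg (v : cubeT * option bool) : cubeT * option bool :=
  (cubeV v.1, optN v.2).

Lemma half_negK : involutive half_neg.
Proof. by move=> [e l]; rewrite /half_neg /= cubeVK optNK. Qed.

Lemma half_coordN x v : half_coord (- x) v = half_coord x (half_neg v).
Proof.
have := prodc_aut (cube (tl x)) (ival (slope x)) v (inv_inj cubeVK) cube_leV
  (inv_inj optNK) star_leN.
rewrite /half_coord /half_neg /= => <-; rewrite tlN slopeN;
  apply: prodc_ext => a.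
  exact: cubeN.
exact: ivalN.
Qed.

(** In homogeneous coordinates, the points outside the open unit ball of the affine chart, those at
    infinity included. The first condition ensures that the direction of [tl x] and the slope make
    sense for every vector of R^4. *)
Definition outer x := (0 < sqnorm (tl x)) && (hd x ^+ 2 <= sqnorm (tl x)).

Lemma outer_tl x : outer x -> tl x != 0.
Proof.
move=> /andP[h _]; apply: contraTneq h => ->;
  rewrite -leNgt /sqnorm big1 // => i _.
by rewrite mxE expr0n.
Qed.

Lemma outer_slope x : outer x -> `|slope x| <= 1.
Proof.
move=> /andP[t0 h]; have s0 : 0 < Num.sqrt (sqnorm (tl x)) by rewrite sqrtr_gt0.
rewrite /slope normrM normfV (gtr0_norm s0) ler_pdivrMr // mul1r.
by rewrite -sqrtr_sqr; apply: ler_wsqrtr.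
Qed.

Lemma cube_tl_point x : outer x -> cpoint (comparability cube_le) (cube (tl x)).
Proof. by move=> /outer_tl/cube_point/cpoint_on[]. Qed.

Lemma half_point x : outer x -> cpoint half_cmp (half_coord x).
Proof.
move=> ox; have poC := cube_le_poset; have poS := star_le_poset.
have cC := cube_tl_point ox; have cS := ival_point (outer_slope ox).
apply/cpoint_on; split; first by apply: prodc_point;
  [exact: poC|exact: poS|exact: cC|exact: cS].
move=> v /(prodc_supp poC poS cC cS)[h _].
by have /cpoint_on[_ h'] := cube_point (outer_tl ox); exact: h'.
Qed.

(** Divided by the lengths of their tails, the two vectors have the same tail, by injectivity of
    [cube], and the same head, the slope. They are thus positive multiples of each other, and both
    have length 1. *)
Lemma half_inj x y : outer x -> outer y -> sqnorm x = 1 -> sqnorm y = 1 ->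
  half_coord x =1 half_coord y -> x = y.
Proof.
move=> ox oy x1 y1 e.
have [e1 e2] := prodc_inj cube_le_poset star_le_poset (cube_tl_point ox)
  (ival_point (outer_slope ox)) (cube_tl_point oy) (ival_point (outer_slope
    oy)) e.
have es : slope x = slope y by rewrite -(ivalE (slope x)) !e2 ivalE.
have nz (z : 'rV[R]_4) : outer z -> normalize (tl z) != 0.
  move=> oz; apply/eqP => z0; have := sqnorm_normalize (outer_tl oz).
  rewrite z0 /sqnorm big1 => [/esym/eqP|i _]; first by rewrite oner_eq0.
  by rewrite mxE expr0n.
have sp (z : 'rV[R]_4) : outer z -> 0 < (Num.sqrt (sqnorm (tl z)))^-1.
  by move=> /outer_tl/sqnorm_gt0 h; rewrite invr_gt0 sqrtr_gt0.
have et : normalize (tl x) = normalize (tl y).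
  apply: cube_inj;
    [exact/sqnorm_normalize/outer_tl|exact/sqnorm_normalize/outer_tl|
    exact: nz|exact: nz|].
  by rewrite /normalize !cubeZ ?sp.
apply: (radial_eq (sp _ ox) (sp _ oy) x1 y1); apply: hd_tl_inj.
  by rewrite !hdZ ![_^-1 * _]mulrC.
by rewrite !tlZ.
Qed.

Lemma half_surj z : cpoint half_cmp z ->
  exists x, [/\ sqnorm x = 1, outer x & half_coord x =1 z].
Proof.
move=> /cpoint_on[cz zD].
have [u [u1 eu]] : exists u : 'rV[R]_3, sqnorm u = 1 /\ cube u =1 marg1 z.
  apply: cube_surj; apply/cpoint_on; split; first exact: marg1_point cz.
  by move=> e /marg1_neq0[w /zD].
have [t t1 et] := ival_surj (marg2_point cz).
(* The point (t, u) of the cylinder over the unit sphere has slope [t] and direction [u]; its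
   normalization keeps both. *)
pose w : 'rV[R]_4 := \row_i oapp (u 0) t (unlift ord0 i).
have hw : hd w = t by rewrite /hd mxE unlift_none.
have tw : tl w = u by apply/rowP => i; rewrite !mxE liftK.
have ow : outer w.
  by rewrite /outer tw hw u1 ltr01 -real_normK ?num_real // expr_le1.
have w0 : w != 0.
  apply: contraTneq ow => ->; rewrite /outer negb_and -leNgt /sqnorm big1 ?lexx
    // => i _.
  by rewrite !mxE expr0n.
have a0 : 0 < (Num.sqrt (sqnorm w))^-1 by rewrite invr_gt0 sqrtr_gt0 sqnorm_gt0.
exists (normalize w); split; first exact: sqnorm_normalize.
  rewrite /outer /normalize hdZ tlZ sqnormZ exprMn ler_pM2l ?exprn_gt0 //.
  by rewrite pmulr_rgt0 ?exprn_gt0.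
move=> v; rewrite /half_coord /normalize slopeZ // tlZ cubeZ // tw.
have -> : slope w = t by rewrite /slope tw u1 sqrtr1 divr1.
rewrite -(prodc_marg cube_le_poset star_le_poset cz v).
exact: prodc_ext.
Qed.

Lemma tl_continuous : continuous tl.
Proof. by move=> x; apply: row_continuous_at => i; exact: coord_continuous. Qed.

Lemma half_continuous_at x v : tl x != 0 ->
  {for x, continuous (fun t => half_coord t v)}.
Proof.
move=> x0; have ct : {for x, continuous tl} by exact: tl_continuous.
apply: prodc_continuous_at => w.
  by apply: (@continuous_comp _ _ _ tl (fun t => cube t w));
    [exact: ct|exact: cube_continuous_at].
suff cs : {for x, continuous slope} 
  by apply: (@continuous_comp _ _ _ slope (fun t => ival t w));
    [exact: cs|exact: ival_continuous_at].
apply: (@continuousM R); first exact: coord_continuous.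
apply: (@continuousV R); first by rewrite lt0r_neq0 // sqrtr_gt0 sqnorm_gt0.
apply: (@continuous_comp _ _ _ (fun t => sqnorm (tl t)) Num.sqrt);
  last exact: sqrt_continuous.
by apply: (@continuous_comp _ _ _ tl (@sqnorm R 3));
  [exact: ct|exact: sqnorm_continuous].
Qed.
End HalfSpace.

(** * The affine chart of RP^3 and the complement of its unit ball *)

Section Chart.
Variable R : realType.
Local Notation S := (sphere R 3).
Local Notation pi := (quotient_by_pi (fun x y : S => \val y = - \val x)).
Local Notation chart := (@affine_chart R 3).

Lemma hd_homogenize (v : 'rV[R]_3) : hd (homogenize v) = 1.
Proof.
have h : homogenize v 0 (lshift 3 0 : 'I_(1 + 3)) = 1.
  exact: etrans (row_mxEl _ _ _ _) (mxE _ _ _ _).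
by rewrite /hd -[RHS]h; congr (homogenize v _ _); apply: val_inj.
Qed.

Lemma tl_homogenize (v : 'rV[R]_3) : tl (homogenize v) = v.
Proof.
apply/rowP => i; rewrite mxE.
have <- : homogenize v 0 (rshift 1 i : 'I_(1 + 3)) = v 0 i by exact: row_mxEr.
by congr (homogenize v _ _); apply: val_inj.
Qed.

Lemma homogenize_neq0 (v : 'rV[R]_3) : homogenize v != 0.
Proof.
apply/eqP => h; have := hd_homogenize v; rewrite h /hd mxE => /esym/eqP.
by rewrite oner_eq0.
Qed.

Lemma chart_pi (x : S) v : pi x = chart v ->
  exists2 c, c != 0 & \val x = c *: homogenize v.
Proof.
have n0 : (Num.sqrt (sqnorm (homogenize v)))^-1 != 0.
  by rewrite invr_neq0 // lt0r_neq0 // sqrtr_gt0 sqnorm_gt0 // homogenize_neq0.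
move=> /projective_piP[] /= e; [exists (Num.sqrt (sqnorm (homogenize v)))^-1|
  exists (- (Num.sqrt (sqnorm (homogenize v)))^-1)]; rewrite ?oppr_eq0 //.
by rewrite -[LHS]opprK -e scaleNr.
Qed.

Lemma chart_of (x : S) : hd (\val x) != 0 ->
  chart ((hd (\val x))^-1 *: tl (\val x)) = pi x.
Proof.
move=> h0; have e : homogenize ((hd (\val x))^-1 *: tl (\val x))
  = (hd (\val x))^-1 *: \val x.
  by apply: hd_tl_inj; rewrite ?hd_homogenize ?tl_homogenize ?hdZ ?tlZ ?mulVf.
apply/projective_piP => /=; rewrite {}e /normalize sqnormZ sphere_eq mulr1
  sqrtr_sqr.
rewrite normfV invrK scalerA.
have [h|h] := ltP 0 (hd (\val x)).
  by left; rewrite gtr0_norm // divff // scale1r.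
by right; rewrite ler0_norm // mulNr divff // scaleN1r opprK.
Qed.

Lemma sphere_outer (x : S) : outer (\val x) = (hd (\val x)
  ^+ 2 <= sqnorm (tl (\val x))).
Proof.
rewrite /outer andbC; have [h|//] := boolP (_ <= _).
have := sphere_eq x; rewrite sqnorm_hd_tl => e; rewrite /=; lra.
Qed.

(** For x proportional to (1, v), the tail is |v| times as long as the head, so |v| < 1 is the
    failure of [outer]; a point with head 0 is not in the chart at all. *)
Lemma puncture_pi (x : S) : puncture chart (pi x) <-> outer (\val x).
Proof.
rewrite sphere_outer; split=> [nb|ox [v v1 /esym/chart_pi[c c0 e]]].
  rewrite leNgt; apply/negP => h; apply: nb.
  have h0 : hd (\val x) != 0.
    apply: contraTneq h => ->; rewrite expr0n /= -leNgt; exact: sqnorm_ge0.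
  exists ((hd (\val x))^-1 *: tl (\val x)); last exact: chart_of.
  by rewrite /= sqnormZ exprVn mulrC ltr_pdivrMr ?mul1r // lt0r sqrf_eq0 h0
    sqr_ge0.
move: ox; rewrite e hdZ tlZ hd_homogenize tl_homogenize mulr1 sqnormZ.
rewrite -[leLHS]mulr1 ler_pM2l; last by rewrite lt0r sqrf_eq0 c0 sqr_ge0.
by rewrite leNgt v1.
Qed.

(** A closed subset of the compact space RP^3: the removed ball is open, its preimage in the sphere
    being given by a strict polynomial inequality. *)
Lemma puncture_compact : compact [set: puncture chart].
Proof.
apply: compact_set_type; apply: (subclosed_compact _ (@projective_compact R 3))
  => //.
apply: open_closedC; rewrite /open /= /quotient_open.
rewrite (_ : _ @^-1` _ = (\val : S -> 'rV[R]_4) @^-1`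
    [set x | sqnorm (tl x) - hd x ^+ 2 < 0]); last first.
  apply/seteqP; split=> x /=; rewrite subr_lt0 ltNge -sphere_outer.
    by move=> h; apply/negP => /puncture_pi; apply.
  by move=> h; apply: contrapT => /puncture_pi; rewrite (negbTE h).
apply: open_comp => [x _|]; first exact: set_val_continuous.
apply: (@open_comp _ _ (fun x : 'rV[R]_4 => sqnorm (tl x) - hd x ^+ 2)
  [set t | t < 0]).
  move=> x _; suff : {for x, continuous (fun x : 'rV[R]_4 => sqnorm (tl x)
    - hd x ^+ 2)} by [].
  apply: (@continuousB R).
    apply: (@continuous_comp _ _ _ (@tl R) (@sqnorm R 3));
      first exact: tl_continuous.
    exact: sqnorm_continuous.
  by apply: (@continuousM R); exact: coord_continuous.
exact: open_lt.
Qed.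
End Chart.

(** * The connected sum of two copies of RP^3 *)

Section DoubledHalves.
Variable R : realType.
Local Notation V4 := (bool * (cubeT * option bool))%type.
Local Notation S := (sphere R 3).
Local Notation pi := (quotient_by_pi (fun x y : S => \val y = - \val x)).
Local Notation chart := (@affine_chart R 3).
Local Notation half_cmp := (induced (fun v : cubeT * option bool =>
  v.1 != cube_center)
  (comparability (prodrel cube_le star_le))).

Definition coord4 (c : bool) (x : 'rV[R]_4) (v : V4) : R :=
  if v.1 == c then half_coord x v.2 else 0.

Definition act4 (g : bool * bool) (v : V4) : V4 :=
  (v.1 (+) g.2, if g.1 then half_neg v.2 else v.2).

(** The first Boolean of [g] is the antipodal map, applied at any level. The second exchanges the
    copies and is allowed only off the middle level, that is, on the boundary sphere. *)
Definition glue4 (g : bool * bool) (v v' : V4) : Prop :=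
  v' = act4 g v /\ (g.2 -> v.2.2 != None).

Lemma act4K g : involutive (act4 g).
Proof.
move=> [c v]; case: g => n s; rewrite /act4 /= -addbA addbb addbF.
by case: n => //; rewrite half_negK.
Qed.

Lemma cmp4E c d v w : cmp4 (c, v) (d, w) = (c == d) && half_cmp v w.
Proof. by rewrite /cmp4 /induced /=; do !bool_congr. Qed.

Lemma half_cmp_diag v : half_cmp v v = (v.1 != cube_center).
Proof.
have [r _ _] := prodrel_poset cube_le_poset star_le_poset.
by rewrite /induced /comparability r !andbT andbb.
Qed.

Lemma cmp4_diag v : cmp4 v v = (v.2.1 != cube_center).
Proof. by case: v => c v; rewrite cmp4E eqxx half_cmp_diag. Qed.

Lemma half_cmp_cube v w : half_cmp v w ->
  [/\ v.1 != cube_center, w.1 != cube_center & comparability cube_le v.1 w.1].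
Proof.
move=> /and3P[-> -> h]; split=> //; move: h; rewrite /comparability.
by case/orP => /andP[-> _]; rewrite ?orbT.
Qed.

Lemma half_cmp_neg v w : half_cmp v w -> half_cmp (half_neg v) w = false.
Proof.
move=> /half_cmp_cube[v0 w0 vw]; apply/negP => /half_cmp_cube[_ _] /=.
by rewrite cubeV_incomparable.
Qed.

Lemma half_cmpC : symmetric half_cmp.
Proof. by move=> v w; rewrite /induced comparabilityC andbCA. Qed.

Lemma cmp4C : symmetric cmp4.
Proof. by move=> [c v] [d w]; rewrite !cmp4E half_cmpC eq_sym. Qed.

Lemma can4_label (v : V4) : v.2.1 != cube_center ->
  can4 v \in [seq (c, (e, None)) | c <- signs, e <- cube_reps] ++
             [seq (false, (e, Some true)) | e <- cubes].
Proof.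
case: v => c [e [s|]] ec; have {}ec : e != cube_center := ec;
  rewrite mem_cat; apply/orP; [right|left].
  apply/mapP; exists (if s then e else cubeV e) => //.
  by rewrite mem_cubes; case: s; rewrite ?cubeV_center.
apply/allpairsP; exists (c, cube_rep e); split;
  [by case: (c)|exact: mem_cube_reps|by []].
Qed.

Lemma p4_lt v : cmp4 v v -> (p4 v < N.of_nat 52)%num.
Proof. by rewrite cmp4_diag => h; exact: label_in_lt (can4_label h). Qed.

Lemma p4_act (g : bool * bool) (v : V4) : (g.2 -> v.2.2 != None) ->
  p4 (act4 g v) = p4 v.
Proof.
move=> h; suff e : can4 (act4 g v) = can4 v by rewrite /p4 /label_in e.
move: g v h => [n s] [c [e [l|]]] /= h.
  by rewrite /can4 /act4 /half_neg /=; case: n => //=; case: l {h} => //=;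
    rewrite cubeVK.
have -> : s = false by case: s h => // /(_ isT).
have rE d : (d, (cube_rep (cubeV e), None)) = (d, (cube_rep e, None)) :> V4.
  by rewrite cube_repV.
by clear h; case: c; case: n => //; exact: rE.
Qed.

Lemma p4_fiber v v' : cmp4 v v -> cmp4 v' v' -> p4 v = p4 v' ->
  exists g, glue4 g v v'.
Proof.
rewrite !cmp4_diag => h h' /(label_in_inj (can4_label h) (can4_label h')).
move: v v' {h h'} => [c [e [l|]]] [c' [e' [l'|]]] //= E.
  have {}E : (if l then e else cubeV e) = (if l' then e' else cubeV e').
    exact: (congr1 (fun v : V4 => v.2.1) E).
  exists (l != l', c (+) c'); split=> //;
    rewrite /act4 /half_neg /= addbA addbb /=.
  congr (_, _); move: E; case: l; case: l' => //= E; rewrite ?E ?cubeVK //.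
  by rewrite (inv_inj cubeVK E).
have e1 : c = c' := congr1 (fun v : V4 => v.1) E.
have /cube_rep_inj[->|->] : cube_rep e = cube_rep e'.
- exact: (congr1 (fun v : V4 => v.2.1) E).
- by exists (false, false); split=> //; rewrite /act4 /= addbF e1.
- by exists (true, false); split=> //; rewrite /act4 /half_neg /= addbF e1.
Qed.

(** Adjacent vertices lie in one copy, so both ends of an edge agree on the exchange of copies; by
    [half_cmp_neg] they also agree on the antipodal map. *)
Lemma glue4_uniq g h v v' w w' : cmp4 v w -> cmp4 v' w' -> glue4 g v v' ->
  glue4 h w w' -> g = h.
Proof.
move=> vw vw' [e _] [e' _]; move: vw vw'; rewrite {}e {}e' {v' w'};
  move: g h v w => [n s] [n' s'] [c v] [d w].
rewrite /act4 /= !cmp4E => /andP[/eqP <- vw] /andP[/eqP/(canRL (addKb c)) es].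
have -> : s' = s by move: es; rewrite addKb.
case: n; case: n' => // h.
  by rewrite half_cmp_neg in h.
by move: h; rewrite half_cmpC half_cmp_neg // half_cmpC.
Qed.

Lemma p4_inj v w : cmp4 v w -> p4 v = p4 w -> v = w.
Proof.
move=> vw e; have [vv ww] : cmp4 v v /\ cmp4 w w.
  by rewrite !cmp4_diag; case/and3P: (vw) => -> -> _.
have [[n s] [we _]] := p4_fiber vv ww e; move: vw; rewrite {}we.
case: v {vv ww e} => c v; rewrite /act4 /= cmp4E => /andP[/eqP cs h].
have -> : s = false by move: cs; case: (c); case: (s).
rewrite addbF; case: n h => // h; move: (h); rewrite half_cmpC half_cmp_neg //.
by case/and3P: h => h _ _; rewrite half_cmp_diag.
Qed.

Lemma mem_verts4 v : (v \in verts4) = cmp4 v v.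
Proof.
rewrite cmp4_diag; case: v => c [e l]; apply/allpairsP/idP => [[[c' v']
  [_ h E]]|h].
  move: h; rewrite -[(c', v').2]/v' (_ : v' = (e, l));
    last exact: (congr1 snd (esym E)).
  by move=> /allpairsP[[e' l'] [/= h _ [-> _]]]; rewrite -mem_cubes.
exists (c, (e, l)); split=> //; first by case: (c).
by apply/allpairsP; exists (e, l); split;
  [rewrite mem_cubes|exact: mem_levels|by []].
Qed.

Lemma coord4_point c x : outer x -> cpoint cmp4 (coord4 c x).
Proof.
move=> /half_point[h0 h1 hch]; split.
- by move=> v; rewrite /coord4; case: ifP.
- rewrite -h1 (eq_bigr (fun v => coord4 c x (v.1, v.2))) => [|[]//].
  rewrite -(pair_bigA _ (fun b v => coord4 c x (b, v))) /= (bigD1 c) //=.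
  rewrite [X in _ + X]big1 ?addr0 => [|b /negbTE bc].
    by apply: eq_bigr => v _; rewrite /coord4 eqxx.
  by apply: big1 => v _; rewrite /coord4 bc.
move=> [b v] [d w]; rewrite /coord4 /= cmp4E; case: (b =P c) => [->|_];
  last by rewrite eqxx.
case: (d =P c) => [->|_]; last by rewrite eqxx.
by rewrite eqxx; exact: hch.
Qed.

Lemma coord4_surj z : cpoint cmp4 z ->
  exists c x, [/\ sqnorm x = 1, outer x & coord4 c x =1 z].
Proof.
move=> [z0 z1 zch].
have [[c v0] zv0] : exists v, z v != 0.
  apply/existsP; apply: contraPT z1 => /existsPn h.
  rewrite big1 => [/esym/eqP|v _]; first by rewrite oner_eq0.
  by apply/eqP; have := h v; rewrite negbK.
(* The relation [cmp4] never links the two copies, so a point of the complex has its support in a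
   single one. *)
have zc d v : z (d, v) != 0 -> d = c.
  by move=> /zch/(_ zv0); rewrite cmp4E => /andP[/eqP].
have zc0 d v : d != c -> z (d, v) = 0.
  by move=> dc; apply/eqP; apply: contraNT dc => /zc ->.
have cz : cpoint half_cmp (fun v => z (c, v)).
  split=> [v||v w h h']; first exact: z0.
    rewrite -z1 [RHS](eq_bigr (fun v => z (v.1, v.2))) => [|[]//].
    rewrite -(pair_bigA _ (fun b v => z (b, v))) /= [RHS](bigD1 c) //=.
    rewrite [X in _ + X]big1 ?addr0 // => b bc; apply: big1 => v _; exact: zc0.
  by have := zch _ _ h h'; rewrite cmp4E eqxx.
have [x [x1 ox xe]] := half_surj cz.
exists c, x; split=> // -[d v]; rewrite /coord4 /=.
by case: eqP => [->|/eqP /zc0 ->//]; rewrite xe.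
Qed.

Lemma coord4_antipode c x v : coord4 c (- x) v = coord4 c x (act4 (true,
  false) v).
Proof. by rewrite /coord4 /act4 /= addbF half_coordN. Qed.

(** Defined on all of RP^3, since the value depends only on the antipodal class, but studied only on
    the complement of the ball: at its centre the tail is 0 and has no direction. *)
Definition map4 (c : bool) (a : projective_space R 3) : 'rV[R]_52 :=
  quotient_lift (fun x : S => push 52 p4 (coord4 c (\val x))) a.

Lemma map4_pi c x : map4 c (pi x) = push 52 p4 (coord4 c (\val x)).
Proof.
apply: (projective_lift (f := fun x : S => push 52 p4 (coord4 c (\val x)))) =>
  {}x.
apply: (@push_eq _ _ _ _ (act4 (true, false))); first exact: inv_inj (act4K _).
- by move=> v; rewrite -coord4_antipode.
- by move=> v _; exact: p4_act.
Qed.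

Lemma map4_continuous_at c (a : puncture chart) : {for \val a,
  continuous (map4 c)}.
Proof.
have [x e] := quotient_by_pi_surj (\val a).
have ox : outer (\val x) by apply/puncture_pi; rewrite -e;
  exact: (@set_valP _ _ a).
rewrite e; apply: (open_surj_continuous_at (q := pi));
  first exact: projective_pi_nbhs.
have -> : map4 c \o pi = fun x => push 52 p4 (coord4 c (\val x)).
  by apply/funext => y; exact: map4_pi.
apply: push_continuous_at => -[d v]; rewrite /coord4 /=.
case: (d == c); last exact: cst_continuous.
apply: (continuous_val_at (f := fun t => half_coord t v)).
exact/half_continuous_at/outer_tl.
Qed.

Lemma slope1_supp (x : 'rV[R]_4) v : outer x -> `|slope x| = 1 ->
  half_coord x v != 0 -> v.2 != None.
Proof.
move=> ox s1 /(prodc_supp cube_le_poset star_le_poset (cube_tl_point ox)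
  (ival_point (outer_slope ox)))[_].
by apply: contraNneq => ->; rewrite /ival s1 subrr.
Qed.

(** On the unit sphere of the chart the slope is 1, so the middle level carries no weight and the
    exchange of copies preserves the labels of the support. *)
Lemma map4_boundary v : sqnorm v = 1 -> map4 false (chart v)
  = map4 true (chart v).
Proof.
move=> v1; rewrite !map4_pi /=.
have n0 : 0 < (Num.sqrt (sqnorm (homogenize v)))^-1.
  by rewrite invr_gt0 sqrtr_gt0 sqnorm_gt0 // homogenize_neq0.
have s1 : slope (normalize (homogenize v)) = 1.
  by rewrite /normalize slopeZ // /slope hd_homogenize tl_homogenize v1 sqrtr1
    divr1.
have outn : outer (normalize (homogenize v)).
  rewrite /outer /normalize hdZ tlZ hd_homogenize tl_homogenize sqnormZ v1
    !mulr1.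
  by rewrite lexx exprn_gt0.
apply: (@push_eq _ _ _ _ (act4 (false, true))); first exact: inv_inj (act4K _).
- by move=> [b w]; rewrite /coord4 /act4 /=; case: b.
- move=> w h; apply: p4_act => _; move: h; rewrite /coord4.
  case: ifP => _; last by rewrite eqxx.
  by apply: slope1_supp => //; rewrite s1 normr1.
Qed.

(** The symmetry found by [push_fiber] splits into two answers: its antipodal part identifies the
    two points of RP^3, and its other part is nontrivial exactly when the copies differ. *)
Lemma map4_fiber c c' (x x' : S) : outer (\val x) -> outer (\val x') ->
  map4 c (pi x) = map4 c' (pi x') ->
  pi x = pi x' /\ (c != c' -> exists2 v, sqnorm v = 1 & pi x = chart v).
Proof.
move=> ox ox'; rewrite !map4_pi => e.
have cx := coord4_point c ox; have cx' := coord4_point c' ox'.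
have [[n s] h] := push_fiber p4_lt p4_inj p4_fiber glue4_uniq cx cx' e.
have h' v : coord4 c (\val x) v != 0 ->
    coord4 c' (\val x') (act4 (n, s) v) = coord4 c (\val x) v.
  by move=> /h[v' [-> _] <-].
have eqs := cpoint_reindex (inv_inj (act4K (n, s))) cx cx' h'.
have [v0 xv0] : exists v, half_coord (\val x) v != 0.
  have [_ h1 _] := half_point ox.
  apply/existsP; apply: contraPT h1 => /existsPn h1.
  rewrite big1 => [/esym/eqP|v _]; first by rewrite oner_eq0.
  by apply/eqP; have := h1 v; rewrite negbK.
have cE v : coord4 c (\val x) (c, v) = half_coord (\val x)
  v by rewrite /coord4 eqxx.
have c'E : c (+) s = c'.
  have := eqs (c, v0); rewrite cE /act4 /coord4 /=; case: eqP => // _ /esym/eqP.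
  by rewrite (negbTE xv0).
have half_eq v : half_coord (\val x') (if n then half_neg v else v)
  = half_coord (\val x) v.
  by have := eqs (c, v); rewrite cE /act4 /coord4 /= c'E eqxx.
have xx' : pi x = pi x'.
  apply/projective_piP; case: n half_eq {h h' eqs} => half_eq; [right|left].
    rewrite -[\val x']opprK; congr (- _).
    apply: half_inj => //.
    - by rewrite /outer hdN tlN sqnormN sqrrN.
    - by rewrite sqnormN sphere_eq.
    - exact: sphere_eq.
    - by move=> v; rewrite half_coordN.
  by apply: half_inj => //; exact: sphere_eq.
split=> // cc'; have sT : s by move: cc' c'E; case: (c); case: (c'); case: (s).
(* Exchanging copies is forbidden at the middle level, which must therefore carry no weight. Then
   the slope has absolute value 1, head and tail have equal length, and their quotient is a point of
   the unit sphere of the chart. *)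
have s0 : ival (slope (\val x)) None = 0.
  have <- : marg2 (half_coord (\val x)) None = ival (slope (\val x)) None.
    exact: (marg2_prodc cube_le_poset star_le_poset None (cube_tl_point ox)
      (ival_point (outer_slope ox))).
  apply/eqP; apply: contraTT isT => /marg2_neq0[u xu].
  have [|v' [_ hh] _] := h (c, (u, None)); first by rewrite cE.
  by have := hh sT; rewrite eqxx.
have t0 : 0 < sqnorm (tl (\val x)) by case/andP: ox.
have s1 : hd (\val x) ^+ 2 = sqnorm (tl (\val x)).
  move/eqP: s0; rewrite subr_eq0 eq_sym /slope => /eqP/(congr1 (fun t =>
    t ^+ 2)).
  rewrite real_normK ?num_real // exprMn exprVn sqr_sqrtr ?ltW // expr1n => e1.
  by rewrite -[LHS](divfK (lt0r_neq0 t0)) e1 mul1r.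
have h0 : hd (\val x) != 0 by rewrite -sqrf_eq0 s1 lt0r_neq0.
exists ((hd (\val x))^-1 *: tl (\val x)); last by rewrite chart_of.
by rewrite sqnormZ exprVn s1 mulVf // lt0r_neq0.
Qed.

Definition half_in (c : bool) (a : puncture chart) : topsum (puncture chart)
  (puncture chart) :=
  if c then topsum_inr _ a else topsum_inl _ a.

Lemma half_in_surj s : exists c a, s = half_in c a.
Proof. by case: s => -[] a; [exists true, a|exists false, a]. Qed.

Definition sum4 (s : topsum (puncture chart) (puncture chart)) : 'rV[R]_52 :=
  match s with
  | existT true a => map4 true (\val (a : puncture chart))
  | existT false a => map4 false (\val (a : puncture chart))
  end.

Lemma sum4E c a : sum4 (half_in c a) = map4 c (\val a).
Proof. by case: c. Qed.

Lemma sum4_continuous : continuous sum4.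
Proof.
have cm c : continuous (fun a : puncture chart => map4 c (\val a)).
  move=> a; exact: (continuous_val_at (f := map4 c) (@map4_continuous_at c a)).
by move=> [[] a] U nU; [exact: (cm true a U nU)|exact: (cm false a U nU)].
Qed.

Lemma puncture_rep (a : puncture chart) : exists2 x : S,
  outer (\val x) & \val a = pi x.
Proof.
have [x e] := quotient_by_pi_surj (\val a); exists x => //.
by apply/puncture_pi; rewrite -e; exact: (@set_valP _ _ a).
Qed.

Lemma RP3_sum_RP3_triangulation : has_triangulation_le R 15 (RP3_sum_RP3 R).
Proof.
apply: (flips_triangulation flips4_check).
apply: (@quotient_polyhedron_homeomorphic R _ _ _ _ sum4).
- apply: sigT_compact; first exact: finite_finset.
  by case; exact: puncture_compact.
- exact: sum4_continuous.
- move=> p q [a [b [v [-> -> v1 av bv]]]].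
  by rewrite -[topsum_inl _ _]/(half_in false a) -[topsum_inr _ _]/(half_in
    true b) !sum4E av bv map4_boundary.
- move=> p q; have [c [a ->]] := half_in_surj p;
  have [d [b ->]] := half_in_surj q.
  rewrite !sum4E; have [x ox ax] := puncture_rep a;
    have [y oy by_] := puncture_rep b.
  rewrite ax by_ => /(map4_fiber ox oy)[xy cd].
  (* Both points are the same point of RP^3. Within one summand they coincide; in different summands
     that point lies on the gluing sphere, and a single generating step relates the two. *)
  have ab : a = b by apply: val_inj; rewrite ax by_.
  have [->|ncd] := eqVneq c d; first by rewrite ab; exact: rst_refl.
  have [v v1 xv] := cd ncd.
  have step : clos_refl_sym_trans _ (fun p q : topsum (puncture chart)
    (puncture chart) =>
      exists (x : puncture chart) (y : puncture chart) (v : 'rV[R]_3),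
      [/\ p = topsum_inl _ x, q = topsum_inr _ y, sqnorm v = 1,
          \val x = chart v & \val y = chart v]) (half_in false a)
            (half_in true a).
    by apply: rst_step; exists a, a, v; split=> //; rewrite ax xv.
  rewrite -ab; case: c ncd {cd} => ncd; case: d ncd => // _.
  exact: rst_sym step.
- move=> p; have [c [a ->]] := half_in_surj p; rewrite sum4E.
  have [x ox ->] := puncture_rep a; rewrite map4_pi.
  by apply: push_polyhedron; [exact: mem_verts4|exact: p4_lt|exact:
    covers4|exact: coord4_point].
- move=> y /(push_surjective cmp4C mem_verts4 p4_lt p4_inj)[z /coord4_surj[c [x
  [x1 ox xe]]] <-].
  pose u : S := exist _ x (sphere_mem x1).
  have ua : pi u \in puncture chart by apply/mem_set/puncture_pi.
  exists (half_in c (exist _ (pi u) ua)); rewrite sum4E map4_pi.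
  by congr push; apply/funext.
Qed.
End DoubledHalves.

Theorem theorem11 (R : realType) :
  [/\ has_triangulation_le R 15 (sphere R 2 * sphere R 1)%type,
      has_triangulation_le R 15 (twisted_sphere_bundle R),
      has_triangulation_le R 15 (projective_space R 2 * sphere R 1)%type
    & has_triangulation_le R 15 (RP3_sum_RP3 R)].
Proof.
split.
- exact: product_sphere_circle_triangulation.
- exact: twisted_sphere_bundle_triangulation.
- exact: product_projective_circle_triangulation.
- exact: RP3_sum_RP3_triangulation.
Qed.
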